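(* Assume that $\mathbb{E}X=0$ and $a_X>1$. (No convergence of $m_t(1)$ and no bound on $m_t(r)$ for $r<1$ are imposed.) If $R_t\Rightarrow R$ as $t\to\star$, where $R$ is nondegenerate, then $$\begin{cases}m_t(a_X)\longrightarrow c\ \text{ for some }c\in(0,1],&\text{if }1<a_X<2,\\ m_t(2)\longrightarrow c\ \text{ for some }c\in(0,1],&\text{if }a_X\ge2.\end{cases}$$ If moreover $1<a_X<4$ and $\mathbb{E}|X|^{a_X}<\infty$, then $m_t$ converges, as $t\to\star$, locally uniformly on $\{s\in\mathbb{C}:\Re s>1\}$ to a holomorphic function $m$; in that case $m(q)>0$ for every real $q>1$.
   Context: $t$ ranges over $(0,\infty)$ and $t\to\star$ means either $t\downarrow0$ or $t\to\infty$ (one fixed choice). For each $t$, $P(t)=(P_j(t))_{j\ge1}$ is a random subprobability sequence: $P_j(t)\ge0$ and $\sum_{j\ge1}P_j(t)\le1$. $X,X_1,X_2,\ldots$ are iid real random variables, independent of the weights. Put $$R_t=\sum_{j\ge1}P_j(t)X_j,\qquad m_t(s)=\mathbb{E}\sum_{j\ge1}P_j(t)^s,$$ where zero weights are omitted and $x^s=\exp(s\log x)$ for $x>0$. The moment abscissa is $a_X=a_+\wedge a_-$, where $a_\pm=\sup\{q>0:\mathbb{E}X_\pm^q<\infty\}$, $X_+=\max(X,0)$, $X_-=\max(-X,0)$ (values in $[0,\infty]$). $\Rightarrow$ denotes convergence in distribution; nondegenerate means not almost surely constant. *)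

(* Defs.v *)
From HB Require Import structures.
From mathcomp Require Import all_boot all_order all_algebra.
From mathcomp Require Import finmap.
From mathcomp Require Import all_classical all_reals all_analysis.
From mathcomp Require Import complex.

Set Implicit Arguments.
Unset Strict Implicit.
Unset Printing Implicit Defensive.

Import Order.TTheory GRing.Theory Num.Theory.
Import numFieldNormedType.Exports.

Local Open Scope classical_set_scope.
Local Open Scope ring_scope.
Local Open Scope complex_scope.

Section probability.
Context d (T : measurableType d) (R : realType) (P : probability T R).

Definition sigma_of_family (I : Type) (f : I -> T -> R) : set (set T) :=
  <<s [set A | exists i (B : set R), measurable B /\ A = f i @^-1` B] >>.

Definition independent_families (I J : Type) (f : I -> T -> R)
    (g : J -> T -> R) : Prop :=
  forall A B : set T, sigma_of_family f A -> sigma_of_family g B ->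
  P (A `&` B) = (P A * P B)%E.

Definition mutually_independent (X : nat -> T -> R) : Prop :=
  forall (J : {fset nat}) (B : nat -> set R),
  (forall j, measurable (B j)) ->
  P (\bigcap_(j in [set` J]) (X j @^-1` B j)) =
  (\prod_(j <- J) P (X j @^-1` B j))%E.

Definition nondegenerate_rv (X : T -> R) : Prop :=
  ~ exists c : R, {ae P, forall w, X w = c}.

(* For nonnegative [Y].  The maximum with 0 is the convention sup(empty) = 0:
   in [\bar R] the supremum of the empty set is -oo. *)
Definition abscissa (Y : T -> R) : \bar R :=
  maxe (0%E : \bar R) (ereal_sup
    [set q%:E | q in [set q : R | 0 < q /\
                       ('E_P[fun w => powR (Y w) q] < +oo)%E]]).

Definition moment_abscissa (X : T -> R) : \bar R :=
  mine (abscissa (X^\+)%R) (abscissa (X^\-)%R).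

Definition cexpectation (Z : T -> R[i]) : R[i] :=
  (\int[P]_w complex.Re (Z w))%R +i* (\int[P]_w complex.Im (Z w))%R.

End probability.

(* Convergence of [E f(Y_t)] for all bounded continuous [f]; the limit variable
   may live on another probability space. *)
Definition cvg_in_distribution (R : realType) d (T : measurableType d)
    (P : probability T R) d' (T' : measurableType d') (P' : probability T' R)
    (F : set_system R) (Y : R -> T -> R) (Z : T' -> R) : Prop :=
  forall f : R -> R, continuous f -> bounded_fun f ->
  ('E_P[f \o Y t] @[t --> F] --> 'E_P'[f \o Z])%E.

Section weights.
Context (R : realType).

Definition is_subprobability (p : nat -> R) : Prop :=
  (forall j, 0 <= p j) /\ (\sum_(0 <= j <oo) (p j)%:E <= 1)%E.

Definition weighted_sum (T : Type) (p x : nat -> T -> R) (w : T) : R :=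
  limn (fun n => \sum_(0 <= j < n) p j w * x j w).

(* x^s = exp(s log x) = exp(Re s log x) (cos(Im s log x) + i sin(Im s log x)),
   meaningful for x > 0 only. *)
Definition cpow (x : R) (s : R[i]) : R[i] :=
  (expR (complex.Re s * ln x))%:C *
  (cos (complex.Im s * ln x) +i* sin (complex.Im s * ln x)).

(* [R[i]^o] is [R[i]] with its topology as a normed module over itself. *)
Definition power_sum (p : nat -> R) (s : R[i]) : R[i] :=
  limn ((fun n => \sum_(0 <= j < n | 0 < p j) cpow (p j) s) : nat -> R[i]^o).

Definition power_moment d (T : measurableType d) (P : probability T R)
    (p : nat -> T -> R) (s : R[i]) : R[i]^o :=
  cexpectation P (fun w => power_sum (p ^~ w) s).

Definition holomorphic_on (D : set R[i]^o) (f : R[i]^o -> R[i]^o) : Prop :=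
  forall z, D z -> derivable f z 1.

Definition cvg_locally_uniformly (F : set_system R) (D : set R[i]^o)
    (f : R -> R[i]^o -> R[i]^o) (g : R[i]^o -> R[i]^o) : Prop :=
  forall z, D z -> exists2 U : set R[i]^o, nbhs z U &
  {uniform U `&` D, f t @[t --> F] --> g}.

End weights.

(* Main.v *)
(* Write L_t(f) = E sum_j f(P_j(t)) and K(s) = E[|X|^s; |X| > 1]. For 1 < s < a,
   E|R_t|^s = H_t(|x|^s) + K(s) L_t(y^s), where H_t(phi) stays bounded for
   functions phi growing like |x|^q with q slightly larger than a, and by
   uniform integrability E|R_t|^s is determined in the limit by the law of R.
   Hence, if Lam is the difference of the limits of L_t along two ultrafilters
   finer than t -> star, then Lam(y^s) K(s) is, up to sign, the same difference
   for H_t; both Lam(y^s) and this difference have convergent Taylor expansions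
   at s = a. If some Taylor coefficient of Lam(y^s) at a did not vanish (the
   first one, or any one when K is bounded up to a), then K would have a
   one-sided expansion at a with geometrically bounded coefficients, and
   Landau's theorem for integrals of nonnegative functions would give a finite
   moment of X of order larger than a, contradicting the definition of a. So
   L_t(y^a) converges, and when E|X|^a is finite all the derivatives of L_t(y^s)
   at s = a converge; moving along discs, these limits propagate to the half
   plane Re s > 1. When a > 2, E|R_t|^2 = E X^2 L_t(y^2) replaces this argument.
   The limits are positive because L_t(y^q) -> 0 for one q > 1 makes L_t(y^2)
   vanish in the limit, and then R_t -> 0 in probability by truncating X. *)
Require Import Defs.
From HB Require Import structures.
From mathcomp Require Import all_boot all_order all_algebra.
From mathcomp Require Import finmap.
From mathcomp Require Import all_classical all_reals all_analysis.
From mathcomp Require Import complex ring lra measurable_realfun.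

Set Implicit Arguments.
Unset Strict Implicit.
Unset Printing Implicit Defensive.

Import Order.TTheory GRing.Theory Num.Theory.
Import numFieldNormedType.Exports.

Local Open Scope classical_set_scope.
Local Open Scope ring_scope.
Local Open Scope complex_scope.

(** * Remainders of the exponential series *)

Section exponential_remainder.
Context {R : realType}.
Implicit Types (c : nat -> R) (N : nat) (h x : R).

(** The expansions of the functionals are obtained without interchanging a power series and an
    expectation. A functional is bounded on a class of functions, each carrying a constant, and the
    Taylor remainder of order N of y^(b+z) in z lies in the class with a constant of order
    (|z|/delta)^N. The price is a factor e^(delta |ln y|), a shift of the exponent by delta.
    Linearity and one bound, uniform in t, then suffice, and both survive a limit along an
    ultrafilter, where all functionals converge at once without extraction of subsequences. The
    obstacle is that H_t must be analytic on both sides of a although X has moments below a only.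
    Once the terms phi(p_j x_j) with |x_j| > 1 are removed, what remains is bounded by terms linear
    in |x_j| and by products |x_i| |x_j|^q with i different from j. Their expectations need moments
    of orders 1 and q < a, while phi may grow with degree q + 1 > a. *)

Lemma le_of_derive_le (f g df dg : R -> R) :
  (forall x : R, is_derive x 1 f (df x)) -> (forall x : R, is_derive x 1 g (dg x)) ->
  f 0 <= g 0 -> (forall x, 0 <= x -> df x <= dg x) ->
  forall x, 0 <= x -> f x <= g x.
Proof.
move=> fd gd fg0 dfg x; rewrite le_eqVlt => /predU1P[<- //|x0].
have hd (y : R) : is_derive y 1 (g - f) (dg y - df y) by apply: is_deriveB.
have [|z /[!in_itv]/= /andP[z0 _]] := MVT x0 (fun y _ => hd y).
  apply/continuous_subspaceT => y.
  by apply/differentiable_continuous/derivable1_diffP; case: (hd y).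
rewrite !fctE subr0 => e.
have : 0 <= (dg z - df z) * x by rewrite mulr_ge0 ?subr_ge0 ?dfg ?ltW.
rewrite -e; move: fg0; lra.
Qed.

(** A truncated exponential generating function: differentiation shifts the coefficients, so one
    rule covers the Taylor polynomials of the exponential and the real and imaginary parts of their
    complex analogues. *)
Definition egf c N h : R := \sum_(j < N) c j * (h ^+ j / j`!%:R).

Lemma is_derive_egf c N h :
  is_derive h 1 (egf c N) (egf (fun j => c j.+1) N.-1 h).
Proof.
case: N => [|N] /=.
  rewrite [egf c 0](_ : _ = cst 0) /egf ?big_ord0; last first.
    by apply/funext => y; rewrite big_ord0.
  exact: is_derive_cst.
elim: N => [|N IH].
  rewrite {2}/egf big_ord0 [X in is_derive _ _ X](_ : _ = cst (c 0%N)); last first.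
    by apply/funext => y; rewrite /egf big_ord_recl big_ord0/= expr0 divr1 mulr1 addr0.
  exact: is_derive_cst.
rewrite [egf c N.+2](_ : _ = egf c N.+1 + (c N.+1 / N.+1`!%:R) *: (@GRing.exp R ^~ N.+1)); last first.
  apply/funext => y; rewrite /egf big_ord_recr/= !fctE/=; congr (_ + _).
  by rewrite /GRing.scale/= mulrA mulrAC.
have -> : egf (fun j => c j.+1) N.+1 h = egf (fun j => c j.+1) N h +
   (c N.+1 / N.+1`!%:R) *: ((N.+1)%:R * h ^+ N).
  rewrite /egf big_ord_recr/= /GRing.scale/=; congr (_ + _); rewrite factS natrM.
  by field; rewrite !pnatr_eq0 -lt0n fact_gt0/=.
apply: is_deriveD.
apply: is_deriveZ.
have := @is_deriveX _ _ id N.+1 h 1 1 (is_derive_id _ _).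
rewrite /GRing.scale/= mulr1; congr is_derive.
by apply/funext => y; rewrite exprfctE.
Qed.

Lemma egf0S c N : egf c N.+1 0 = c 0%N.
Proof.
rewrite /egf big_ord_recl/= expr0 divr1 mulr1 big1 ?addr0// => j _.
by rewrite exprS mul0r mul0r mulr0.
Qed.

Lemma is_derive_expRM (k h : R) : is_derive h 1 (fun y => expR (k * y)) (k * expR (k * h)).
Proof.
rewrite mulrC.
have := @is_derive1_comp _ expR (fun y => k * y) h (expR (k * h)) k (is_derive_expR _).
apply; have := @is_deriveZ _ _ _ id k h 1 1 (is_derive_id h 1).
by rewrite /GRing.scale/= mulr1.
Qed.

Lemma is_derive_cosM (k h : R) : is_derive h 1 (fun y => cos (k * y)) (- (k * sin (k * h))).
Proof.
rewrite mulrC -mulNr.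
have := @is_derive1_comp _ cos (fun y => k * y) h (- sin (k * h)) k (is_derive_cos _).
apply; have := @is_deriveZ _ _ _ id k h 1 1 (is_derive_id h 1).
by rewrite /GRing.scale/= mulr1.
Qed.

Lemma is_derive_sinM (k h : R) : is_derive h 1 (fun y => sin (k * y)) (k * cos (k * h)).
Proof.
rewrite mulrC.
have := @is_derive1_comp _ sin (fun y => k * y) h (cos (k * h)) k (is_derive_sin _).
apply; have := @is_deriveZ _ _ _ id k h 1 1 (is_derive_id h 1).
by rewrite /GRing.scale/= mulr1.
Qed.

Definition exp_rem N h : R := expR h - egf (fun=> 1) N h.

Lemma exp_rem0 h : exp_rem 0 h = expR h.
Proof. by rewrite /exp_rem /egf big_ord0 subr0. Qed.

Lemma exp_remS N h : exp_rem N.+1 h = exp_rem N h - h ^+ N / N`!%:R.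
Proof. by rewrite /exp_rem /egf big_ord_recr/= mul1r opprD addrA. Qed.

Lemma exp_remS0 N : exp_rem N.+1 0 = 0.
Proof. by rewrite /exp_rem egf0S expR0 subrr. Qed.

Lemma egf_scale (k : R) c N h : egf c N (k * h) = egf (fun j => k ^+ j * c j) N h.
Proof.
by apply: eq_bigr => j _; rewrite exprMn; ring.
Qed.

Lemma is_derive_exp_rem (k : R) N h :
  is_derive h 1 (fun y => exp_rem N.+1 (k * y)) (k * exp_rem N (k * h)).
Proof.
rewrite (_ : (fun y => _) = (fun y => expR (k * y)) - egf (fun j => k ^+ j * 1) N.+1); last first.
  by apply/funext => y; rewrite /exp_rem egf_scale.
rewrite (_ : k * _ = k * expR (k * h) - egf (fun j => k ^+ j.+1 * 1) N h); last first.
  rewrite /exp_rem mulrBr egf_scale /egf mulr_sumr; congr (_ - _).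
  by apply: eq_bigr => j _; rewrite exprS !mulrA.
apply: is_deriveB; first exact: is_derive_expRM.
exact: is_derive_egf.
Qed.

Lemma exp_rem_ge0 N h : 0 <= h -> 0 <= exp_rem N h.
Proof.
elim: N h => [h _|N IH]; first by rewrite exp_rem0 expR_ge0.
apply: (@le_of_derive_le (cst 0) (exp_rem N.+1) (cst 0) (exp_rem N)) => //=.
  move=> x; have := is_derive_exp_rem 1 N x.
  rewrite !mul1r; congr is_derive; apply/funext => y; by rewrite mul1r.
by rewrite exp_remS0.
Qed.

(** Differentiating in [h] lowers [N] on both sides, down to [expR (k * h) <= expR h]; the
    comparison integrates back because both sides vanish at 0 when the order is positive. *)
Lemma exp_rem_scale N (k : R) h : 0 <= k <= 1 -> 0 <= h ->
  exp_rem N (k * h) <= k ^+ N * exp_rem N h.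
Proof.
move=> /andP[k0 k1]; elim: N h => [h h0|N IH].
  by rewrite !exp_rem0 mul1r ler_expR ler_piMl.
apply: (@le_of_derive_le (fun h => exp_rem N.+1 (k * h)) (fun h => k ^+ N.+1 * exp_rem N.+1 h) (fun h => k * exp_rem N (k * h))
    (fun h => k ^+ N.+1 * exp_rem N h)).
- by move=> x; exact: is_derive_exp_rem.
- move=> x; have := is_derive_exp_rem 1 N x; rewrite mul1r => /(@is_deriveZ _ _ _ _ (k ^+ N.+1)).
  rewrite /GRing.scale/= mul1r; congr is_derive; apply/funext => y; by rewrite /GRing.scale_fun /= mul1r.
- by rewrite /= mulr0 !exp_remS0 mulr0.
- by move=> x x0; rewrite exprS -mulrA ler_wpM2l// IH.
Qed.

Lemma exp_rem_le N h : 0 <= h -> exp_rem N h <= expR h.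
Proof.
move=> h0; rewrite /exp_rem lerBlDr lerDl /egf sumr_ge0// => j _.
by rewrite mul1r mulr_ge0 ?exprn_ge0// invr_ge0.
Qed.

(** The alternating series estimate: the derivative of a signed remainder is the preceding signed
    remainder, so both bounds integrate from 0. *)
Lemma exp_rem_neg N h : 0 <= h ->
  0 <= (-1) ^+ N * exp_rem N (- h) <= h ^+ N / N`!%:R.
Proof.
elim: N h => [h h0|N IH h h0].
  by rewrite exp_rem0 expr0 mul1r divr1 expR_ge0/= expr0 -expR0 ler_expR; lra.
have dN x : is_derive x 1 (fun h => (-1) ^+ N.+1 * exp_rem N.+1 (- h)) ((-1) ^+ N * exp_rem N (- x)).
  have := is_derive_exp_rem (-1) N x => /(@is_deriveZ _ _ _ _ ((-1) ^+ N.+1)).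
  rewrite /GRing.scale/= exprS !mulN1r mulrNN; congr is_derive.
  by apply/funext => y; rewrite /GRing.scale_fun /GRing.scale/= mulN1r.
apply/andP; split.
  apply: (@le_of_derive_le (cst 0) (fun h => (-1) ^+ N.+1 * exp_rem N.+1 (- h)) (cst 0) (fun h => (-1) ^+ N * exp_rem N (- h))) => //=.
    by rewrite oppr0 exp_remS0 mulr0.
  by move=> x /IH/andP[].
(* The monomial is written as an [egf] with a single coefficient, so that its derivative is an
   instance of [is_derive_egf]. *)
pose c j : R := (j == N.+1)%:R.
have cE y : egf c N.+2 y = y ^+ N.+1 / N.+1`!%:R.
  rewrite /egf big_ord_recr/= big1 ?add0r ?/c ?eqxx ?mul1r// => j _.
  by rewrite (ltn_eqF (ltn_ord j)) mul0r.
have cE' y : egf (fun j => c j.+1) N.+1 y = y ^+ N / N`!%:R.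
  rewrite /egf big_ord_recr/= big1 ?add0r ?/c ?eqxx ?mul1r// => j _.
  by rewrite eqSS (ltn_eqF (ltn_ord j)) mul0r.
rewrite -cE.
apply: (@le_of_derive_le _ (egf c N.+2) (fun h => (-1) ^+ N * exp_rem N (- h)) (egf (fun j => c j.+1) N.+1)) => //=.
- by move=> x; exact: is_derive_egf.
- by rewrite oppr0 exp_remS0 mulr0 cE expr0n/= mul0r.
- by move=> x x0; rewrite cE'; have /andP[] := IH _ x0.
Qed.

End exponential_remainder.

Section complex_exponential_remainder.
Context {R : realType}.
Implicit Types (N : nat) (z w : R[i]) (h l : R).

(** The modulus as an element of [R]; the norm of [R[i]] takes its values in [R[i]] itself. *)
Definition cnorm z : R := Normc.normc z.

Definition cexp z : R[i] :=
  (expR (complex.Re z))%:C * (cos (complex.Im z) +i* sin (complex.Im z)).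

Definition cexp_rem N z : R[i] := cexp z - \sum_(j < N) z ^+ j / j`!%:R.

Lemma cnormE z : cnorm z = Num.sqrt (complex.Re z ^+ 2 + complex.Im z ^+ 2).
Proof. by case: z. Qed.

Lemma cexp_rem0 z : cexp_rem 0 z = cexp z.
Proof. by rewrite /cexp_rem big_ord0 subr0. Qed.

Lemma cexp_remS N z : cexp_rem N.+1 z = cexp_rem N z - z ^+ N / N`!%:R.
Proof. by rewrite /cexp_rem big_ord_recr/= opprD addrA. Qed.

Lemma ReB z w : complex.Re (z - w) = complex.Re z - complex.Re w.
Proof. by rewrite raddfB. Qed.
Lemma ImB z w : complex.Im (z - w) = complex.Im z - complex.Im w.
Proof. by rewrite raddfB. Qed.
Lemma ReM z w : complex.Re (z * w) =
  complex.Re z * complex.Re w - complex.Im z * complex.Im w.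
Proof. by case: z w => ? ? [? ?]. Qed.
Lemma ImM z w : complex.Im (z * w) =
  complex.Re z * complex.Im w + complex.Im z * complex.Re w.
Proof. by case: z w => ? ? [? ?]. Qed.

Lemma ReMr (k : R) z : complex.Re (k%:C * z) = k * complex.Re z.
Proof. by rewrite ReM/= mul0r subr0. Qed.
Lemma ImMr (k : R) z : complex.Im (k%:C * z) = k * complex.Im z.
Proof. by rewrite ImM/= mul0r addr0. Qed.

Lemma cexp_rem_termE z (h : R) j : (h%:C * z) ^+ j / j`!%:R =
  (h ^+ j / j`!%:R)%:C * z ^+ j.
Proof.
by rewrite exprMn rmorphM/= rmorphXn/= fmorphV rmorph_nat mulrAC.
Qed.

Lemma Re_cexp_rem N z h : complex.Re (cexp_rem N (h%:C * z)) =
  expR (complex.Re z * h) * cos (complex.Im z * h) -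
  egf (fun j => complex.Re (z ^+ j)) N h.
Proof.
rewrite /cexp_rem ReB /cexp ReMr ReMr ImMr; congr (_ * _ - _).
- by rewrite mulrC.
- by rewrite mulrC.
- rewrite raddf_sum; apply: eq_bigr => j _.
  by rewrite -[LHS]/(complex.Re _) cexp_rem_termE ReMr mulrC.
Qed.

Lemma Im_cexp_rem N z h : complex.Im (cexp_rem N (h%:C * z)) =
  expR (complex.Re z * h) * sin (complex.Im z * h) -
  egf (fun j => complex.Im (z ^+ j)) N h.
Proof.
rewrite /cexp_rem ImB /cexp ImMr ReMr ImMr; congr (_ * _ - _).
- by rewrite mulrC.
- by rewrite mulrC.
- rewrite raddf_sum; apply: eq_bigr => j _.
  by rewrite -[LHS]/(complex.Im _) cexp_rem_termE ImMr mulrC.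
Qed.

Lemma is_derive_Re_cexp_rem N z h :
  is_derive h 1 (fun h => complex.Re (cexp_rem N.+1 (h%:C * z)))
    (complex.Re (z * cexp_rem N (h%:C * z))).
Proof.
rewrite ReM Re_cexp_rem Im_cexp_rem.
rewrite (_ : (fun _ => _) = (fun h => expR (complex.Re z * h)) * (fun h => cos (complex.Im z * h)) -
  egf (fun j => complex.Re (z ^+ j)) N.+1); last by apply/funext => y; rewrite Re_cexp_rem.
set a := complex.Re z; set b := complex.Im z.
have /= H := is_deriveB (is_deriveM (is_derive_expRM a h) (is_derive_cosM b h)) (is_derive_egf (fun j => complex.Re (z ^+ j)) N.+1 h).
apply: is_derive_eq H _.
have -> : egf (fun j => complex.Re (z ^+ j.+1)) N h =
  a * egf (fun j => complex.Re (z ^+ j)) N h - b * egf (fun j => complex.Im (z ^+ j)) N h.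
  rewrite /egf !mulr_sumr -sumrB; apply: eq_bigr => j _.
  by rewrite exprS ReM -/a -/b; ring.
by rewrite /GRing.scale/=; ring.
Qed.

Lemma is_derive_Im_cexp_rem N z h :
  is_derive h 1 (fun h => complex.Im (cexp_rem N.+1 (h%:C * z)))
    (complex.Im (z * cexp_rem N (h%:C * z))).
Proof.
rewrite ImM Re_cexp_rem Im_cexp_rem.
rewrite (_ : (fun _ => _) = (fun h => expR (complex.Re z * h)) * (fun h => sin (complex.Im z * h)) -
  egf (fun j => complex.Im (z ^+ j)) N.+1); last by apply/funext => y; rewrite Im_cexp_rem.
set a := complex.Re z; set b := complex.Im z.
have /= H := is_deriveB (is_deriveM (is_derive_expRM a h) (is_derive_sinM b h)) (is_derive_egf (fun j => complex.Im (z ^+ j)) N.+1 h).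
apply: is_derive_eq H _.
have -> : egf (fun j => complex.Im (z ^+ j.+1)) N h =
  a * egf (fun j => complex.Im (z ^+ j)) N h + b * egf (fun j => complex.Re (z ^+ j)) N h.
  rewrite /egf !mulr_sumr -big_split/=; apply: eq_bigr => j _.
  by rewrite exprS ImM -/a -/b; ring.
by rewrite /GRing.scale/=; ring.
Qed.

Lemma cexp_rem0E N : cexp_rem N.+1 0 = 0.
Proof.
rewrite /cexp_rem big_ord_recl big1 => [|j _]; last by rewrite exprS mul0r mul0r.
rewrite /cexp/= expR0 cos0 sin0 fact0 divr1 mul1r addr0 expr0.
by apply/eqP; rewrite subr_eq0 eq_complex/= !eqxx.
Qed.

(* A rotation turns the modulus of the remainder into the real part of a
   multiple, whose derivative along a ray can be bounded inductively. *)
Lemma cexp_rem_dir N z (u w : R) h : 0 <= h ->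
  u * complex.Re (cexp_rem N (h%:C * z)) + w * complex.Im (cexp_rem N (h%:C * z))
  <= Num.sqrt (u ^+ 2 + w ^+ 2) * exp_rem N (cnorm z * h).
Proof.
have CS (a b c d : R) : a * c + b * d <= Num.sqrt (a ^+ 2 + b ^+ 2) * Num.sqrt (c ^+ 2 + d ^+ 2).
  apply: le_trans (ler_norm _) _.
  rewrite -sqrtrM ?addr_ge0 ?sqr_ge0// -sqrtr_sqr ler_wsqrtr//.
  rewrite -subr_ge0 (_ : _ - _ = (a * d - b * c) ^+ 2) ?sqr_ge0//; ring.
elim: N u w h => [u w h h0|N IH u w].
  rewrite cexp_rem0 exp_rem0 /cexp !ReMr !ImMr/=.
  set e := expR (h * complex.Re z); set k := cos _; set s := sin _.
  have -> : u * (e * k) + w * (e * s) = e * (u * k + w * s) by ring.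
  apply: (@le_trans _ _ (e * Num.sqrt (u ^+ 2 + w ^+ 2))).
    rewrite ler_wpM2l ?expR_ge0//; apply: le_trans (CS _ _ _ _) _.
    by rewrite cos2Dsin2 sqrtr1 mulr1.
  rewrite mulrC ler_wpM2l ?sqrtr_ge0// ler_expR mulrC ler_wpM2r// cnormE.
  apply: le_trans (ler_norm _) _.
  by rewrite -sqrtr_sqr ler_wsqrtr// lerDl sqr_ge0.
have := (@le_of_derive_le R
  (fun h => u * complex.Re (cexp_rem N.+1 (h%:C * z)) + w * complex.Im (cexp_rem N.+1 (h%:C * z)))
  (fun h => Num.sqrt (u ^+ 2 + w ^+ 2) * exp_rem N.+1 (cnorm z * h))
  (fun h => u * complex.Re (z * cexp_rem N (h%:C * z)) + w * complex.Im (z * cexp_rem N (h%:C * z)))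
  (fun h => Num.sqrt (u ^+ 2 + w ^+ 2) * (cnorm z * exp_rem N (cnorm z * h)))); apply.
- move=> x; apply: is_deriveD; apply: is_deriveZ.
    exact: is_derive_Re_cexp_rem.
  exact: is_derive_Im_cexp_rem.
- move=> x; apply: is_deriveZ; exact: is_derive_exp_rem.
- by rewrite mul0r cexp_rem0E [cnorm z * 0]mulr0 exp_remS0/= !mulr0 addr0.
move=> x x0; rewrite ReM ImM; set a := complex.Re z; set b := complex.Im z.
set A := complex.Re _; set B := complex.Im _.
have -> : u * (a * A - b * B) + w * (a * B + b * A) = (u * a + w * b) * A + (w * a - u * b) * B by ring.
apply: le_trans (IH _ _ _ x0) _.
rewrite le_eqVlt; apply/orP; left; apply/eqP.
rewrite mulrA; congr (_ * _); rewrite cnormE -sqrtrM ?addr_ge0 ?sqr_ge0//.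
by congr Num.sqrt; rewrite -/a -/b; ring.
Qed.

(** The two roles are separated: the first factor is geometric in [N] and does not see [l], the
    second does not see [z] or [N]. With [l = ln y] the second is a power of [y] of exponent [d] or
    [- d]. *)
Lemma cnorm_cexp_rem N z l (d : R) : 0 < d -> cnorm z <= d ->
  cnorm (cexp_rem N (z * l%:C)) <= (cnorm z / d) ^+ N * expR (d * `|l|).
Proof.
move=> d0 zd.
have key y (h : R) : 0 <= h -> cnorm (cexp_rem N (h%:C * y)) <= exp_rem N (cnorm y * h).
  (* Taking the remainder itself as the direction turns the left side into its squared modulus, and
     one factor cancels. *)
  move=> h0; have := cexp_rem_dir N y (complex.Re (cexp_rem N (h%:C * y))) (complex.Im (cexp_rem N (h%:C * y))) h0.
  rewrite -!expr2 -cnormE -[X in X <= _]sqr_sqrtr ?addr_ge0 ?sqr_ge0// -cnormE expr2.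
  have [<- _|] := eqVneq 0 (cnorm (cexp_rem N (h%:C * y))).
    by rewrite exp_rem_ge0// mulr_ge0// cnormE sqrtr_ge0.
  rewrite eq_sym => n0; rewrite ler_pM2l// lt_neqAle eq_sym n0.
  by rewrite cnormE sqrtr_ge0.
have nz0 : 0 <= cnorm z by rewrite cnormE sqrtr_ge0.
apply: (@le_trans _ _ (exp_rem N (cnorm z * `|l|))).
  have [l0|l0] := leP 0 l.
    by rewrite mulrC (ger0_norm l0) key.
  have -> : z * l%:C = (- l)%:C * - z by rewrite rmorphN/= mulrNN mulrC.
  have -> : cnorm z = cnorm (- z) by rewrite !cnormE !raddfN/= !sqrrN.
  by rewrite (ltr0_norm l0) key// oppr_ge0 ltW.
have -> : cnorm z * `|l| = (cnorm z / d) * (d * `|l|) by field; rewrite gt_eqF.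
have dl0 : 0 <= d * `|l| by rewrite mulr_ge0// ltW.
apply: le_trans (exp_rem_scale _ _ dl0) _.
  by rewrite divr_ge0 ?(ltW d0)//= ler_pdivrMr// mul1r.
by rewrite ler_wpM2l ?exp_rem_le// exprn_ge0// divr_ge0// ltW.
Qed.

Lemma normr_exp_rem N (z l d : R) : 0 < d -> `|z| <= d ->
  `|exp_rem N (z * l)| <= (`|z| / d) ^+ N * expR (d * `|l|).
Proof.
move=> d0 zd.
have := @cnorm_cexp_rem N z%:C l d d0; rewrite !cnormE/= expr0n/= addr0 sqrtr_sqr => /(_ zd).
apply: le_trans; rewrite -rmorphM/= -[X in cexp_rem N X]mulr1 Re_cexp_rem Im_cexp_rem/=.
rewrite mul1r !mul0r cos0 sin0 mulr1 mulr0.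
have -> : egf (fun j => complex.Im (1 ^+ j : R[i])) N (z * l) = 0.
  by rewrite /egf big1// => j _; rewrite expr1n mul0r.
have -> : egf (fun j => complex.Re (1 ^+ j : R[i])) N (z * l) = egf (fun=> 1) N (z * l).
  by apply: eq_bigr => j _; rewrite expr1n.
by rewrite subrr expr0n/= addr0 sqrtr_sqr.
Qed.
End complex_exponential_remainder.

(** * One-sided expansions and Landau's theorem *)

Section expansions.
Context {R : realType}.
Implicit Types (F D K : R -> R) (f d q : nat -> R).

(** Only negative [z] occur because moments of order [a + z] are known to be finite on that side
    only. One pair of constants serves all orders, which forces geometric growth of the
    coefficients. *)
Definition expansion (r rho C : R) F f := forall N z, - r < z < 0 ->
  `|F z - \sum_(i < N) f i * z ^+ i| <= C * (rho * `|z|) ^+ N.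

Lemma expansion_shift r rho C F f : 0 <= rho -> expansion r rho C F f ->
  expansion r rho (C * rho) (fun z => (F z - f 0%N) / z) (fun i => f i.+1).
Proof.
move=> rho0 H N z zr; have := H N.+1 z zr.
have z0 : z != 0 by rewrite lt_eqF//; case/andP: zr.
rewrite big_ord_recl/= expr0 mulr1.
have -> : F z - (f 0%N + \sum_(i < N) f (bump 0 i) * z ^+ (bump 0 i)) =
  ((F z - f 0%N) / z - \sum_(i < N) f i.+1 * z ^+ i) * z.
  rewrite mulrBl divfK// mulr_suml opprD addrA; congr (_ - _).
  by apply: eq_bigr => i _; rewrite /bump/= add1n exprSr mulrA.
rewrite normrM exprS.
have -> : C * (rho * `|z| * (rho * `|z|) ^+ N) = (C * rho * (rho * `|z|) ^+ N) * `|z| by ring.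
by rewrite ler_pM2r// normr_gt0.
Qed.

Lemma expansionD r rho C C' F G f g (c : R) : expansion r rho C F f -> expansion r rho C' G g ->
  expansion r rho (C + `|c| * C') (fun z => F z + c * G z) (fun i => f i + c * g i).
Proof.
move=> HF HG N z zr.
have -> : F z + c * G z - \sum_(i < N) (f i + c * g i) * z ^+ i =
  (F z - \sum_(i < N) f i * z ^+ i) + c * (G z - \sum_(i < N) g i * z ^+ i).
  rewrite mulrBr mulr_sumr (eq_bigr (fun i : 'I_N => f i * z ^+ i + c * (g i * z ^+ i))).
    by rewrite big_split/=; ring.
  by move=> i _; ring.
apply: le_trans (ler_normD _ _) _; rewrite mulrDl lerD ?HF// normrM -mulrA.
by rewrite ler_wpM2l// HG.
Qed.

Lemma expansion_le r rho C C' D dd : 0 <= rho -> C <= C' -> expansion r rho C D dd -> expansion r rho C' D dd.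
Proof.
move=> r0 CC h N z zr; apply: le_trans (h N z zr) _; rewrite ler_wpM2r// exprn_ge0// mulr_ge0//.
Qed.

Lemma expansion_lim r rho C F f z : expansion r rho C F f -> - r < z < 0 ->
  `|F z - f 0%N| <= C * (rho * `|z|).
Proof. by move=> H /(H 1%N); rewrite big_ord1 expr0 mulr1 expr1. Qed.

Lemma expansion_bound r rho C F f z : expansion r rho C F f -> - r < z < 0 -> `|F z| <= C.
Proof. by move=> H /(H 0%N); rewrite big_ord0 subr0 expr0 mulr1. Qed.

Lemma le_of_small (r x A : R) : 0 < r -> 0 <= A ->
  (forall z, - r < z < 0 -> x <= A * `|z|) -> x <= 0.
Proof.
move=> r0 A0 H; rewrite leNgt; apply/negP => x0.
pose e := Num.min (r / 2) (x / (A + 1) / 2).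
have e0 : 0 < e by rewrite lt_min !divr_gt0//; lra.
have := H (- e); rewrite normrN (gtr0_norm e0).
have : e <= r / 2 by rewrite ge_min lexx.
have er : e <= x / (A + 1) / 2 by rewrite ge_min lexx orbT.
move=> er2 HH.
have h1 : x <= A * e by apply: HH; lra.
have h2 : A * e <= A * (x / (A + 1) / 2) by rewrite ler_wpM2l.
have h3 : A * (x / (A + 1) / 2) = x * (A / (A + 1)) / 2 by ring.
have h4 : A / (A + 1) <= 1 by rewrite ler_pdivrMr; lra.
have h5 : x * (A / (A + 1)) <= x * 1 by rewrite ler_wpM2l// ltW.
lra.
Qed.

Lemma expansion_coef0 r rho C F f : 0 < r -> 0 <= rho -> 0 <= C -> expansion r rho C F f ->
  `|f 0%N| <= C.
Proof.
move=> r0 rho0 C0 H; rewrite -subr_le0.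
apply: (@le_of_small r _ (C * rho)) => //; first by rewrite mulr_ge0.
move=> z zr; rewrite lerBlDl.
have h1 := expansion_lim H zr; have h2 := expansion_bound H zr.
rewrite -mulrA; apply: le_trans (lerD h2 h1).
by rewrite -{1}(subKr (F z) (f 0%N)) ler_normB.
Qed.

(** Weaker than [expansion]: the constant may depend on the order. This form is what [landau] uses,
    next to a separate geometric bound on the coefficients. *)
Definition asymptotic (r : R) K q := forall n, exists C, forall z, - r < z < 0 ->
  `|K z - \sum_(j < n.+1) q j * z ^+ j| <= C * `|z| ^+ n.+1.

Section division.
Variables (d tau : nat -> R).
(** Long division of the series [tau] by [d]: the coefficients of the remainder after [n] steps,
    divided by the [n]-th power of the variable. The leading coefficients over [d 0] form the
    quotient [div_series]. *)
Fixpoint div_coef n : nat -> R := match n with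
  | 0 => tau
  | n.+1 => fun i => div_coef n i.+1 - div_coef n 0%N / d 0%N * d i.+1
  end.
Definition div_series n := div_coef n 0%N / d 0%N.
End division.

(** Long division is carried out on functions and coefficients together: every partial remainder is
    again a function with an [expansion], so its constant bounds the next coefficient of the
    quotient. *)
Lemma expansion_div0 r rho C D T K d tau : 0 < r -> 0 < rho -> 0 <= C ->
  expansion r rho C D d -> expansion r rho C T tau ->
  (forall z, - r < z < 0 -> D z * K z = T z) -> d 0%N != 0 ->
  exists r' A sigma q, [/\ 0 < r' <= r, 0 < sigma, 0 <= A,
     forall n, `|q n| <= A * sigma ^+ n & asymptotic r' K q].
Proof.
move=> r0 rho0 C0 HD HT DK d0.
pose q := div_series d tau.
(* A division step replaces [F], of constant [C'], by [(F - q n * D) / z]. As [|q n| <= C' / |d 0|],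
   the new constant is at most [(C' + C' / |d 0| * C) * rho], that is [C' * sigma]. *)
pose sigma := (1 + C / `|d 0%N|) * rho.
have nd0 : 0 < `|d 0%N| by rewrite normr_gt0.
have s0 : 0 < sigma.
  by rewrite mulr_gt0// ltr_wpDr// divr_ge0.
have key n : exists2 F, expansion r rho (C * sigma ^+ n) F (div_coef d tau n) &
    forall z, - r < z < 0 -> z ^+ n * F z = D z * (K z - \sum_(j < n) q j * z ^+ j).
  elim: n => [|n [F HF FE]].
    exists T; first by rewrite expr0 mulr1.
    by move=> z zr; rewrite big_ord0 subr0 DK// expr0 mul1r.
  exists (fun z => (F z + (- q n) * D z - 0) / z).
    have := expansion_shift (ltW rho0) (expansionD (- q n) HF HD).
    have -> : div_coef d tau n 0 + - q n * d 0%N = 0 by rewrite /q /div_series; field.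
    move=> H N z zr; have := H N z zr; rewrite /=.
    under [in X in X -> _]eq_bigr do rewrite mulNr.
    move=> /le_trans; apply; rewrite ler_wpM2r ?exprn_ge0 ?mulr_ge0 ?(ltW rho0)//.
    rewrite exprSr mulrA /sigma mulrA ler_wpM2r ?(ltW rho0)// mulrDr mulr1 lerD2l normrN.
    rewrite mulrCA mulrC ler_wpM2l// /q /div_series normrM normfV ler_wpM2r ?invr_ge0//.
    apply: expansion_coef0 HF => //; first exact: ltW.
    by rewrite mulr_ge0// exprn_ge0// ltW.
  move=> z zr; have z0 : z != 0 by rewrite lt_eqF//; case/andP: zr.
  rewrite big_ord_recr/= opprD addrA mulrDr -FE// exprSr subr0; by field.
(* For [|z|] below [r'], [D z] differs from [d 0] by at most half of [|d 0|], hence stays away from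
   0. *)
pose r' := Num.min r (`|d 0%N| / 2 / (C * rho + 1)).
have Cr1 : 0 < C * rho + 1 by rewrite ltr_wpDl// mulr_ge0// ltW.
exists r', (C / `|d 0%N|), sigma, q; split => //.
- by rewrite /r' lt_min r0 !divr_gt0//= ge_min lexx.
- by rewrite divr_ge0.
- move=> n; rewrite /q /div_series normrM normfV mulrAC ler_wpM2r ?invr_ge0//.
  have [F HF _] := key n.
  apply: expansion_coef0 HF => //; first exact: ltW.
  by rewrite mulr_ge0// exprn_ge0// ltW.
- move=> n; have [F HF FE] := key n.+1.
  exists (2 / `|d 0%N| * (C * sigma ^+ n.+1)) => z zr'.
  have zr : - r < z < 0.
    case/andP: zr' => h1 ->; rewrite andbT; apply: le_lt_trans h1.
    by rewrite lerN2 ge_min lexx.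
  have Dz : `|d 0%N| / 2 <= `|D z|.
    have h1 := expansion_lim HD zr.
    have h2 : `|z| <= `|d 0%N| / 2 / (C * rho + 1).
      rewrite ltr0_norm; last by case/andP: zr.
      case/andP: zr' => + _; rewrite ltrNl => /ltW/le_trans; apply.
      by rewrite ge_min lexx orbT.
    have h3 : C * (rho * `|z|) <= `|d 0%N| / 2.
      move: h2; rewrite ler_pdivlMr// => h2; apply: le_trans h2.
      by rewrite mulrA mulrC ler_wpM2l// lerDl.
    have h4 : `|d 0%N| <= `|D z| + `|D z - d 0%N|.
      by rewrite -{1}(subKr (D z) (d 0%N)) ler_normB.
    lra.
  have Fz := expansion_bound HF zr.
  have Dz0 : 0 < `|D z| by apply: lt_le_trans Dz; rewrite divr_gt0.
  have : `|D z| * `|K z - \sum_(j < n.+1) q j * z ^+ j| <= `|z| ^+ n.+1 * (C * sigma ^+ n.+1).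
    by rewrite -normrM -FE// normrM normrX ler_wpM2l// exprn_ge0.
  rewrite -ler_pdivlMl// => /le_trans; apply.
  rewrite -[X in _ <= X]mulrA [X in 2 / _ * X]mulrC ler_wpM2r//.
    by rewrite mulr_ge0 ?exprn_ge0// mulr_ge0// exprn_ge0// ltW.
  by rewrite -[2 / _]invf_div lef_pV2// posrE// divr_gt0.
Qed.

(** Dividing [D] and [T] by [z] lowers the order of vanishing of [D]. This requires [tau 0 = 0],
    which holds when [K] is bounded, since then [T = D * K] tends to 0 with [D]. *)
Lemma expansion_div r rho C D T K d tau k (B : R) : 0 < r -> 0 < rho -> 0 <= C ->
  expansion r rho C D d -> expansion r rho C T tau ->
  (forall z, - r < z < 0 -> D z * K z = T z) ->
  d k != 0 -> (forall j, (j < k)%N -> d j = 0) ->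
  (k = 0%N \/ forall z, - r < z < 0 -> `|K z| <= B) ->
  exists r' A sigma q, [/\ 0 < r' <= r, 0 < sigma, 0 <= A,
     forall n, `|q n| <= A * sigma ^+ n & asymptotic r' K q].
Proof.
move=> r0 rho0; elim: k C D T d tau => [|k IH] C D T d tau C0 HD HT DK dk dj HB.
  exact: expansion_div0 HD HT DK dk.
case: HB => // HB.
have d00 : d 0%N = 0 by exact: dj.
have B0 : 0 <= B.
  by apply: le_trans (HB (- (r / 2)) _) => //; lra.
have t00 : tau 0%N = 0.
  apply/eqP; rewrite -normr_eq0 eq_le normr_ge0 andbT.
  apply: (@le_of_small r _ (C * rho * B + C * rho)) => //.
    by rewrite addr_ge0 ?mulr_ge0// ltW.
  move=> z zr; have h1 := expansion_lim HT zr; have h2 := expansion_lim HD zr.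
  have h3 : `|T z| <= C * (rho * `|z|) * B.
    rewrite -DK// normrM ler_pM//; last exact: HB.
    by move: h2; rewrite d00 subr0.
  have h4 : `|tau 0%N| <= `|T z| + `|T z - tau 0%N|.
    by rewrite -{1}(subKr (T z) (tau 0%N)) ler_normB.
  have -> : (C * rho * B + C * rho) * `|z| = C * (rho * `|z|) * B + C * (rho * `|z|) by ring.
  by apply: le_trans h4 _; rewrite lerD.
apply: (IH (C * rho) (fun z => (D z - d 0%N) / z) (fun z => (T z - tau 0%N) / z)
  (fun i => d i.+1) (fun i => tau i.+1)) => //.
- by rewrite mulr_ge0// ltW.
- exact: expansion_shift (ltW rho0) HD.
- exact: expansion_shift (ltW rho0) HT.
- by move=> z zr; rewrite d00 t00 !subr0 mulrAC DK.
- by move=> j jk; exact: dj.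
- by right.
Qed.
End expansions.

Section landau.
Context d (T : measurableType d) (R : realType) (mu : {measure set T -> \bar R}).
Variables (Y u : T -> R).
Hypotheses (mY : measurable_fun setT Y) (mu_ : measurable_fun setT u).
Hypotheses (Y0 : forall w, 0 <= Y w) (u0 : forall w, 0 <= u w).

Let M n := (\int[mu]_w (Y w * (u w ^+ n / n`!%:R))%:E)%E.
Let A n z := (\int[mu]_w (Y w * ((-1) ^+ n * exp_rem n (z * u w)))%:E)%E.

Let expand_nonneg n z w : z < 0 -> 0 <= (-1) ^+ n * exp_rem n (z * u w) <= (- z * u w) ^+ n / n`!%:R.
Proof.
move=> z0; have := @exp_rem_neg R n (- z * u w); rewrite mulNr opprK; apply.
by rewrite -mulNr mulr_ge0// oppr_ge0 ltW.
Qed.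

Let mexp_rem n z : measurable_fun setT (fun w => exp_rem n (z * u w)).
Proof.
rewrite /exp_rem /egf; apply: measurable_funB.
  by apply: measurableT_comp => //; exact: measurable_funM.
apply: measurable_sum => j; apply: measurable_funM => //; apply: measurable_funM => //.
by apply: measurable_funX; exact: measurable_funM.
Qed.

Let mM n : measurable_fun setT (fun w => Y w * (u w ^+ n / n`!%:R)).
Proof. by apply: measurable_funM => //; apply: measurable_funM => //; exact: measurable_funX. Qed.

Let mA n z : measurable_fun setT (fun w => Y w * ((-1) ^+ n * exp_rem n (z * u w))).
Proof. by apply: measurable_funM => //; apply: measurable_funM => //; exact: measurable_funX. Qed.

Let M_ge0 n w : (0 <= (Y w * (u w ^+ n / n`!%:R))%:E)%E.
Proof. by rewrite lee_fin mulr_ge0// divr_ge0// exprn_ge0. Qed.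

Let A_ge0 n z w : z < 0 -> (0 <= (Y w * ((-1) ^+ n * exp_rem n (z * u w)))%:E)%E.
Proof. by move=> z0; rewrite lee_fin mulr_ge0//; have /andP[] := expand_nonneg n w z0. Qed.

(** Consecutive signed remainders add up to a Taylor term. The identity is a sum of nonnegative
    integrals, hence meaningful before [M n] is known to be finite. *)
Let AS n z : z < 0 -> (A n.+1 z + A n z = ((- z) ^+ n)%:E * M n)%E.
Proof.
move=> z0; rewrite -ge0_integralZl//; last 2 first.
- exact/measurable_EFinP.
- by rewrite lee_fin exprn_ge0// oppr_ge0 ltW.
rewrite -ge0_integralD//; try by [move=> w _; exact: A_ge0|exact/measurable_EFinP].
apply: eq_integral => w _; rewrite -EFinD -EFinM; congr _%:E.
by rewrite exp_remS exprS !exprMn (exprNn z); ring.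
Qed.

Let A_le n z : z < 0 -> (A n z <= ((- z) ^+ n)%:E * M n)%E.
Proof.
move=> z0; rewrite -AS// leeDr// integral_ge0// => w _; exact: A_ge0.
Qed.

(* The signed Taylor remainders of [expR (z * u)] at [z < 0] are nonnegative, so
   by Fatou the one-sided expansion of [K] forces [M n = q n] for all [n]. The
   geometric bound on [q] then sums the exponential series at some [e > 0]. *)
Lemma landau (K : R -> R) (q : nat -> R) (r B sigma : R) :
  0 < r -> 0 < sigma -> 0 <= B -> (forall n, `|q n| <= B * sigma ^+ n) ->
  asymptotic r K q ->
  (forall z, - r < z < 0 -> (\int[mu]_w (Y w * expR (z * u w))%:E = (K z)%:E)%E) ->
  exists2 e, 0 < e & (\int[mu]_w (Y w * expR (e * u w))%:E < +oo)%E.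
Proof.
move=> r0 s0 B0 qB Kq KE.
pose z_ i : R := - (r / 2 * harmonic i).
have z_lt i : 0 < - z_ i <= r / 2.
  rewrite /z_ opprK mulr_gt0 ?divr_gt0// ?invr_gt0 ?ltr0n//= ler_piMr ?divr_ge0 ?(ltW r0)//.
  by rewrite invf_le1 ?ltr0n// ler1n.
have z_r i : - r < z_ i < 0 by have := z_lt i; lra.
have z_0 : (fun i => `|z_ i|) @ \oo --> 0.
  rewrite [X in X @ _](_ : _ = (fun i => r / 2 * harmonic i)); last first.
    by apply/funext => i; have /andP[h _] := z_lt i; rewrite -normrN (gtr0_norm h) /z_ opprK.
  by rewrite -[X in _ --> X](mulr0 (r / 2)); apply: cvgMr; exact: cvg_harmonic.
have z_cvg (x : nat -> R) l C : (forall i, `|x i - l| <= C * `|z_ i|) -> (fun i => (x i)%:E) @ \oo --> l%:E.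
  move=> H; apply: cvg_EFin; first exact: nearW.
  apply/subr_cvg0; apply/norm_cvg0P.
  apply: (@squeeze_cvgr _ _ _ _ (cst 0) (fun i => C * `|z_ i|)) => //.
  - by apply: nearW => i; rewrite normr_ge0/=.
  - exact: cvg_cst.
  - by rewrite -[X in _ --> X](mulr0 C); apply: cvgMr.
have qM n : (forall z, - r < z < 0 -> A n z = ((-1) ^+ n * (K z - \sum_(j < n) q j * z ^+ j))%:E) -> M n = (q n)%:E.
    move=> AE.
    pose g i w := ((Y w * ((-1) ^+ n * exp_rem n (z_ i * u w)))%:E * ((- z_ i) ^- n)%:E)%E.
    have zi0 i : 0 < - z_ i by case/andP: (z_lt i).
    have zn0 i : z_ i != 0 by have := zi0 i; rewrite oppr_gt0 => /lt_eqF ->.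
    have gE i : (\int[mu]_w g i w = A n (z_ i) * ((- z_ i) ^- n)%:E)%E.
      rewrite ge0_integralZr//.
      - exact/measurable_EFinP.
      - by move=> w _; apply: A_ge0; case/andP: (z_r i).
      - by rewrite lee_fin invr_ge0 exprn_ge0// ltW.
    have gE' i : (\int[mu]_w g i w = ((K (z_ i) - \sum_(j < n) q j * (z_ i) ^+ j) / (z_ i) ^+ n)%:E)%E.
      rewrite gE AE// -EFinM (exprNn (z_ i)); congr _%:E.
      by field; rewrite expf_neq0 ?signr_eq0//= expf_neq0.
    have gq : (fun i => \int[mu]_w g i w)%E @ \oo --> (q n)%:E.
      rewrite (funext gE').
      have [C HC] := Kq n; apply: (z_cvg _ _ C) => i.
      have -> : (K (z_ i) - \sum_(j < n) q j * z_ i ^+ j) / z_ i ^+ n - q n = (K (z_ i) - \sum_(j < n.+1) q j * z_ i ^+ j) / z_ i ^+ n.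
        by rewrite big_ord_recr/=; field; rewrite expf_neq0.
      rewrite normrM normfV normrX ler_pdivrMr ?exprn_gt0 ?normr_gt0//.
      by rewrite -mulrA -exprS HC.
    (* Fatou along [z_] gives [M n <= q n]; the converse holds because [A_le] bounds every quotient
       by [M n]. *)
    apply/eqP; rewrite eq_le; apply/andP; split.
      have gM w : limn_einf (g ^~ w) = (Y w * (u w ^+ n / n`!%:R))%:E.
        apply: (cvg_limn_einf_sup _).1.
        rewrite /g; under eq_fun do rewrite -EFinM.
        apply: (z_cvg _ _ (Y w * (u w ^+ n.+1 / n.+1`!%:R))) => i.
        have -> : Y w * ((-1) ^+ n * exp_rem n (z_ i * u w)) * (- z_ i) ^- n - Y w * (u w ^+ n / n`!%:R) =
          - (Y w * ((-1) ^+ n.+1 * exp_rem n.+1 (z_ i * u w)) * (- z_ i) ^- n).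
          rewrite exp_remS (exprNn (z_ i)) exprMn [(-1) ^+ n.+1]exprS; field.
          by rewrite expf_neq0//= signr_eq0 pnatr_eq0 -lt0n fact_gt0.
        have z_i0 : z_ i < 0 by case/andP: (z_r i).
        have /andP[h1 h2] := expand_nonneg n.+1 w z_i0.
        rewrite normrN normrM ger0_norm; last by rewrite mulr_ge0.
        rewrite ger0_norm ?invr_ge0 ?exprn_ge0 ?(ltW (zi0 i))// ler_pdivrMr ?exprn_gt0//.
        rewrite -!mulrA ler_wpM2l//; apply: le_trans h2 _.
        rewrite (ltr0_norm z_i0) exprMn [(- z_ i) ^+ n.+1]exprS.
        by rewrite le_eqVlt; apply/orP; left; apply/eqP; ring.
      rewrite -(cvg_limn_einf_sup gq).1 /M.
      under eq_integral do rewrite -gM.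
      apply: fatou => //.
        by move=> i; apply/measurable_EFinP; apply: measurable_funM.
      move=> i w _; rewrite mule_ge0//; first by apply: A_ge0; case/andP: (z_r i).
      by rewrite lee_fin invr_ge0 exprn_ge0// ltW.
    apply: (cvge_le _ gq); apply: nearW => i.
    rewrite gE; have z_i0 : z_ i < 0 by case/andP: (z_r i).
    rewrite -lee_pdivlMr ?invr_gt0 ?exprn_gt0//.
    apply: le_trans (A_le n z_i0) _.
    by rewrite invrK muleC.
have AE n : forall z, - r < z < 0 -> A n z = ((-1) ^+ n * (K z - \sum_(j < n) q j * z ^+ j))%:E.
  elim: n => [z zr|n IH z zr].
    rewrite big_ord0 subr0 expr0 mul1r -KE//.
    by apply: eq_integral => w _; rewrite exp_rem0 mul1r.
  have := @AS n z; rewrite (qM _ IH) IH// -EFinM; case/andP: zr => _ z0 /(_ z0).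
  (* A priori [A n.+1 z] could be infinite; its sum with a real number being real excludes this. *)
  move: (A n.+1 z) => [x| |] //= []; rewrite (exprNn z) big_ord_recr/= => e.
  by congr _%:E; rewrite -[x](addrK ((-1) ^+ n * (K z - \sum_(j < n) q j * z ^+ j))) e exprS; ring.
have ME n : M n = (q n)%:E by apply: qM; exact: AE.
(* With this [e] the terms [e ^ j * q j] are at most [B / 2 ^ j], and the partial sums stay below
   [2 * B]. *)
pose e := sigma^-1 / 2.
have e0 : 0 < e by rewrite divr_gt0// invr_gt0.
exists e => //.
pose f N w := (Y w * egf (fun=> 1) N (e * u w))%:E.
have mf N : measurable_fun setT (f N).
  apply/measurable_EFinP; apply: measurable_funM => //.
  apply: measurable_sum => j; apply: measurable_funM => //; apply: measurable_funM => //.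
  by apply: measurable_funX; exact: measurable_funM.
have t0 n w : 0 <= Y w * (1 * ((e * u w) ^+ n / n`!%:R)).
  by rewrite mulr_ge0// mul1r divr_ge0// exprn_ge0// mulr_ge0// ltW.
have f0 N w : (0 <= f N w)%E.
  by rewrite lee_fin /egf mulr_sumr sumr_ge0.
have fE N : (\int[mu]_w f N w = (\sum_(j < N) e ^+ j * q j)%:E)%E.
  have fsum w : f N w = (\sum_(j < N) (e ^+ j)%:E * (Y w * (u w ^+ j / j`!%:R))%:E)%E.
    rewrite /f /egf mulr_sumr -sumEFin; apply: eq_bigr => j _; rewrite -EFinM.
    by congr _%:E; rewrite exprMn; ring.
  rewrite (eq_integral _ _ (fun w _ => fsum w)) ge0_integral_sum//.
  - rewrite -sumEFin; apply: eq_bigr => j _; rewrite ge0_integralZl//.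
    + by rewrite -/(M j) ME.
    + exact/measurable_EFinP.
    + by rewrite lee_fin exprn_ge0// ltW.
  - by move=> j; apply/measurable_EFinP; apply: measurable_funM.
  - by move=> j w _; rewrite mule_ge0// lee_fin exprn_ge0// ltW.
have f_le N : (\int[mu]_w f N w <= (B * 2)%:E)%E.
  rewrite fE lee_fin.
  have h (j : 'I_N) : true -> e ^+ j * q j <= B * (2^-1) ^+ j.
    move=> _; apply: (@le_trans _ _ (e ^+ j * (B * sigma ^+ j))).
      rewrite ler_wpM2l ?exprn_ge0 ?(ltW e0)//.
      exact: le_trans (ler_norm _) (qB _).
    rewrite mulrCA ler_wpM2l// -exprMn /e mulrAC mulVf ?mul1r// gt_eqF//.
  apply: le_trans (ler_sum _ h) _.
  rewrite -mulr_sumr ler_wpM2l//.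
  have -> : \sum_(i < N) 2^-1 ^+ i = 2 - 2 * 2^-1 ^+ N :> R.
    elim: N {h} => [|N IH]; first by rewrite big_ord0 expr0; ring.
    by rewrite big_ord_recr/= IH exprSr; field.
  by rewrite gerBl mulr_ge0// exprn_ge0.
have egfE x N : egf (fun=> 1) N x = series (exp_coeff x) N.
  by rewrite /egf /series/= big_mkord; apply: eq_bigr => i _; rewrite mul1r.
have f_cvg w : f ^~ w @ \oo --> (Y w * expR (e * u w))%:E.
  apply: cvg_EFin; first exact: nearW.
  rewrite [X in X @ _](_ : _ = (fun N => Y w * series (exp_coeff (e * u w)) N)); last first.
    by apply/funext => N; rewrite /= egfE.
  by apply: cvgMr; have := is_cvg_series_exp_coeff (e * u w).
have fnd w : nondecreasing_seq (f ^~ w).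
  apply/nondecreasing_seqP => N; rewrite lee_fin ler_wpM2l//.
  by rewrite [leRHS]/egf big_ord_recr/= lerDl mul1r divr_ge0// exprn_ge0// mulr_ge0// ltW.
have := @cvg_monotone_convergence _ _ _ mu _ measurableT f mf (fun n w _ => f0 n w) (fun w _ => fnd w).
under eq_integral do rewrite (cvg_lim _ (f_cvg _))//.
move=> H; apply: (@le_lt_trans _ _ (B * 2)%:E); last exact: ltry.
by apply: (cvge_le _ H); exact: nearW.
Qed.
End landau.

(** * Weighted sums of iid variables *)

Section null_sets.
Import HBNNSimple.
Context d (T : measurableType d) (R : realType) (mu : {measure set T -> \bar R}).

(* Meant for [weighted_sum], which is only known to agree almost everywhere with
   a measurable function. *)
Lemma ge0_integral_ae_le (f g : T -> \bar R) :
  (forall w, 0 <= f w)%E -> (forall w, 0 <= g w)%E ->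
  {ae mu, forall w, f w = g w} -> (\int[mu]_w f w <= \int[mu]_w g w)%E.
Proof.
move=> f0 g0 [N [mN N0 fgN]].
have mNC : measurable (~` N) by exact: measurableC.
rewrite [X in (X <= _)%E]ge0_integralTE//; apply: ge_ereal_sup => _ [h hf <-].
rewrite -integralT_nnsfun.
(* Multiplying a simple function below [f] by the indicator of the complement of [N] keeps its
   integral and places it below [g]. *)
have -> : (\int[mu]_w (h w)%:E = \int[mu]_w (proj_nnsfun h mNC w)%:E)%E.
  apply: ae_eq_integral => //.
  - by apply/measurable_EFinP.
  - by apply/measurable_EFinP.
  exists N; split => // w /= H; apply: contrapT => nN; apply: H => _ /=.
  by rewrite /proj_nnsfun/= mindicE mem_set ?mulr1.
rewrite integralT_nnsfun ge0_integralTE//; apply: ereal_sup_ubound.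
exists (proj_nnsfun h mNC) => // w.
have [wN|wN] := pselect (N w).
  by rewrite /proj_nnsfun/= mindicE memNset ?mulr0// => /(_ wN).
rewrite /proj_nnsfun/= mindicE mem_set// mulr1.
suff <- : f w = g w by exact: hf.
by apply: contrapT => H; apply: wN; apply: fgN.
Qed.

(** The functions may fail to be measurable, so the positive and the negative parts are each
    compared in both directions through simple functions. *)
Lemma integral_ae_eq (f g : T -> \bar R) :
  {ae mu, forall w, f w = g w} -> (\int[mu]_w f w = \int[mu]_w g w)%E.
Proof.
move=> fg.
have key (h k : T -> \bar R) : {ae mu, forall w, h w = k w} -> forall (op : (T -> \bar R) -> T -> \bar R),
    (forall h k w, h w = k w -> op h w = op k w) -> (forall h w, 0 <= op h w)%E ->
    (\int[mu]_w op h w = \int[mu]_w op k w)%E.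
  move=> hk op opE op0; apply/eqP; rewrite eq_le; apply/andP; split;
    apply: ge0_integral_ae_le => //; apply: filterS hk => w hkw; apply: opE => //.
rewrite [LHS]integralE [RHS]integralE; congr (_ - _)%E.
- apply: (key _ _ fg (fun h => h^\+)%E) => // h k w e; by rewrite !funeposE e.
- apply: (key _ _ fg (fun h => h^\-)%E) => // h k w e; by rewrite !funenegE e.
Qed.
End null_sets.

Section independence.
Context d (T : measurableType d) (R : realType) (P : probability T R).
Local Open Scope ereal_scope.

(** Independence makes the joint law the product of the marginal laws, and Tonelli factorizes the
    integral. *)
Lemma ge0_integral_indep (U V : T -> R) :
  measurable_fun setT U -> measurable_fun setT V ->
  (forall w, 0 <= U w)%R -> (forall w, 0 <= V w)%R ->
  (forall A B, measurable A -> measurable B ->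
    P (U @^-1` A `&` V @^-1` B) = P (U @^-1` A) * P (V @^-1` B)) ->
  \int[P]_w (U w * V w)%:E = \int[P]_w (U w)%:E * \int[P]_w (V w)%:E.
Proof.
move=> mU mV U0 V0 UV.
pose U' : {mfun T >-> R} := HB.pack U (isMeasurableFun.Build _ _ _ _ _ mU).
pose V' : {mfun T >-> R} := HB.pack V (isMeasurableFun.Build _ _ _ _ _ mV).
have mUV : measurable_fun setT (fun w => (U w, V w)) by exact: measurable_fun_pair.
pose UV' : {mfun T >-> (R * R)%type} := HB.pack (fun w => (U w, V w)) (isMeasurableFun.Build _ _ _ _ _ mUV).
(* The absolute values make the integrand nonnegative on the whole plane, as Tonelli requires; they
   are invisible on the range of [(U, V)]. *)
pose f (z : R * R) := (`|z.1| * `|z.2|)%:E.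
have mf : measurable_fun setT f.
  apply/measurable_EFinP; apply: measurable_funM; apply: measurableT_comp => //.
have f0 z : 0 <= f z by rewrite lee_fin mulr_ge0.
have prodE A : measurable A -> (distribution P U' \x distribution P V') A = distribution P UV' A.
  apply: product_measure_unique => B C mB mC.
  rewrite /= /distribution/= /pushforward/= -UV//.
have -> : \int[P]_w (U w * V w)%:E = \int[distribution P UV']_z f z.
  rewrite ge0_integral_distribution//; apply: eq_integral => w _ /=.
  by rewrite /f/= !ger0_norm.
rewrite -(eq_measure_integral _ (fun A mA _ => prodE A mA)).
rewrite (@fubini_tonelli1 _ _ _ _ _ _ _ f mf f0) /fubini_F.
have mnorm : measurable_fun setT (fun y : R => `|y|%:E) by apply/measurable_EFinP; exact: normr_measurable.
have VE : \int[distribution P V']_y `|y|%:E = \int[P]_w (V w)%:E.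
  rewrite ge0_integral_distribution//.
  by apply: eq_integral => w _ /=; rewrite ger0_norm.
have UE : \int[distribution P U']_y `|y|%:E = \int[P]_w (U w)%:E.
  rewrite ge0_integral_distribution//.
  by apply: eq_integral => w _ /=; rewrite ger0_norm.
have inner x : \int[distribution P V']_y f (x, y) = `|x|%:E * \int[P]_w (V w)%:E.
  rewrite -VE -ge0_integralZl//.
under eq_integral do rewrite inner.
rewrite ge0_integralZr//; last by apply: integral_ge0 => w _; rewrite lee_fin.
by rewrite UE.
Qed.
End independence.

Section capped_weights.
Context {R : realType}.

(* Turns weights that are almost surely a subprobability into weights that are
   one everywhere, without leaving the sigma-algebra generated by [W]. *)
Fixpoint capped_sum (T : Type) (W : nat -> T -> R) n w : R := match n with
  | 0 => 0
  | n.+1 => capped_sum W n w + Num.max 0 (Num.min (W n w) (1 - capped_sum W n w))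
  end.

Definition capped (T : Type) (W : nat -> T -> R) n w : R :=
  Num.max 0 (Num.min (W n w) (1 - capped_sum W n w)).

Lemma capped_sumE (T : Type) (W : nat -> T -> R) n w :
  capped_sum W n w = \sum_(j < n) capped W j w.
Proof. by elim: n => [|n IH]; rewrite ?big_ord0// big_ord_recr/= -IH. Qed.

Lemma capped_ge0 (T : Type) (W : nat -> T -> R) n w : 0 <= capped W n w.
Proof. by rewrite /capped le_max lexx. Qed.

Lemma capped_sum_le1 (T : Type) (W : nat -> T -> R) n w : capped_sum W n w <= 1.
Proof.
elim: n => [|n IH] /=; first exact: ler01.
rewrite addr_maxr addr0 ge_max IH/= -lerBrDl ge_min lexx orbT//.
Qed.

Lemma capped_eq (T : Type) (W : nat -> T -> R) w :
  is_subprobability (W ^~ w) -> forall n, capped W n w = W n w.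
Proof.
move=> [W0 W1] n.
have le1 m : \sum_(j < m) W j w <= 1.
  rewrite -lee_fin; apply: le_trans W1.
  rewrite -sumEFin -(big_mkord xpredT (fun j => (W j w)%:E)).
  by apply: nneseries_lim_ge => j _ _; rewrite lee_fin.
have aux m : capped_sum W m w = \sum_(j < m) W j w -> capped W m w = W m w.
  move=> e; rewrite /capped e (_ : Num.min _ _ = W m w); first exact/max_idPr.
  by apply/min_idPl; rewrite lerBrDl; have := le1 m.+1; rewrite big_ord_recr.
have := aux; apply; elim: n => [|n IH]; first by rewrite big_ord0.
by rewrite big_ord_recr/= -IH; congr (_ + _); exact: aux.
Qed.

Lemma measurable_capped d (T : measurableType d) (W : nat -> T -> R) n :
  (forall j, measurable_fun setT (W j)) -> measurable_fun setT (capped W n).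
Proof.
move=> mW.
have step m : measurable_fun setT (capped_sum W m) -> measurable_fun setT (capped W m).
  move=> mS; apply: measurable_maxr => //; apply: measurable_minr => //.
  exact: measurable_funB.
suff : measurable_fun setT (capped_sum W n) by exact: step.
elim: n => [|n IH]; first exact: measurable_cst.
by apply: measurable_funD => //; exact: step.
Qed.
End capped_weights.

Section independent_families.
Context d (T : measurableType d) (R : realType) (P : probability T R).
Local Open Scope ereal_scope.

(** The generators used in [sigma_of_family], named so that measurability for the generated
    sigma-algebra can be stated on [g_sigma_algebraType]. *)
Definition family_gen (I : Type) (f : I -> T -> R) : set (set T) :=
  [set A | exists i (B : set R), measurable B /\ A = f i @^-1` B].

Lemma measurable_family (I : Type) (f : I -> T -> R) i :
  measurable_fun setT (f i : g_sigma_algebraType (family_gen f) -> R).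
Proof.
by move=> _ B mB; rewrite setTI; apply: sub_sigma_algebra; exists i, B.
Qed.

Lemma integral_independent_families (I J : Type) (f : I -> T -> R) (g : J -> T -> R) (U V : T -> R) :
  independent_families P f g ->
  measurable_fun setT U -> measurable_fun setT V ->
  measurable_fun setT (U : g_sigma_algebraType (family_gen f) -> R) ->
  measurable_fun setT (V : g_sigma_algebraType (family_gen g) -> R) ->
  (forall w, 0 <= U w)%R -> (forall w, 0 <= V w)%R ->
  \int[P]_w (U w * V w)%:E = \int[P]_w (U w)%:E * \int[P]_w (V w)%:E.
Proof.
move=> fg mU mV mU' mV' U0 V0; apply: ge0_integral_indep => // A B mA mB.
apply: fg.
- by have := mU' measurableT A mA; rewrite setTI.
- by have := mV' measurableT B mB; rewrite setTI.
Qed.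

Lemma integral_mutually_independent (X : nat -> {RV P >-> R}) i j (f g : R -> R) :
  mutually_independent P X -> i != j ->
  measurable_fun setT f -> measurable_fun setT g ->
  (forall x, 0 <= f x)%R -> (forall x, 0 <= g x)%R ->
  \int[P]_w (f (X i w) * g (X j w))%:E =
  \int[P]_w (f (X i w))%:E * \int[P]_w (g (X j w))%:E.
Proof.
move=> iX ij mf mg f0 g0; apply: ge0_integral_indep => //.
- exact: measurableT_comp.
- exact: measurableT_comp.
move=> A B mA mB.
pose C k := if k == i then f @^-1` A else g @^-1` B.
have mC k : measurable (C k).
  rewrite /C; case: ifP => _; rewrite -[X in measurable X]setTI.
    exact: mf.
  exact: mg.
have := iX [fset i; j]%fset C mC.
rewrite big_fsetU1 ?inE// big_seq_fset1 /C eqxx eq_sym (negbTE ij).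
move=> H; rewrite /= in H. rewrite -H; congr (P _); apply/seteqP; split.
  move=> w [wA wB] k /=; rewrite !inE => /orP[/eqP->|/eqP->].
    by rewrite eqxx.
  by rewrite eq_sym (negbTE ij).
move=> w H'; split.
  by have := H' i; rewrite /= !inE !eqxx; apply.
by have := H' j; rewrite /= !inE !eqxx orbT eq_sym (negbTE ij); apply.
Qed.

Lemma integral_same_distribution (X Y : {RV P >-> R}) (f : R -> R) :
  distribution P X = distribution P Y -> measurable_fun setT f -> (forall x, 0 <= f x)%R ->
  \int[P]_w (f (X w))%:E = \int[P]_w (f (Y w))%:E.
Proof.
move=> XY mf f0.
have mf' : measurable_fun setT (EFin \o f) by exact/measurable_EFinP.
rewrite -(@ge0_integral_distribution _ _ _ _ _ P X (EFin \o f))// -(@ge0_integral_distribution _ _ _ _ _ P Y (EFin \o f))//.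
by apply: eq_measure_integral => A mA _; exact: (congr1 (@^~ A) XY).
Qed.
End independent_families.

Section domination.
Context d (T : measurableType d) (R : realType) (P : {measure set T -> \bar R}).

Lemma integrable_dom (f g : T -> R) (G : R) : measurable_fun setT f -> measurable_fun setT g ->
  (forall w, `|f w| <= g w) -> (\int[P]_w (g w)%:E = G%:E)%E ->
  P.-integrable setT (EFin \o f).
Proof.
move=> mf mg fg gG; apply: (@le_integrable _ _ _ P _ measurableT _ (EFin \o g)).
- exact/measurable_EFinP.
- by move=> w _; rewrite /= lee_fin; apply: le_trans (fg w) (ler_norm _).
apply/integrableP; split; first exact/measurable_EFinP.
have -> : (\int[P]_w `|(EFin \o g) w| = G%:E)%E.
  rewrite -gG; apply: eq_integral => w _ /=; rewrite ger0_norm//.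
  exact: le_trans (fg w).
exact: ltry.
Qed.

Lemma Rintegral_dom (f g : T -> R) (G : R) : measurable_fun setT f -> measurable_fun setT g ->
  (forall w, `|f w| <= g w) -> (\int[P]_w (g w)%:E = G%:E)%E ->
  `|Rintegral P setT f| <= G.
Proof.
move=> mf mg fg gG; have fi := integrable_dom mf mg fg gG.
apply: le_trans (le_normr_Rintegral measurableT fi) _.
rewrite /Rintegral -[leRHS]/(fine G%:E) -gG; apply: fine_le.
- apply: integrable_fin_num => //; exact: (integrable_abse fi).
- by rewrite gG.
apply: ge0_le_integral => //.
- by apply/measurable_EFinP; exact: measurableT_comp.
- exact/measurable_EFinP.
- by move=> w _; rewrite lee_fin.
Qed.
End domination.

(** * Jensen's inequality and functions of polynomial growth *)

Section inequalities.
Context {R : realType}.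

(** Young's inequality with exponents [s] and [s / (s - 1)]: the power function lies above its
    tangent at [A]. *)
Lemma powR_tangent (u A s : R) : 0 <= u -> 0 <= A -> 1 <= s ->
  s * (A `^ (s - 1)) * u <= u `^ s + (s - 1) * A `^ s.
Proof.
move=> u0 A0; rewrite le_eqVlt => /predU1P[<-|s1].
  by rewrite subrr powRr0 powRr1// mul0r addr0 !mul1r.
have s0 : 0 < s by lra.
have s10 : 0 < s - 1 by lra.
have := @conjugate_powR R u (A `^ (s - 1)) s (s / (s - 1)) u0 (powR_ge0 _ _) s0.
rewrite divr_gt0// => /(_ isT).
rewrite -powRrM (_ : (s - 1) * (s / (s - 1)) = s); last by field; rewrite gt_eqF.
have -> : s^-1 + (s / (s - 1))^-1 = 1 by field; rewrite !gt_eqF.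
move=> /(_ erefl) H.
have -> : s * A `^ (s - 1) * u = s * (u * A `^ (s - 1)) by ring.
apply: le_trans (ler_wpM2l (ltW s0) H) _.
by rewrite le_eqVlt; apply/orP; left; apply/eqP; field; rewrite !gt_eqF.
Qed.

Lemma jensen_powR n (p x : 'I_n -> R) (s : R) : (forall j, 0 <= p j) -> (forall j, 0 <= x j) ->
  \sum_j p j <= 1 -> 1 <= s -> (\sum_j p j * x j) `^ s <= \sum_j p j * x j `^ s.
Proof.
move=> p0 x0 p1 s1; set A := \sum_j _.
have A0 : 0 <= A by apply: sumr_ge0 => j _; rewrite mulr_ge0.
have key : \sum_j p j * (s * (A `^ (s - 1)) * x j) <= \sum_j p j * (x j `^ s + (s - 1) * A `^ s).
  by apply: ler_sum => j _; rewrite ler_wpM2l// powR_tangent.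
have e1 : \sum_j p j * (s * (A `^ (s - 1)) * x j) = s * A `^ s.
  rewrite -(mulr_powRB1 A0 (_ : 0 < s)); last lra.
  set B := A `^ (s - 1); rewrite (_ : s * (A * B) = (s * B) * A); last by ring.
  by rewrite /A mulr_sumr; apply: eq_bigr => j _; ring.
have e2 : \sum_j p j * (x j `^ s + (s - 1) * A `^ s) = \sum_j p j * x j `^ s + (\sum_j p j) * ((s - 1) * A `^ s).
  by rewrite mulr_suml -big_split/=; apply: eq_bigr => j _; rewrite mulrDr.
rewrite e1 e2 in key.
(* A total mass below 1 only helps, because the constant term of the tangent inequality is
   nonnegative. *)
have h : (\sum_j p j) * ((s - 1) * A `^ s) <= 1 * ((s - 1) * A `^ s).
  by rewrite ler_wpM2r// mulr_ge0 ?powR_ge0//; lra.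
lra.
Qed.

(* For such [phi] the defect [phi (x + y) - phi x - phi y] is controlled by the
   products [|x| |y| ^ q] and [|x| ^ q |y|]. *)
Definition growth_lip (q : R) (phi : R -> R) (C : R) :=
  [/\ measurable_fun setT phi, phi 0 = 0 &
     forall x y, `|phi x - phi y| <= C * (`|x - y| * (1 + `|x| `^ q + `|y| `^ q))].

Lemma growth_lip_ge0 q phi C : growth_lip q phi C -> 0 <= C.
Proof.
case=> _ _ /(_ 1 0) H; have := le_trans (normr_ge0 _) H.
rewrite pmulr_lge0//; rewrite subr0 normr1 mul1r.
by have := powR_ge0 (1 : R) q; have := powR_ge0 `|0 : R| q; lra.
Qed.

Lemma growth_lip_norm q phi C x : 0 < q -> growth_lip q phi C -> `|phi x| <= C * (`|x| * (1 + `|x| `^ q)).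
Proof.
move=> q0 [_ p0 /(_ x 0)].
by rewrite p0 !subr0 normr0 powR0 ?addr0// gt_eqF.
Qed.

(** Every term of degree [q + 1] on the right is mixed: if [|y| <= |x|], then [|y| * |y| ^ q] is
    absorbed by [|y| * |x| ^ q]. For independent [x] and [y] the expectation of the bound needs
    moments of orders 1 and [q] only. *)
Lemma growth_lip_defect q phi C x y : 1 <= q -> growth_lip q phi C ->
  `|phi (x + y) - phi x - phi y| <=
  C * (2 `^ q + 2) * (`|y| + `|y| * `|x| `^ q + `|x| * `|y| `^ q).
Proof.
move=> q1; have q0 : 0 < q by lra.
wlog yx : x y / `|y| <= `|x|.
  move=> H Hl; have [yx|/ltW xy] := leP `|y| `|x|; first exact: H.
  have := H _ _ xy Hl; rewrite (addrC y x) addrAC => /le_trans; apply.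
  rewrite ler_wpM2l ?mulr_ge0 ?(growth_lip_ge0 Hl) ?addr_ge0 ?powR_ge0//.
  by move: xy; lra.
move=> Hl; have C0 := growth_lip_ge0 Hl.
have h1 : `|phi y| <= C * (`|y| * (1 + `|x| `^ q)).
  apply: le_trans (growth_lip_norm _ q0 Hl) _.
  by rewrite !ler_wpM2l// lerD2l ge0_ler_powR ?nnegrE// ltW.
have h2 : `|phi (x + y) - phi x| <= C * (`|y| * (1 + (2 `^ q + 1) * `|x| `^ q)).
  case: Hl => _ _ /(_ (x + y) x) H; apply: le_trans H _.
  rewrite addrAC subrr add0r !ler_wpM2l//.
  rewrite mulrDl mul1r addrA lerD2r lerD2l -powRM//.
  rewrite ge0_ler_powR ?nnegrE ?mulr_ge0 ?(ltW q0)//.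
  apply: le_trans (ler_normD _ _) _; lra.
apply: le_trans (ler_normB _ _) _; apply: le_trans (lerD h2 h1) _.
rewrite -mulrDr -mulrA ler_wpM2l//.
have a0 := powR_ge0 (2:R) q; have b0 := powR_ge0 `|x| q.
have c0 : 0 <= `|x| * `|y| `^ q by rewrite mulr_ge0 ?powR_ge0.
have e0 : 0 <= (2 `^ q + 2) * (`|x| * `|y| `^ q) by rewrite mulr_ge0// addr_ge0.
have f0 : 0 <= 2 `^ q * `|y| by rewrite mulr_ge0.
have -> : (2 `^ q + 2) * (`|y| + `|y| * `|x| `^ q + `|x| * `|y| `^ q) =
  2 `^ q * `|y| + 2 * `|y| + (2 `^ q + 2) * (`|y| * `|x| `^ q) + (2 `^ q + 2) * (`|x| * `|y| `^ q) by ring.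
have -> : `|y| * (1 + (2 `^ q + 1) * `|x| `^ q) + `|y| * (1 + `|x| `^ q) =
  2 * `|y| + (2 `^ q + 2) * (`|y| * `|x| `^ q) by ring.
lra.
Qed.

Lemma growth_lipD q phi psi C C' k : growth_lip q phi C -> growth_lip q psi C' ->
  growth_lip q (fun x => phi x + k * psi x) (C + `|k| * C').
Proof.
move=> [m1 z1 H1] [m2 z2 H2]; split.
- by apply: measurable_funD => //; exact: measurable_funM.
- by rewrite z1 z2 mulr0 addr0.
move=> x y.
have -> : phi x + k * psi x - (phi y + k * psi y) = (phi x - phi y) + k * (psi x - psi y) by ring.
apply: le_trans (ler_normD _ _) _; rewrite mulrDl lerD// normrM -mulrA.
by rewrite ler_wpM2l.
Qed.
End inequalities.

Lemma RintegralDZ d (T : measurableType d) (R : realType) (P : {measure set T -> \bar R})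
    (f g : T -> R) (k : R) :
  P.-integrable setT (EFin \o f) -> P.-integrable setT (EFin \o g) ->
  \int[P]_w (f w + k * g w) = \int[P]_w f w + k * \int[P]_w g w.
Proof.
move=> fi gi.
have ki : P.-integrable setT (EFin \o (fun w => k * g w)).
  have := integrableZl measurableT k gi; apply: eq_integrable => // w _.
by rewrite RintegralD// RintegralZl.
Qed.

Section bounded_series.
Context {R : realType}.
Variables (e : nat -> R) (B : R).
Hypotheses (e0 : forall n, 0 <= e n) (eB : forall n, \sum_(j < n) e j <= B).

Lemma cvg_dominated_series (a : nat -> R) C : (forall n, `|a n| <= C * e n) ->
  cvgn (fun n => \sum_(j < n) a j).
Proof.
move=> aC.
have E (b : nat -> R) : (fun n => \sum_(j < n) b j) = series b.
  by apply/funext => n; rewrite /series/= big_mkord.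
rewrite E; apply: normed_cvg.
have -> : [normed series a] = series (fun n => `|a n|) by [].
apply: (@series_le_cvg _ _ (fun n => C * e n)) => //.
- by move=> n; apply: le_trans (aC n).
have -> : series (fun n => C * e n) = (fun n => C * series e n).
  by apply/funext => n; rewrite /series/= mulr_sumr.
apply: is_cvgMr; apply: nondecreasing_is_cvgn.
  by apply/nondecreasing_seqP => n; rewrite -E big_ord_recr/= lerDl.
by exists B => _ [n _ <-]; rewrite -E.
Qed.

Lemma lim_dominated_series (a : nat -> R) C : 0 <= C -> (forall n, `|a n| <= C * e n) ->
  `|limn (fun n => \sum_(j < n) a j)| <= C * B.
Proof.
move=> C0 aC; have ac := cvg_dominated_series aC.
rewrite -(cvg_lim _ (cvg_norm ac))//.
apply: limr_le; first exact: is_cvg_norm.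
apply: nearW => n; apply: le_trans (ler_norm_sum _ _ _) _.
apply: (@le_trans _ _ (\sum_(j < n) C * e j)); first by apply: ler_sum => j _.
by rewrite -mulr_sumr ler_wpM2l.
Qed.
End bounded_series.

Definition weighted_partial_sum (R : realType) (T : Type) (p x : nat -> T -> R) n w : R :=
  \sum_(j < n) p j w * x j w.

(** The single summand is removed only where [|x n| > 1]: elsewhere it is at most a multiple of
    [p n * |x n|], hence summable. The removed part is an integral over [|X| > 1], where [ln |X|] is
    positive, as Landau's theorem demands. *)
Definition sum_increment (R : realType) (T : Type) (p x : nat -> T -> R) (phi : R -> R) n w : R :=
  phi (weighted_partial_sum p x n.+1 w) - phi (weighted_partial_sum p x n w)
  - (if 1 < `|x n w| then phi (p n w * x n w) else 0).

Lemma measurable_absX (R : realType) (s : R) : measurable_fun setT (fun y : R => `|y| `^ s).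
Proof. exact: (measurableT_comp (measurable_powR s) (@normr_measurable R setT)). Qed.

(** * The functionals of the weights and of the weighted sums *)

Section functionals.
Context d (T : measurableType d) (R : realType) (P : probability T R).

Lemma integral_prob_cst (C : R) : (\int[P]_w C%:E = C%:E)%E.
Proof.
by rewrite -[LHS]/(\int[P]_w (cst C%:E w))%E integral_cst//= probability_setT mule1.
Qed.

(* [E sum_j f (p_j)] *)
Definition weight_functional (p : nat -> T -> R) (f : R -> R) : R :=
  limn (fun n => \sum_(j < n) \int[P]_w f (p j w)).

(* [lim_n E phi (S_n)] with the contribution of the single large summands
   removed: unlike that limit, it is finite as soon as [phi] grows slower than
   [|.| ^ (q + 1)] and [X] has a moment of order [q]. *)
Definition sum_functional (p x : nat -> T -> R) (phi : R -> R) : R :=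
  limn (fun n => \sum_(j < n) \int[P]_w sum_increment p x phi j w).

(* All that the proof uses of the independence of weights and summands. *)
Record iid_weighted (p x : nat -> T -> R) (X : T -> R) : Prop := IidWeighted {
  iw_mp : forall j, measurable_fun setT (p j) ;
  iw_mx : forall j, measurable_fun setT (x j) ;
  iw_mX : measurable_fun setT X ;
  iw_p0 : forall j w, 0 <= p j w ;
  iw_p1 : forall n w, \sum_(j < n) p j w <= 1 ;
  iw_one : forall j (s : R) (f : R -> R), 0 < s -> measurable_fun setT f -> (forall y, 0 <= f y) ->
    (\int[P]_w (p j w `^ s * f (x j w))%:E =
     \int[P]_w (p j w `^ s)%:E * \int[P]_w (f (X w))%:E)%E ;
  iw_two : forall i j (f g : R -> R), i != j -> measurable_fun setT f -> measurable_fun setT g ->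
    (forall y, 0 <= f y) -> (forall y, 0 <= g y) ->
    (\int[P]_w (p i w * p j w * (f (x i w) * g (x j w)))%:E =
     \int[P]_w (p i w * p j w)%:E * (\int[P]_w (f (X w))%:E * \int[P]_w (g (X w))%:E))%E }.

Section core.
Variables (p x : nat -> T -> R) (X : T -> R).
Hypothesis HW : iid_weighted p x X.
Let mp := iw_mp HW.
Let mx := iw_mx HW.
Let mX := iw_mX HW.
Let p0 := iw_p0 HW.
Let psum := iw_p1 HW.
Local Notation S := (weighted_partial_sum p x).

Lemma weight_le1 j w : p j w <= 1.
Proof. by apply: le_trans (psum j.+1 w); rewrite big_ord_recr/= lerDr sumr_ge0. Qed.

Lemma measurable_partial_sum n : measurable_fun setT (S n).
Proof. by apply: measurable_sum => j; exact: measurable_funM. Qed.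

Definition mean_weight j := \int[P]_w p j w.

Lemma weight_pow_le j s w : 1 <= s -> p j w `^ s <= p j w.
Proof.
move=> s1; have := p0 j w; rewrite le_eqVlt => /predU1P[<-|pj].
  by rewrite powR0// gt_eqF//; lra.
by rewrite ge1r_powR// pj weight_le1.
Qed.

Lemma fin_int_bounded (f : T -> R) (C : R) : measurable_fun setT f -> (forall w, `|f w| <= C) ->
  P.-integrable setT (EFin \o f) /\ (\int[P]_w (f w)%:E = (\int[P]_w f w)%:E)%E.
Proof.
move=> mf fC; have : P.-integrable setT (EFin \o f).
  apply: (@integrable_dom _ _ _ _ f (cst C) C) => //.
  exact: integral_prob_cst.
by move=> fi; split => //; rewrite /Rintegral fineK// (integrable_fin_num _ fi).
Qed.

Lemma mean_weightE j : (\int[P]_w (p j w)%:E = (mean_weight j)%:E)%E.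
Proof.
have [] := @fin_int_bounded (p j) 1 (mp j) _ => // w.
by rewrite ger0_norm// weight_le1.
Qed.

Lemma mean_weight_ge0 j : 0 <= mean_weight j.
Proof. by apply: Rintegral_ge0 => w _. Qed.

Lemma mean_weight_sum n : \sum_(j < n) mean_weight j <= 1.
Proof.
rewrite -lee_fin -sumEFin; under eq_bigr do rewrite -mean_weightE.
rewrite -ge0_integral_sum//; last 2 first.
- by move=> j; apply/measurable_EFinP.
- by move=> j w _; rewrite lee_fin.
rewrite -[leRHS](integral_prob_cst 1).
apply: ge0_le_integral => //.
- by move=> w _; apply: sume_ge0 => j _; rewrite lee_fin.
- by apply: emeasurable_sum => j; apply/measurable_EFinP.
- by move=> w _; have := psum n w; rewrite -lee_fin -sumEFin.
Qed.

Lemma int_weight_fun j (f : R -> R) : measurable_fun setT f -> (forall y, 0 <= f y) ->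
  (\int[P]_w (p j w * f (x j w))%:E = (mean_weight j)%:E * \int[P]_w (f (X w))%:E)%E.
Proof.
move=> mf f0; rewrite -mean_weightE.
have E (g : T -> R) : (fun w => (p j w `^ 1 * g w)%:E) = (fun w => (p j w * g w)%:E).
  by apply/funext => w; rewrite powRr1.
have E1 : (fun w => (p j w `^ 1)%:E) = (fun w => (p j w)%:E).
  by apply/funext => w; rewrite powRr1.
by have := iw_one HW j ltr01 mf f0; rewrite E E1.
Qed.

Lemma int_weight_absX j s :
  (\int[P]_w (p j w * `|x j w| `^ s)%:E = (mean_weight j)%:E * \int[P]_w (`|X w| `^ s)%:E)%E.
Proof.
exact: (int_weight_fun j (measurable_absX s) (fun y => powR_ge0 _ _)).
Qed.

(** Jensen makes the bound linear in the weights, whose expectations sum to at most 1. *)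
Lemma moment_partial_sum_le n s : 1 <= s ->
  (\int[P]_w (`|S n w| `^ s)%:E <= \int[P]_w (`|X w| `^ s)%:E)%E.
Proof.
move=> s1; have s0 : 0 < s by lra.
apply: (@le_trans _ _ (\int[P]_w (\sum_(j < n) (p j w * `|x j w| `^ s)%:E))%E).
  apply: ge0_le_integral => //.
  - apply/measurable_EFinP; apply: (measurableT_comp (measurable_absX s)).
    exact: measurable_partial_sum.
  - apply: emeasurable_sum => j; apply/measurable_EFinP; apply: measurable_funM => //.
    exact: (measurableT_comp (measurable_absX s)).
  move=> w _; rewrite sumEFin lee_fin.
  apply: le_trans (jensen_powR (p := fun j : 'I_n => p j w) (x := fun j : 'I_n => `|x j w|) _ _ _ s1) => //.
  rewrite ge0_ler_powR ?nnegrE ?(ltW s0)//.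
    by apply: sumr_ge0 => j _; rewrite mulr_ge0.
  apply: le_trans (ler_norm_sum _ _ _) _; apply: ler_sum => j _.
  by rewrite normrM (ger0_norm (p0 _ _)).
rewrite ge0_integral_sum//; last 2 first.
- move=> j; apply/measurable_EFinP; apply: measurable_funM => //.
  exact: (measurableT_comp (measurable_absX s)).
- by move=> j w _; rewrite lee_fin mulr_ge0// powR_ge0.
under eq_bigr do rewrite int_weight_absX//.
rewrite -ge0_sume_distrl; last by move=> j _; rewrite lee_fin mean_weight_ge0.
rewrite sumEFin -[leRHS]mul1e; apply: lee_wpmul2r.
  by apply: integral_ge0 => w _; rewrite lee_fin powR_ge0.
by rewrite lee_fin mean_weight_sum.
Qed.

Definition mean_pair i j := \int[P]_w (p i w * p j w).

Lemma mean_pairE i j : (\int[P]_w (p i w * p j w)%:E = (mean_pair i j)%:E)%E.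
Proof.
have [] := @fin_int_bounded (fun w => p i w * p j w) 1 _ _ => //.
- exact: measurable_funM.
- by move=> w; rewrite ger0_norm ?mulr_ge0// mulr_ile1 ?weight_le1.
Qed.


Lemma mean_pair_sum N : \sum_(n < N) \sum_(j < n) mean_pair n j <= 1.
Proof.
have h0 n w : 0 <= \sum_(j < n) p n w * p j w by apply: sumr_ge0 => j _; rewrite mulr_ge0.
have mh n : measurable_fun setT (fun w => (\sum_(j < n) p n w * p j w)%:E).
  by apply/measurable_EFinP; apply: measurable_sum => j; exact: measurable_funM.
have intE n : (\int[P]_w (\sum_(j < n) p n w * p j w)%:E = (\sum_(j < n) mean_pair n j)%:E)%E.
  under eq_integral do rewrite -sumEFin.
  rewrite ge0_integral_sum//; last 2 first.
  - by move=> j; apply/measurable_EFinP; exact: measurable_funM.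
  - by move=> j w _; rewrite lee_fin mulr_ge0.
  by rewrite -sumEFin; apply: eq_bigr => j _; rewrite mean_pairE.
rewrite -lee_fin -sumEFin; under eq_bigr do rewrite -intE.
rewrite -ge0_integral_sum//; last by move=> n w _; rewrite lee_fin.
rewrite -[leRHS](integral_prob_cst 1).
apply: ge0_le_integral => //.
- by move=> w _; apply: sume_ge0 => j _; rewrite lee_fin.
- by apply: emeasurable_sum => j.
move=> w _; rewrite sumEFin lee_fin; apply: le_trans (psum N w).
apply: ler_sum => n _; rewrite -mulr_sumr ler_piMr//.
Qed.

Lemma int_pair i j (f g : R -> R) : i != j -> measurable_fun setT f -> measurable_fun setT g ->
  (forall y, 0 <= f y) -> (forall y, 0 <= g y) ->
  (\int[P]_w (p i w * p j w * (f (x i w) * g (x j w)))%:E =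
   (mean_pair i j)%:E * (\int[P]_w (f (X w))%:E * \int[P]_w (g (X w))%:E))%E.
Proof. by move=> ij mf mg f0 g0; rewrite -mean_pairE (iw_two HW). Qed.

Section moments.
Variables (q k1 kq : R).
Hypotheses (q1 : 1 <= q) (k1E : (\int[P]_w `|X w|%:E = k1%:E)%E)
  (kqE : (\int[P]_w (`|X w| `^ q)%:E = kq%:E)%E).

Let k10 : 0 <= k1.
Proof. by rewrite -lee_fin -k1E; apply: integral_ge0 => w _. Qed.
Let kq0 : 0 <= kq.
Proof. by rewrite -lee_fin -kqE; apply: integral_ge0 => w _; rewrite lee_fin powR_ge0. Qed.

(** Bounds the defect at step [n], after Jensen's inequality for the power of the partial sum and
    [p ^ q <= p] have removed the powers of the weights. The expectations [edom n] are summable with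
    a bound that does not depend on the weights, because the mean weights, and likewise the mean
    products over pairs, sum to at most 1. *)
Let dom n w := p n w * `|x n w| + \sum_(j < n) (p n w * p j w * (`|x n w| * `|x j w| `^ q) +
  p n w * p j w * (`|x n w| `^ q * `|x j w|)).
Let edom n := mean_weight n * k1 + \sum_(j < n) mean_pair n j * (2 * (k1 * kq)).

Let mabs : measurable_fun setT (fun y : R => `|y|) := @normr_measurable R setT.

Let mdom n : measurable_fun setT (dom n).
Proof.
have mxn i : measurable_fun setT (fun w => `|x i w|) by exact: (measurableT_comp mabs).
have mxq i : measurable_fun setT (fun w => `|x i w| `^ q) by exact: (measurableT_comp (measurable_absX q)).
apply: measurable_funD; first exact: measurable_funM.
apply: measurable_sum => j; apply: measurable_funD; apply: measurable_funM;
  by [exact: measurable_funM|exact: measurable_funM].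
Qed.

Let int_dom n : (\int[P]_w (dom n w)%:E = (edom n)%:E)%E.
Proof.
have mxn i : measurable_fun setT (fun w => `|x i w|) by exact: (measurableT_comp mabs).
have mxq i : measurable_fun setT (fun w => `|x i w| `^ q) by exact: (measurableT_comp (measurable_absX q)).
have mpp i j : measurable_fun setT (fun w => p i w * p j w) by exact: measurable_funM.
have m1 j : measurable_fun setT (fun w => (p n w * p j w * (`|x n w| * `|x j w| `^ q))%:E).
  by apply/measurable_EFinP; apply: measurable_funM => //; exact: measurable_funM.
have m2 j : measurable_fun setT (fun w => (p n w * p j w * (`|x n w| `^ q * `|x j w|))%:E).
  by apply/measurable_EFinP; apply: measurable_funM => //; exact: measurable_funM.
have n1 j w : (0 <= (p n w * p j w * (`|x n w| * `|x j w| `^ q))%:E)%E.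
  by rewrite lee_fin !mulr_ge0// powR_ge0.
have n2 j w : (0 <= (p n w * p j w * (`|x n w| `^ q * `|x j w|))%:E)%E.
  by rewrite lee_fin !mulr_ge0// powR_ge0.
under eq_integral do rewrite EFinD -sumEFin.
rewrite ge0_integralD//; last 4 first.
- by move=> w _; rewrite lee_fin mulr_ge0.
- by apply/measurable_EFinP; exact: measurable_funM.
- by move=> w _; apply: sume_ge0 => j _; rewrite EFinD adde_ge0.
- by apply: emeasurable_sum => j; under eq_fun do rewrite EFinD; exact: emeasurable_funD.
rewrite (int_weight_fun n mabs)// k1E -EFinM /edom EFinD; congr (_ + _)%E.
rewrite ge0_integral_sum//; last 2 first.
- by move=> j; under eq_fun do rewrite EFinD; exact: emeasurable_funD.
- by move=> j w _; rewrite EFinD adde_ge0.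
rewrite -sumEFin; apply: eq_bigr => j _.
under eq_integral do rewrite EFinD.
rewrite ge0_integralD//.
have nj : (n != j :> nat) by rewrite neq_ltn ltn_ord orbT.
rewrite (int_pair nj mabs (measurable_absX q))//.
rewrite (int_pair nj (measurable_absX q) mabs)//.
rewrite k1E kqE -!EFinM -EFinD; congr _%:E; ring.
Qed.

Let edom_ge0 n : 0 <= edom n.
Proof. by rewrite -lee_fin -int_dom; apply: integral_ge0 => w _; rewrite lee_fin addr_ge0 ?sumr_ge0 ?mulr_ge0// => j _; rewrite addr_ge0// !mulr_ge0 ?powR_ge0. Qed.

Definition moment_bound := k1 + 2 * (k1 * kq).

Let edom_sum N : \sum_(n < N) edom n <= moment_bound.
Proof.
rewrite /edom big_split/= lerD//.
  by rewrite -mulr_suml -[leRHS]mul1r ler_wpM2r// mean_weight_sum.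
under eq_bigr do rewrite -mulr_suml.
by rewrite -mulr_suml -[leRHS]mul1r ler_wpM2r ?mean_pair_sum// !mulr_ge0.
Qed.

Lemma measurable_sum_increment phi n : measurable_fun setT phi ->
  measurable_fun setT (sum_increment p x phi n).
Proof.
move=> mphi; apply: measurable_funB.
  by apply: measurable_funB; apply: (measurableT_comp mphi); exact: measurable_partial_sum.
apply: measurable_fun_ifT => //.
  by apply: measurable_fun_ltr => //; exact: (measurableT_comp mabs).
by apply: (measurableT_comp mphi); exact: measurable_funM.
Qed.

(** The part [2 ^ q + 2] comes from [growth_lip_defect]; the other 2 pays for the summands with
    [|x n| <= 1], for which [|phi y| <= 2 * C * |y|]. *)
Definition growth_const := 2 `^ q + 4.

Let incr_le phi C n w : growth_lip q phi C ->
  `|sum_increment p x phi n w| <= C * growth_const * dom n w.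
Proof.
move=> Hl; have C0 := growth_lip_ge0 Hl.
have q0 : 0 < q by exact: lt_le_trans ltr01 q1.
pose s := S n w; pose y := p n w * x n w.
have ny : `|y| = p n w * `|x n w| by rewrite normrM (ger0_norm (p0 _ _)).
have ys : `|y| + `|y| * `|s| `^ q + `|s| * `|y| `^ q <= dom n w.
  rewrite /dom -addrA ny lerD2l big_split/= lerD//.
  - have : `|s| `^ q <= \sum_(j < n) p j w * `|x j w| `^ q.
      apply: le_trans (jensen_powR (p := fun j : 'I_n => p j w) (x := fun j : 'I_n => `|x j w|) _ _ _ q1) => //.
      rewrite ge0_ler_powR ?nnegrE ?(ltW q0)//.
        by apply: sumr_ge0 => j _; rewrite mulr_ge0.
      apply: le_trans (ler_norm_sum _ _ _) _; apply: ler_sum => j _.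
      by rewrite normrM (ger0_norm (p0 _ _)).
    move/(ler_wpM2l (_ : 0 <= p n w * `|x n w|)) => H.
    apply: le_trans (H _) _; first by rewrite mulr_ge0.
    by rewrite mulr_sumr le_eqVlt; apply/orP; left; apply/eqP; apply: eq_bigr => j _; ring.
  - have hs : `|s| <= \sum_(j < n) p j w * `|x j w|.
      apply: le_trans (ler_norm_sum _ _ _) _; apply: ler_sum => j _.
      by rewrite normrM (ger0_norm (p0 _ _)).
    have hy : (p n w * `|x n w|) `^ q <= p n w * `|x n w| `^ q.
      by rewrite powRM// ler_wpM2r ?powR_ge0// weight_pow_le.
    apply: le_trans (ler_pM _ _ hs hy) _ => //; first exact: powR_ge0.
    by rewrite mulr_suml le_eqVlt; apply/orP; left; apply/eqP; apply: eq_bigr => j _; ring.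
have hdef := growth_lip_defect s y q1 Hl.
have SE : S n.+1 w = s + y by rewrite /weighted_partial_sum big_ord_recr.
have d0 : 0 <= `|y| + `|y| * `|s| `^ q + `|s| * `|y| `^ q.
  by rewrite !addr_ge0// mulr_ge0// powR_ge0.
rewrite /sum_increment SE -/s -/y.
suff H : `|phi (s + y) - phi s - (if 1 < `|x n w| then phi y else 0)| <=
   C * growth_const * (`|y| + `|y| * `|s| `^ q + `|s| * `|y| `^ q).
  apply: le_trans H _; rewrite ler_wpM2l// mulr_ge0//.
  by rewrite addr_ge0// powR_ge0.
case: ifPn => [_|]; last rewrite -leNgt => xle.
  apply: le_trans hdef _; rewrite ler_wpM2r// ler_wpM2l// /growth_const; lra.
have y1 : `|y| <= 1 by rewrite ny mulr_ile1 ?weight_le1.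
have hphi : `|phi y| <= C * (`|y| * 2).
  apply: le_trans (growth_lip_norm _ q0 Hl) _; rewrite !ler_wpM2l//.
  rewrite [leRHS](_ : 2 = 1 + 1 `^ q); last by rewrite powR1; ring.
  by rewrite lerD2l ge0_ler_powR ?nnegrE// ltW.
have -> : phi (s + y) - phi s - 0 = (phi (s + y) - phi s - phi y) + phi y by ring.
apply: le_trans (ler_normD _ _) _; apply: le_trans (lerD hdef hphi) _.
have -> : C * growth_const * (`|y| + `|y| * `|s| `^ q + `|s| * `|y| `^ q) =
  C * (2 `^ q + 2) * (`|y| + `|y| * `|s| `^ q + `|s| * `|y| `^ q) +
  C * (`|y| * 2 + 2 * (`|y| * `|s| `^ q + `|s| * `|y| `^ q)).
  by rewrite /growth_const; ring.
rewrite lerD2l ler_wpM2l// lerDl mulr_ge0// addr_ge0// mulr_ge0// powR_ge0.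
Qed.

Let mphiL phi C : growth_lip q phi C -> measurable_fun setT phi. Proof. by case. Qed.

Let int_cdom C n : 0 <= C -> (\int[P]_w (C * growth_const * dom n w)%:E = (C * growth_const * edom n)%:E)%E.
Proof.
move=> C0; under eq_integral do rewrite EFinM.
rewrite ge0_integralZl//.
- by rewrite int_dom -EFinM.
- exact/measurable_EFinP.
- move=> w _; rewrite lee_fin addr_ge0 ?sumr_ge0 ?mulr_ge0// => j _.
  by rewrite addr_ge0// !mulr_ge0 ?powR_ge0.
- by rewrite lee_fin mulr_ge0// addr_ge0// powR_ge0.
Qed.

Lemma integrable_sum_increment phi C n : growth_lip q phi C ->
  P.-integrable setT (EFin \o sum_increment p x phi n).
Proof.
move=> Hl; apply: (integrable_dom _ _ (fun w => incr_le n w Hl)).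
- exact: measurable_sum_increment (mphiL Hl).
- exact: measurable_funM.
- exact: int_cdom (growth_lip_ge0 Hl).
Qed.

Let Rint_incr phi C n : growth_lip q phi C ->
  `|\int[P]_w sum_increment p x phi n w| <= C * growth_const * edom n.
Proof.
move=> Hl; apply: (Rintegral_dom _ _ (fun w => incr_le n w Hl)).
- exact: measurable_sum_increment (mphiL Hl).
- exact: measurable_funM.
- exact: int_cdom (growth_lip_ge0 Hl).
Qed.

(** The factor of [C] depends on the law of [X] alone, so the bound is uniform over all families of
    weights. *)
Lemma sum_functional_bound phi C : growth_lip q phi C ->
  `|sum_functional p x phi| <= C * (growth_const * moment_bound).
Proof.
move=> Hl; rewrite mulrA.
have Cg : 0 <= C * growth_const.
  by rewrite mulr_ge0 ?(growth_lip_ge0 Hl)// addr_ge0// powR_ge0.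
have H n := Rint_incr n Hl.
refine (lim_dominated_series edom_ge0 edom_sum Cg H).
Qed.

Lemma cvg_sum_functional phi C : growth_lip q phi C ->
  (fun n => \sum_(j < n) \int[P]_w sum_increment p x phi j w) @ \oo --> sum_functional p x phi.
Proof.
by move=> Hl; have H n := Rint_incr n Hl; refine (cvg_dominated_series edom_ge0 edom_sum H).
Qed.

Lemma sum_functionalD phi psi C C' k : growth_lip q phi C -> growth_lip q psi C' ->
  sum_functional p x (fun y => phi y + k * psi y) =
  sum_functional p x phi + k * sum_functional p x psi.
Proof.
move=> H1 H2; apply: cvg_lim => //.
have E n : \int[P]_w sum_increment p x (fun y => phi y + k * psi y) n w =
    \int[P]_w sum_increment p x phi n w + k * \int[P]_w sum_increment p x psi n w.
  have i1 := integrable_sum_increment n H1; have i2 := integrable_sum_increment n H2.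
  rewrite -(RintegralDZ k i1 i2).
  by apply: eq_Rintegral => w _; rewrite /sum_increment; case: ifP => _; ring.
under eq_fun do (under eq_bigr do rewrite E; rewrite big_split/= -mulr_sumr).
by apply: cvgD; [exact: cvg_sum_functional H1|apply: cvgMr; exact: cvg_sum_functional H2].
Qed.

End moments.
End core.
End functionals.

(** Linear domination on the unit interval matches the only control on the weights, a total mass of
    at most 1. Powers of exponent at least 1 belong to the class, and so do their products with
    powers of the logarithm when the exponent exceeds 1. *)
Definition weight_dom (R : realType) (f : R -> R) (C : R) :=
  measurable_fun setT f /\ forall y, 0 <= y <= 1 -> `|f y| <= C * y.

Definition big_moment d (T : measurableType d) (R : realType) (P : probability T R) (X : T -> R) (s : R) :=
  \int[P]_w (if 1 < `|X w| then `|X w| `^ s else 0).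

Lemma powR_le1D (R : realType) (s q y : R) : 0 < s -> s <= q -> 0 <= y -> y `^ s <= 1 + y `^ q.
Proof.
move=> s0 sq y0; have [h|h] := leP y 1.
  have -> : (1 : R) = 1 `^ s by rewrite powR1.
  by rewrite (@le_trans _ _ (1 `^ s))// ?ge0_ler_powR ?nnegrE// ?(ltW s0)// lerDl powR_ge0.
by rewrite (@le_trans _ _ (y `^ q))// ?ler_powR ?(ltW h)// lerDr.
Qed.

Lemma moment_le1D d (T : measurableType d) (R : realType) (P : probability T R) (Y : T -> R) (s q : R) :
  measurable_fun setT Y -> (forall w, 0 <= Y w) -> 0 < s -> s <= q ->
  (\int[P]_w (Y w `^ s)%:E <= 1 + \int[P]_w (Y w `^ q)%:E)%E.
Proof.
move=> mY Y0 s0 sq.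
have mp r : measurable_fun setT (fun w => (Y w `^ r)%:E).
  by apply/measurable_EFinP; exact: (measurableT_comp (measurable_powR r)).
have p0 r w : [set: T] w -> (0 <= (Y w `^ r)%:E)%E by rewrite lee_fin powR_ge0.
rewrite -[X in (X + _)%E](integral_prob_cst P 1) -ge0_integralD//.
- apply: ge0_le_integral => //; [exact: p0|exact: emeasurable_funD|].
  by move=> w _; rewrite -EFinD lee_fin powR_le1D.
- exact: p0.
Qed.

Section weight_functional_theory.
Context d (T : measurableType d) (R : realType) (P : probability T R).
Variables (p x : nat -> T -> R) (X : T -> R).
Hypothesis HW : iid_weighted P p x X.
Let mp := iw_mp HW.
Let mx := iw_mx HW.
Let mX := iw_mX HW.
Let p0 := iw_p0 HW.
Let psum := iw_p1 HW.
Local Notation S := (weighted_partial_sum p x).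

Lemma weight_dom_ge0 (f : R -> R) C : weight_dom f C -> 0 <= C.
Proof. by case=> _ /(_ 1); rewrite ler01 lexx mulr1 => /(_ isT); apply: le_trans. Qed.

Let dom_le (f : R -> R) C j w : weight_dom f C -> `|f (p j w)| <= C * p j w.
Proof. by case=> _; apply; rewrite p0 (weight_le1 HW). Qed.

Lemma integrable_weight (f : R -> R) C j : weight_dom f C -> P.-integrable setT (EFin \o (fun w => f (p j w))).
Proof.
move=> H; have C0 := weight_dom_ge0 H.
have [] := @fin_int_bounded _ _ _ P (fun w => f (p j w)) C _ _ => //.
- by apply: (measurableT_comp _ (mp j)); case: H.
- move=> w; apply: le_trans (dom_le j w H) _.
  by rewrite ler_piMr// (weight_le1 HW).
Qed.

Let Rint_weight (f : R -> R) C j : weight_dom f C -> `|\int[P]_w f (p j w)| <= C * mean_weight P p j.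
Proof.
move=> H; have C0 := weight_dom_ge0 H.
apply: (Rintegral_dom _ _ (fun w => dom_le j w H)).
- by apply: (measurableT_comp _ (mp j)); case: H.
- exact: measurable_funM.
- under eq_integral do rewrite EFinM.
  rewrite ge0_integralZl//; first by rewrite (mean_weightE HW).
    exact/measurable_EFinP.
  by move=> w _; rewrite lee_fin.
Qed.

Let e0 n : 0 <= mean_weight P p n. Proof. exact: (mean_weight_ge0 HW). Qed.
Let e1 n : \sum_(j < n) mean_weight P p j <= 1. Proof. exact: (mean_weight_sum HW). Qed.

Lemma weight_functional_bound (f : R -> R) C : weight_dom f C ->
  `|weight_functional P p f| <= C.
Proof.
move=> H; rewrite -[leRHS]mulr1; have Hn n := Rint_weight n H.
refine (lim_dominated_series e0 e1 (weight_dom_ge0 H) Hn).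
Qed.

Lemma cvg_weight_functional (f : R -> R) C : weight_dom f C ->
  (fun n => \sum_(j < n) \int[P]_w f (p j w)) @ \oo --> weight_functional P p f.
Proof. by move=> H; have Hn n := Rint_weight n H; refine (cvg_dominated_series e0 e1 Hn). Qed.

Lemma weight_functionalD (f g : R -> R) C C' k : weight_dom f C -> weight_dom g C' ->
  weight_functional P p (fun y => f y + k * g y) =
  weight_functional P p f + k * weight_functional P p g.
Proof.
move=> H1 H2; apply: cvg_lim => //.
have E n : \int[P]_w (f (p n w) + k * g (p n w)) =
    \int[P]_w f (p n w) + k * \int[P]_w g (p n w).
  by have i1 := integrable_weight n H1; have i2 := integrable_weight n H2; exact: RintegralDZ.
under eq_fun do (under eq_bigr do rewrite E; rewrite big_split/= -mulr_sumr).
by apply: cvgD; [exact: cvg_weight_functional H1|apply: cvgMr; exact: cvg_weight_functional H2].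
Qed.

Lemma weight_functional_ge0 (f : R -> R) C : weight_dom f C -> (forall y, 0 <= y <= 1 -> 0 <= f y) ->
  0 <= weight_functional P p f.
Proof.
move=> H f0; apply: (limr_ge (cvgP _ (cvg_weight_functional H))).
apply: nearW => n; apply: sumr_ge0 => j _; apply: Rintegral_ge0 => w _; apply: f0.
by rewrite p0 (weight_le1 HW).
Qed.

Lemma weight_dom_powR (s : R) : 1 <= s -> weight_dom (fun y : R => y `^ s) 1.
Proof.
move=> s1; split; first exact: measurable_powR.
move=> y /andP[y0 y1]; rewrite mul1r ger0_norm ?powR_ge0//.
move: y0; rewrite le_eqVlt => /predU1P[<-|y0]; first by rewrite powR0// gt_eqF//; lra.
by rewrite ge1r_powR// y0 y1.
Qed.

Lemma integrable_abs_moment (Y : T -> R) (s k : R) : measurable_fun setT Y ->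
  (\int[P]_w (`|Y w| `^ s)%:E <= k%:E)%E ->
  P.-integrable setT (EFin \o (fun w => `|Y w| `^ s)) /\
  (\int[P]_w (`|Y w| `^ s)%:E = (\int[P]_w `|Y w| `^ s)%:E)%E.
Proof.
move=> mY Yk.
have mYs : measurable_fun setT (fun w => `|Y w| `^ s) by exact: (measurableT_comp (measurable_absX s)).
have fn : (\int[P]_w (`|Y w| `^ s)%:E \is a fin_num)%E.
  rewrite ge0_fin_numE; last by apply: integral_ge0 => w _; rewrite lee_fin powR_ge0.
  by apply: le_lt_trans Yk _; exact: ltry.
split; last by rewrite /Rintegral fineK.
apply: (@integrable_dom _ _ _ _ _ (fun w => `|Y w| `^ s) (\int[P]_w `|Y w| `^ s)) => //.
- by move=> w; rewrite ger0_norm// powR_ge0.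
- by rewrite /Rintegral fineK.
Qed.

Section power.
Variables (q k1 kq s ks : R).
Hypotheses (q1 : 1 <= q) (k1E : (\int[P]_w `|X w|%:E = k1%:E)%E)
  (kqE : (\int[P]_w (`|X w| `^ q)%:E = kq%:E)%E)
  (s1 : 1 <= s) (ksE : (\int[P]_w (`|X w| `^ s)%:E = ks%:E)%E).

Let bigp (y : R) := if 1 < `|y| then `|y| `^ s else 0.

Let mbigp : measurable_fun setT bigp.
Proof.
apply: measurable_fun_ifT => //.
  by apply: measurable_fun_ltr => //; exact: normr_measurable.
exact: measurable_absX.
Qed.

Lemma big_momentE : (\int[P]_w (bigp (X w))%:E = (big_moment P X s)%:E)%E.
Proof.
rewrite /big_moment /Rintegral fineK// ge0_fin_numE; last first.
  by apply: integral_ge0 => w _; rewrite lee_fin /bigp; case: ifP => // _; exact: powR_ge0.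
apply: (@le_lt_trans _ _ ks%:E); last exact: ltry.
rewrite -ksE; apply: ge0_le_integral => //.
- by move=> w _; rewrite lee_fin /bigp; case: ifP => // _; exact: powR_ge0.
- by apply/measurable_EFinP; exact: (measurableT_comp mbigp).
- by apply/measurable_EFinP; exact: (measurableT_comp (measurable_absX s)).
- by move=> w _; rewrite lee_fin /bigp; case: ifP => // _; exact: powR_ge0.
Qed.

Lemma int_partial_sum_moment n : P.-integrable setT (EFin \o (fun w => `|S n w| `^ s)).
Proof.
apply: (proj1 (@integrable_abs_moment (S n) s ks _ _)).
  exact: (measurable_partial_sum HW).
by rewrite -ksE; exact: (moment_partial_sum_le HW).
Qed.

(** Telescoping: the increment of the moment at step [n] is that of the sum functional plus the
    expectation of [|p n * x n| ^ s] on [|x n| > 1], and the latter factorizes by independence. *)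
Lemma cvg_moment_partial_sum C : growth_lip q (fun y => `|y| `^ s) C ->
  (fun n => \int[P]_w `|S n w| `^ s) @ \oo -->
  sum_functional P p x (fun y => `|y| `^ s) +
  big_moment P X s * weight_functional P p (fun y => y `^ s).
Proof.
move=> Hl.
have s0 : 0 < s by exact: lt_le_trans ltr01 s1.
have bigE n : (\int[P]_w (if 1 < `|x n w| then `|p n w * x n w| `^ s else 0)%:E =
   (big_moment P X s * \int[P]_w (p n w `^ s))%:E)%E.
  have E w : (if 1 < `|x n w| then `|p n w * x n w| `^ s else 0) = p n w `^ s * bigp (x n w).
    rewrite /bigp; case: ifP => _; last by rewrite mulr0.
    by rewrite normrM (ger0_norm (p0 _ _)) powRM.
  under eq_integral do rewrite E.
  rewrite (iw_one HW n s0 mbigp); last by move=> y; rewrite /bigp; case: ifP => // _; exact: powR_ge0.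
  rewrite big_momentE muleC EFinM; congr (_ * _)%E.
  rewrite /Rintegral fineK//.
  by have := integrable_fin_num measurableT (integrable_weight n (weight_dom_powR s1)).
have bigi n : P.-integrable setT (EFin \o (fun w => if 1 < `|x n w| then `|p n w * x n w| `^ s else 0)).
  apply: (integrable_dom _ _ _ (bigE n)).
  - apply: measurable_fun_ifT => //.
      by apply: measurable_fun_ltr => //; exact: (measurableT_comp (@normr_measurable _ _)).
    by apply: (measurableT_comp (measurable_absX s)); exact: measurable_funM.
  - apply: measurable_fun_ifT => //.
      by apply: measurable_fun_ltr => //; exact: (measurableT_comp (@normr_measurable _ _)).
    by apply: (measurableT_comp (measurable_absX s)); exact: measurable_funM.
  - by move=> w; case: ifP => _; rewrite ?normr0// ger0_norm ?powR_ge0.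
have step n : \int[P]_w sum_increment p x (fun y => `|y| `^ s) n w =
   \int[P]_w `|S n.+1 w| `^ s - \int[P]_w `|S n w| `^ s - big_moment P X s * \int[P]_w (p n w `^ s).
  have E : big_moment P X s * \int[P]_w (p n w `^ s) = \int[P]_w (if 1 < `|x n w| then `|p n w * x n w| `^ s else 0).
    by rewrite [RHS]/Rintegral bigE.
  rewrite E.
  have i1 := int_partial_sum_moment n.+1; have i2 := int_partial_sum_moment n.
  rewrite -RintegralB// -RintegralB//.
  exact: (integrableB measurableT i1 i2).
have sumE n : \int[P]_w `|S n w| `^ s = \sum_(j < n) \int[P]_w sum_increment p x (fun y => `|y| `^ s) j w +
   big_moment P X s * \sum_(j < n) \int[P]_w (p j w `^ s).
  elim: n => [|n IH].
    rewrite !big_ord0 mulr0 addr0 /Rintegral.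
    under eq_integral do rewrite /weighted_partial_sum big_ord0 normr0 powR0 ?gt_eqF//.
    by rewrite integral0.
  by rewrite !big_ord_recr/= step mulrDr; move: IH => ->; ring.
rewrite (funext sumE); apply: cvgD; first exact: (cvg_sum_functional HW q1 k1E kqE Hl).
by apply: cvgMr; exact: cvg_weight_functional (weight_dom_powR s1).
Qed.
End power.
End weight_functional_theory.

Lemma integrableDZ d (T : measurableType d) (R : realType) (P : {measure set T -> \bar R})
    (f g : T -> R) (k : R) :
  P.-integrable setT (EFin \o f) -> P.-integrable setT (EFin \o g) ->
  P.-integrable setT (EFin \o (fun w => f w + k * g w)).
Proof.
move=> fi gi.
have ki : P.-integrable setT (EFin \o (fun w => k * g w)).
  by have := integrableZl measurableT k gi; apply: eq_integrable => // w _.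
exact: (integrableD measurableT fi ki).
Qed.

Lemma maxr0_subN (R : realType) (a : R) : Num.max a 0 - Num.max (- a) 0 = a.
Proof.
have [h|/ltW h] := leP 0 a.
  by rewrite (max_idPr _) ?subr0//; lra.
by rewrite (max_idPl _) ?sub0r ?opprK//; lra.
Qed.

(** * Second moments of centered sums *)

Section second_moment.
Context d (T : measurableType d) (R : realType) (P : probability T R).
Variables (p x : nat -> T -> R) (X : T -> R).
Hypothesis HW : iid_weighted P p x X.
Let mp := iw_mp HW.
Let mx := iw_mx HW.
Let mX := iw_mX HW.
Let p0 := iw_p0 HW.
Let psum := iw_p1 HW.
Local Notation S := (weighted_partial_sum p x).

Section centered.
Variables (y : R -> R) (v : R).
Hypotheses (my : measurable_fun setT y) (yi : P.-integrable setT (EFin \o (fun w => y (X w))))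
  (ymean : \int[P]_w y (X w) = 0) (yv : (\int[P]_w (y (X w) ^+ 2)%:E = v%:E)%E).

Let S_y n w := \sum_(j < n) p j w * y (x j w).

Let mmax : measurable_fun setT (fun z : R => Num.max (y z) 0).
Proof. exact: measurable_maxr. Qed.
Let mmin : measurable_fun setT (fun z : R => Num.max (- y z) 0).
Proof. by apply: measurable_maxr => //; exact: measurable_funN. Qed.

(** Independence is available for nonnegative functions only. Centering therefore enters as equality
    of the expectations of the positive and negative parts, and the four products in [cross]
    cancel. *)
Let posneg : exists A : R, (\int[P]_w (Num.max (y (X w)) 0)%:E = A%:E)%E /\
  (\int[P]_w (Num.max (- y (X w)) 0)%:E = A%:E)%E.
Proof.
have absi : P.-integrable setT (EFin \o (fun w => `|y (X w)|)) := integrable_abse yi.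
have mpos : measurable_fun setT (fun w => Num.max (y (X w)) 0) by exact: (measurableT_comp mmax).
have mneg : measurable_fun setT (fun w => Num.max (- y (X w)) 0) by exact: (measurableT_comp mmin).
have posi : P.-integrable setT (EFin \o (fun w => Num.max (y (X w)) 0)).
  apply: le_integrable absi => //; first exact/measurable_EFinP.
  move=> w _ /=; rewrite lee_fin normr_id ger0_norm ?le_max ?lexx ?orbT//.
  by rewrite ge_max ler_norm normr_ge0.
have negi : P.-integrable setT (EFin \o (fun w => Num.max (- y (X w)) 0)).
  apply: le_integrable absi => //; first exact/measurable_EFinP.
  move=> w _ /=; rewrite lee_fin normr_id ger0_norm ?le_max ?lexx ?orbT//.
  by rewrite ge_max normr_ge0 andbT -normrN ler_norm.
exists (\int[P]_w Num.max (y (X w)) 0).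
have E1 : (\int[P]_w (Num.max (y (X w)) 0)%:E = (\int[P]_w Num.max (y (X w)) 0)%:E)%E.
  by rewrite /Rintegral fineK// (integrable_fin_num _ posi).
have E2 : (\int[P]_w (Num.max (- y (X w)) 0)%:E = (\int[P]_w Num.max (- y (X w)) 0)%:E)%E.
  by rewrite /Rintegral fineK// (integrable_fin_num _ negi).
split => //; rewrite E2; congr _%:E.
have : \int[P]_w (Num.max (y (X w)) 0 - Num.max (- y (X w)) 0) = 0.
  by rewrite -[RHS]ymean; apply: eq_Rintegral => w _; exact: maxr0_subN.
by rewrite RintegralB// => /eqP; rewrite subr_eq0 => /eqP.
Qed.

Let cross i j : i != j -> P.-integrable setT (EFin \o (fun w => p i w * p j w * (y (x i w) * y (x j w)))) /\
  \int[P]_w (p i w * p j w * (y (x i w) * y (x j w))) = 0.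
Proof.
move=> ij; have [A [pA nA]] := posneg.
pose yp (z : R) := Num.max (y z) 0; pose yn (z : R) := Num.max (- y z) 0.
have yp0 z : 0 <= yp z by rewrite /yp le_max lexx orbT.
have yn0 z : 0 <= yn z by rewrite /yn le_max lexx orbT.
have term (f g : R -> R) : measurable_fun setT f -> measurable_fun setT g ->
    (forall z, 0 <= f z) -> (forall z, 0 <= g z) ->
    (\int[P]_w (f (X w))%:E = A%:E)%E -> (\int[P]_w (g (X w))%:E = A%:E)%E ->
    P.-integrable setT (EFin \o (fun w => p i w * p j w * (f (x i w) * g (x j w)))) /\
    \int[P]_w (p i w * p j w * (f (x i w) * g (x j w))) = mean_pair P p i j * (A * A).
  move=> mf mg f0 g0 fA gA.
  have E : (\int[P]_w (p i w * p j w * (f (x i w) * g (x j w)))%:E = (mean_pair P p i j * (A * A))%:E)%E.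
    by rewrite (int_pair HW ij)// fA gA -!EFinM.
  split; last by rewrite /Rintegral E.
  have m : measurable_fun setT (fun w => p i w * p j w * (f (x i w) * g (x j w))).
    apply: measurable_funM; first exact: measurable_funM.
    by apply: measurable_funM; [exact: (measurableT_comp mf)|exact: (measurableT_comp mg)].
  apply: (integrable_dom m m _ E) => w.
  by rewrite ger0_norm// !mulr_ge0.
have [i1 e1] := term yp yp mmax mmax yp0 yp0 pA pA.
have [i2 e2] := term yn yn mmin mmin yn0 yn0 nA nA.
have [i3 e3] := term yp yn mmax mmin yp0 yn0 pA nA.
have [i4 e4] := term yn yp mmin mmax yn0 yp0 nA pA.
have yE z : y z = yp z - yn z.
  by rewrite /yp /yn maxr0_subN.
pose h w := (p i w * p j w * (yp (x i w) * yp (x j w)) + p i w * p j w * (yn (x i w) * yn (x j w)))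
  - (p i w * p j w * (yp (x i w) * yn (x j w)) + p i w * p j w * (yn (x i w) * yp (x j w))).
have hE : (fun w => p i w * p j w * (y (x i w) * y (x j w))) = h.
  by apply/funext => w; rewrite /h !yE; ring.
have i12 := integrableD measurableT i1 i2.
have i34 := integrableD measurableT i3 i4.
rewrite hE; split; first exact: (integrableB measurableT i12 i34).
by rewrite /h RintegralB// RintegralD// RintegralD// e1 e2 e3 e4; ring.
Qed.

(** Orthogonality of the centered summands. Besides the identity, [y] will be a centered truncation,
    since [X] itself may have infinite variance. *)
Lemma second_moment n : P.-integrable setT (EFin \o (fun w => S_y n w ^+ 2)) /\
  \int[P]_w (S_y n w ^+ 2) = v * \sum_(j < n) \int[P]_w (p j w `^ 2).
Proof.
have sqi j : P.-integrable setT (EFin \o (fun w => p j w `^ 2 * y (x j w) ^+ 2)) /\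
    \int[P]_w (p j w `^ 2 * y (x j w) ^+ 2) = v * \int[P]_w (p j w `^ 2).
  have m2 : measurable_fun setT (fun z => y z ^+ 2) by exact: measurable_funX.
  have n2 z : 0 <= y z ^+ 2 by exact: sqr_ge0.
  have p2 : (\int[P]_w (p j w `^ 2)%:E = (\int[P]_w (p j w `^ 2))%:E)%E.
    rewrite /Rintegral fineK//.
    by have := integrable_fin_num measurableT (integrable_weight HW j (weight_dom_powR (ler1n R 2))).
  have E : (\int[P]_w (p j w `^ 2 * y (x j w) ^+ 2)%:E = (v * \int[P]_w (p j w `^ 2))%:E)%E.
    by rewrite (iw_one HW j (ltr0n R 2) m2 n2) yv p2 -EFinM mulrC.
  split; last by rewrite [LHS]/Rintegral E.
  have m : measurable_fun setT (fun w => p j w `^ 2 * y (x j w) ^+ 2).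
    apply: measurable_funM; first exact: (measurableT_comp (measurable_powR _)).
    exact: (measurableT_comp m2).
  by apply: (integrable_dom m m _ E) => w; rewrite ger0_norm// mulr_ge0// powR_ge0.
elim: n => [|n [IHi IHe]].
  have E w : S_y 0 w ^+ 2 = 0 by rewrite /S_y big_ord0 expr0n.
  split; last by rewrite big_ord0 mulr0 -[RHS]/(fine 0%E) /Rintegral; under eq_integral do rewrite E; rewrite integral0.
  rewrite (_ : EFin \o _ = cst 0%E); first exact: integrable0.
  by apply/funext => w /=; rewrite E.
pose c w := \sum_(j < n) (p n w * p j w * (y (x n w) * y (x j w))).
have [ci ce] : P.-integrable setT (EFin \o c) /\ \int[P]_w c w = 0.
  suff H m : (m <= n)%N -> P.-integrable setT (EFin \o (fun w => \sum_(j < m) (p n w * p j w * (y (x n w) * y (x j w))))) /\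
      \int[P]_w (\sum_(j < m) (p n w * p j w * (y (x n w) * y (x j w)))) = 0 by exact: H.
  elim: m => [_|m IH mn].
    have E : (fun w => \sum_(j < 0) (p n w * p j w * (y (x n w) * y (x j w)))) = cst 0.
      by apply/funext => w; rewrite big_ord0.
    rewrite E; split; first exact: integrable0.
    by rewrite /Rintegral/= integral0.
  have [i1 e1] := IH (ltnW mn).
  have [i2 e2] : P.-integrable setT (EFin \o (fun w => p n w * p m w * (y (x n w) * y (x m w)))) /\
      \int[P]_w (p n w * p m w * (y (x n w) * y (x m w))) = 0.
    by apply: cross; rewrite neq_ltn mn orbT.
  under eq_fun do rewrite big_ord_recr/=.
  split; first by have := integrableD measurableT i1 i2; apply: eq_integrable => // w _; rewrite /= big_ord_recr.
  by rewrite RintegralD// e1 e2 addr0.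
have [si se] := sqi n.
have E w : S_y n.+1 w ^+ 2 = (S_y n w ^+ 2 + p n w `^ 2 * y (x n w) ^+ 2) + 2 * c w.
  have -> : c w = p n w * y (x n w) * S_y n w.
    by rewrite /c /S_y mulr_sumr; apply: eq_bigr => j _; ring.
  rewrite {1}/S_y big_ord_recr/= -/(S_y n w) powR_mulrn//; ring.
have i12 : P.-integrable setT (EFin \o (fun w => S_y n w ^+ 2 + p n w `^ 2 * y (x n w) ^+ 2)) := integrableD measurableT IHi si.
rewrite (_ : (fun w => S_y n.+1 w ^+ 2) = (fun w => (S_y n w ^+ 2 + p n w `^ 2 * y (x n w) ^+ 2) + 2 * c w)); last exact/funext.
split; first exact: integrableDZ.
by rewrite RintegralDZ// ce mulr0 addr0 RintegralD// IHe se big_ord_recr/= mulrDr.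
Qed.

End centered.
End second_moment.

Section bounded_convergence.
Context d (T : measurableType d) (R : realType) (P : probability T R).

Lemma bounded_convergence (g : nat -> T -> R) (G : T -> R) (C : R) :
  (forall n, measurable_fun setT (g n)) -> (forall n w, `|g n w| <= C) ->
  {ae P, forall w, g ^~ w @ \oo --> G w} ->
  (fun n => \int[P]_w g n w) @ \oo --> \int[P]_w G w /\
  (\int[P]_w (G w)%:E = (\int[P]_w G w)%:E)%E.
Proof.
move=> mg gC gG.
(* A measurable version of [G], which is itself only an almost sure limit. *)
pose h w := limn_esup (fun n => (g n w)%:E).
have hG : {ae P, forall w, h w = (G w)%:E}.
  apply: filterS gG => w gw.
  by apply: (cvg_limn_einf_sup _).2; apply: cvg_EFin => //; exact: nearW.
have mh : measurable_fun setT h.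
  by apply: measurable_fun_limn_esup => n; exact/measurable_EFinP.
have [] := @dominated_convergence _ _ _ P setT measurableT (fun n => EFin \o g n) h (cst C%:E) _ mh.
- by move=> n; exact/measurable_EFinP.
- apply: filterS gG => w gw _.
  rewrite /h (cvg_limn_einf_sup (_ : (fun n => (g n w)%:E) @ \oo --> (G w)%:E)).2.
    by apply: cvg_EFin => //; exact: nearW.
  by apply: cvg_EFin => //; exact: nearW.
- have [] := @fin_int_bounded _ _ _ P (cst C) `|C|; by [|move=> ? ?|].
- by apply: aeW => w n _; rewrite /= lee_fin.
move=> hi _ hcvg.
have GE : (\int[P]_w (G w)%:E = \int[P]_w h w)%E.
  by apply/esym; apply: integral_ae_eq.
have Gfin : (\int[P]_w (G w)%:E \is a fin_num)%E by rewrite GE; exact: integrable_fin_num.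
split; last by rewrite /Rintegral fineK.
have : (fun n => \int[P]_w (g n w)%:E)%E @ \oo --> (fine (\int[P]_w (G w)%:E))%:E.
  by rewrite fineK// GE.
by move/fine_cvgP => [].
Qed.

End bounded_convergence.

(** * Truncated powers and uniform integrability *)

Section truncation.
Context d (T : measurableType d) (R : realType) (P : probability T R).

Definition trunc_pow (s M y : R) := Num.min `|y| M `^ s.

Lemma trunc_pow_bounds (s M y : R) : 0 < s -> 0 < M -> 0 <= trunc_pow s M y <= M `^ s.
Proof.
move=> s0 M0; rewrite /trunc_pow powR_ge0/= ge0_ler_powR ?nnegrE ?(ltW s0) ?(ltW M0)//.
  by rewrite le_min normr_ge0 ltW.
by rewrite ge_min lexx orbT.
Qed.

Lemma measurable_trunc_pow (s M : R) : measurable_fun setT (trunc_pow s M).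
Proof.
apply: (measurableT_comp (measurable_powR s)).
by apply: measurable_minr => //; exact: normr_measurable.
Qed.

Lemma trunc_pow_le (s s' M y : R) : 0 < s -> s <= s' -> 0 < M ->
  0 <= `|y| `^ s - trunc_pow s M y <= M `^ (s - s') * `|y| `^ s'.
Proof.
move=> s0 ss M0; rewrite /trunc_pow.
have [yM|My] := leP `|y| M.
  by rewrite subrr lexx mulr_ge0// powR_ge0.
apply/andP; split.
  by rewrite subr_ge0 ge0_ler_powR ?nnegrE ?(ltW s0) ?(ltW M0)// ltW.
have y0 : 0 < `|y| by exact: lt_trans My.
apply: (@le_trans _ _ (`|y| `^ s)); first by rewrite gerBl powR_ge0.
have -> : `|y| `^ s = `|y| `^ (s - s') * `|y| `^ s'.
  by rewrite -powRD ?subrK// gt_eqF// implybT.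
rewrite ler_wpM2r ?powR_ge0// -(opprB s' s) !powRN lef_pV2 ?posrE ?powR_gt0//.
by rewrite ge0_ler_powR ?nnegrE ?(ltW M0) ?(ltW y0) ?subr_ge0// ltW.
Qed.

(** Uniform integrability in quantitative form: for [s < s'] the error tends to 0 as [M] grows,
    uniformly over all [Y] whose moment of order [s'] is at most [k]. *)
Lemma trunc_moment_le (Y : T -> R) (s s' M k : R) : measurable_fun setT Y ->
  0 < s -> s <= s' -> 0 < M ->
  (\int[P]_w (`|Y w| `^ s)%:E < +oo)%E ->
  (\int[P]_w (`|Y w| `^ s')%:E <= k%:E)%E ->
  `|\int[P]_w `|Y w| `^ s - \int[P]_w trunc_pow s M (Y w)| <= M `^ (s - s') * k.
Proof.
move=> mY s0 ss M0 Ys Yk.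
have i1 : P.-integrable setT (EFin \o (fun w => `|Y w| `^ s)).
  apply/integrableP; split.
    by apply/measurable_EFinP; exact: (measurableT_comp (measurable_absX s)).
  by under eq_integral do rewrite /= ger0_norm ?powR_ge0//.
have [i2 _] := @fin_int_bounded _ _ _ P (fun w => trunc_pow s M (Y w)) (M `^ s)
  (measurableT_comp (measurable_trunc_pow s M) mY) (fun w => let: conj a b := andP (trunc_pow_bounds (Y w) s0 M0) in
   eq_ind_r (fun z => z <= M `^ s) b (ger0_norm a)).
have [i3 e3] := integrable_abs_moment mY Yk.
rewrite -RintegralB//.
have H w : `|(`|Y w| `^ s - trunc_pow s M (Y w))| <= M `^ (s - s') * `|Y w| `^ s'.
  by have /andP[h1 h2] := trunc_pow_le (Y w) s0 ss M0; rewrite ger0_norm.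
apply: (@le_trans _ _ (M `^ (s - s') * \int[P]_w `|Y w| `^ s')).
  apply: (Rintegral_dom _ _ H).
  - apply: measurable_funB; first exact: (measurableT_comp (measurable_absX s)).
    exact: (measurableT_comp (measurable_trunc_pow s M)).
  - by apply: measurable_funM => //; exact: (measurableT_comp (measurable_absX s')).
  - under eq_integral do rewrite EFinM.
    rewrite integralZl//; first by rewrite e3.
by rewrite ler_wpM2l ?powR_ge0// -lee_fin -e3.
Qed.
End truncation.

Section convergence_of_sums.
Context d (T : measurableType d) (R : realType) (P : probability T R).
Variables (p x : nat -> T -> R) (X : T -> R).
Hypothesis HW : iid_weighted P p x X.
Let mp := iw_mp HW.
Let mx := iw_mx HW.
Let p0 := iw_p0 HW.
Local Notation S := (weighted_partial_sum p x).

(** The series of [p j * |x j|] has expectation at most [k1], so the sums converge absolutely almost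
    surely. *)
Lemma ae_cvg_partial_sum (k1 : R) : (\int[P]_w `|X w|%:E = k1%:E)%E ->
  {ae P, forall w, S ^~ w @ \oo --> weighted_sum p x w}.
Proof.
move=> k1E.
have mabs : measurable_fun setT (fun y : R => `|y|) by exact: normr_measurable.
have k10 : 0 <= k1 by rewrite -lee_fin -k1E; apply: integral_ge0 => w _.
pose f w := (\sum_(0 <= j <oo) (p j w * `|x j w|)%:E)%E.
have f0 j w : (0 <= (p j w * `|x j w|)%:E)%E by rewrite lee_fin mulr_ge0.
have mf0 j : measurable_fun setT (fun w => (p j w * `|x j w|)%:E).
  by apply/measurable_EFinP; apply: measurable_funM => //; exact: (measurableT_comp mabs).
have fint : P.-integrable setT f.
  apply/integrableP; split; first by apply: ge0_emeasurable_sum.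
  under eq_integral do rewrite gee0_abs ?nneseries_ge0//.
  rewrite integral_nneseries//.
  apply: (@le_lt_trans _ _ k1%:E); last exact: ltry.
  apply: lime_le; first by apply: is_cvg_nneseries => j _ _; exact: integral_ge0.
  apply: nearW => n; rewrite big_mkord.
  under eq_bigr do rewrite (int_weight_fun HW _ mabs)// k1E -EFinM.
  rewrite sumEFin lee_fin -mulr_suml -[leRHS]mul1r ler_wpM2r//.
  exact: (mean_weight_sum HW).
apply: filterS (integrable_ae measurableT fint) => w /(_ I) fw.
have -> : S ^~ w = series (fun j => p j w * x j w).
  by apply/funext => n; rewrite /weighted_partial_sum /series/= big_mkord.
apply: normed_cvg.
rewrite (_ : [normed series _] = (fun n => \sum_(j < n) p j w * `|x j w|)); last first.
  rewrite (_ : [normed series _] = series (fun j => `|p j w * x j w|))//.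
  apply/funext => n; rewrite /series/= big_mkord; apply: eq_bigr => j _.
  by rewrite normrM (ger0_norm (p0 _ _)).
apply: nondecreasing_is_cvgn.
  by apply/nondecreasing_seqP => n; rewrite big_ord_recr/= lerDl mulr_ge0.
exists (fine (f w)) => _ [n _ <-].
rewrite -lee_fin fineK// -sumEFin -(big_mkord xpredT (fun j => (p j w * `|x j w|)%:E)).
by apply: nneseries_lim_ge => j _ _.
Qed.

Lemma cvg_expectation_partial_sum (k1 C : R) (f : R -> R) (Z : T -> R) :
  (\int[P]_w `|X w|%:E = k1%:E)%E -> continuous f -> (forall y, `|f y| <= C) ->
  {ae P, forall w, Z w = weighted_sum p x w} ->
  (fun n => \int[P]_w f (S n w)) @ \oo --> \int[P]_w f (Z w) /\
  (\int[P]_w (f (Z w))%:E = (\int[P]_w f (Z w))%:E)%E.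
Proof.
move=> k1E cf fC ZE.
apply: (@bounded_convergence _ _ _ P _ _ C).
- move=> n; apply: measurableT_comp; first exact: continuous_measurable_fun.
  exact: (measurable_partial_sum HW).
- by move=> n w.
- apply: filterS2 ZE (ae_cvg_partial_sum k1E) => w -> Sw.
  exact: (continuous_cvg _ (cf _) Sw).
Qed.

(** Each summand is split into [y (x j)] and a rest. The rest contributes at most [zeta] in mean;
    for the centered part, [|u| <= theta + u ^ 2 / theta] reduces the mean to the second moment. *)
Lemma small_partial_sum (y : R -> R) (v zeta theta : R) n :
  measurable_fun setT y -> P.-integrable setT (EFin \o (fun w => y (X w))) ->
  \int[P]_w y (X w) = 0 -> (\int[P]_w (y (X w) ^+ 2)%:E = v%:E)%E ->
  (\int[P]_w `|X w - y (X w)|%:E = zeta%:E)%E -> 0 < theta ->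
  \int[P]_w Num.min `|S n w| 1 <=
  zeta + theta + v / theta * \sum_(j < n) \int[P]_w (p j w `^ 2).
Proof.
move=> my yi y0 yv yz th0.
pose Sy w := \sum_(j < n) p j w * y (x j w).
pose Sz w := \sum_(j < n) p j w * `|x j w - y (x j w)|.
have [Syi Sye] := second_moment HW my yi y0 yv n.
have mz : measurable_fun setT (fun u : R => `|u - y u|).
  by apply: (measurableT_comp (@normr_measurable _ _)); exact: measurable_funB.
have mSz : measurable_fun setT Sz.
  by apply: measurable_sum => j; apply: measurable_funM => //; exact: (measurableT_comp mz).
have mSy : measurable_fun setT Sy.
  by apply: measurable_sum => j; apply: measurable_funM => //; exact: (measurableT_comp my).
have Szi : P.-integrable setT (EFin \o Sz) /\ \int[P]_w Sz w <= zeta.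
  have E : (\int[P]_w (Sz w)%:E = (\sum_(j < n) mean_weight P p j * zeta)%:E)%E.
    under eq_integral do rewrite -sumEFin.
    rewrite ge0_integral_sum//.
    - by rewrite -sumEFin; apply: eq_bigr => j _; rewrite (int_weight_fun HW _ mz)// yz -EFinM.
    - move=> j; apply/measurable_EFinP; apply: measurable_funM => //; exact: (measurableT_comp mz).
    - by move=> j w _; rewrite lee_fin mulr_ge0.
  split.
    apply: (integrable_dom mSz mSz _ E) => w; rewrite ger0_norm//.
    by apply: sumr_ge0 => j _; rewrite mulr_ge0.
  rewrite {1}/Rintegral E /= -mulr_suml -[leRHS]mul1r ler_wpM2r ?(mean_weight_sum HW)//.
  by rewrite -lee_fin -yz; apply: integral_ge0 => w _; rewrite lee_fin.
case: Szi => Szi Sze.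
have thi : P.-integrable setT (EFin \o (cst theta : T -> R)).
  by have [] := @fin_int_bounded _ _ _ P (cst theta) `|theta|; by [|move=> ? ?|].
pose h w := (Sz w + 1 * (cst theta w)) + theta^-1 * Sy w ^+ 2.
have hi1 := integrableDZ 1 Szi thi.
have hi : P.-integrable setT (EFin \o h) := integrableDZ theta^-1 hi1 Syi.
have le_h w : Num.min `|S n w| 1 <= h w.
  apply: (@le_trans _ _ `|S n w|); first by rewrite ge_min lexx.
  have -> : S n w = \sum_(j < n) p j w * (x j w - y (x j w)) + Sy w.
    by rewrite -big_split/=; apply: eq_bigr => j _; ring.
  apply: le_trans (ler_normD _ _) _; rewrite /h -addrA lerD//.
    apply: le_trans (ler_norm_sum _ _ _) _; apply: ler_sum => j _.
    by rewrite normrM (ger0_norm (p0 _ _)).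
  rewrite mul1r/= -subr_ge0 -real_normK ?num_real//.
  set u := `|Sy w|.
  have -> : theta + theta^-1 * u ^+ 2 - u = theta^-1 * ((u - theta / 2) ^+ 2 + 3 / 4 * theta ^+ 2).
    by field; rewrite gt_eqF.
  by rewrite mulr_ge0 ?invr_ge0 ?(ltW th0)// addr_ge0 ?sqr_ge0// mulr_ge0 ?sqr_ge0//; lra.
have mS : measurable_fun setT (fun w => Num.min `|S n w| 1).
  apply: measurable_minr => //; apply: (measurableT_comp (@normr_measurable _ _)).
  exact: (measurable_partial_sum HW).
have mb w : `|Num.min `|S n w| 1| <= 1.
  have h0 : 0 <= Num.min `|S n w| 1 by rewrite le_min normr_ge0 ler01.
  by rewrite (ger0_norm h0) ge_min lexx orbT.
have [mini _] := fin_int_bounded P mS mb.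
apply: le_trans (le_Rintegral measurableT mini hi (fun w _ => le_h w)) _.
have cE : \int[P]_w cst theta w = theta by rewrite /Rintegral/= integral_prob_cst.
rewrite (RintegralDZ theta^-1 hi1 Syi) (RintegralDZ 1 Szi thi) Sye cE mul1r.
by rewrite mulrA [theta^-1 * v]mulrC lerD2r lerD2r.
Qed.
End convergence_of_sums.

Definition complex_extension (R : realType) (Lam : (R -> R) -> R) (F : R -> R[i]) : R[i] :=
  Lam (fun y => complex.Re (F y)) +i* Lam (fun y => complex.Im (F y)).

Definition cweight_dom (R : realType) (F : R -> R[i]) (C : R) :=
  weight_dom (fun y => complex.Re (F y)) C /\ weight_dom (fun y => complex.Im (F y)) C.

(** * Complex powers and power moments *)

Section complex_limits.
Context {R : realType}.

Lemma norm_complexE (z : R[i]) : `|z| = (cnorm z)%:C.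
Proof. by rewrite normc_def cnormE. Qed.

Lemma cnorm_ge0 (z : R[i]) : 0 <= cnorm z.
Proof. by rewrite cnormE sqrtr_ge0. Qed.

Lemma Re_le_cnorm (z : R[i]) : `|complex.Re z| <= cnorm z.
Proof. by rewrite cnormE -sqrtr_sqr ler_wsqrtr// lerDl sqr_ge0. Qed.

Lemma Im_le_cnorm (z : R[i]) : `|complex.Im z| <= cnorm z.
Proof. by rewrite cnormE -sqrtr_sqr ler_wsqrtr// lerDr sqr_ge0. Qed.

Lemma cnorm_le (z : R[i]) : cnorm z <= `|complex.Re z| + `|complex.Im z|.
Proof.
rewrite cnormE -[leRHS]ger0_norm ?addr_ge0// -sqrtr_sqr ler_wsqrtr//.
by rewrite sqrrD !real_normK ?num_real// lerD2r lerDl mulrn_wge0// mulr_ge0.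
Qed.

Lemma cnormD (u v : R[i]) : cnorm (u + v) <= cnorm u + cnorm v.
Proof. by rewrite -lecR raddfD -!norm_complexE ler_normD. Qed.

Lemma cnormN (u : R[i]) : cnorm (- u) = cnorm u.
Proof. by apply: complexI; rewrite -!norm_complexE normrN. Qed.

Lemma cnormM (z w : R[i]) : cnorm (z * w) = cnorm z * cnorm w.
Proof. exact: Normc.normcM. Qed.

Lemma cnorm_real (k : R) : cnorm k%:C = `|k|.
Proof. by rewrite cnormE/= expr0n/= addr0 sqrtr_sqr. Qed.

Lemma cnormX (z : R[i]) n : cnorm (z ^+ n) = cnorm z ^+ n.
Proof.
elim: n => [|n IH]; first by rewrite !expr0 -[1]/(1%:C) cnorm_real normr1.
by rewrite !exprS cnormM IH.
Qed.

Lemma cvg_complexP (T : Type) (F : set_system T) (f : T -> R[i]) (l : R[i]) : Filter F ->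
  (forall e, 0 < e -> \forall t \near F, cnorm (f t - l) < e) <-> ((f : T -> R[i]^o) @ F --> (l : R[i]^o)).
Proof.
move=> FF; split => [H|/cvgrPdist_lt H e e0].
  apply/cvgrPdist_lt => e; rewrite ltcE/= => /andP[/eqP ei e0].
  near=> t; rewrite distrC norm_complexE ltcE/= ei eqxx/=.
  by near: t; exact: H.
have := H e%:C; rewrite ltcR => /(_ e0); apply: filterS => t.
by rewrite distrC norm_complexE ltcR.
Unshelve. all: by end_near. Qed.

Lemma cvg_complex (T : Type) (F : set_system T) (u v : T -> R) (a b : R) : Filter F ->
  u @ F --> a -> v @ F --> b ->
  ((fun t => u t +i* v t) : T -> R[i]^o) @ F --> (a +i* b : R[i]^o).
Proof.
move=> FF ua vb; apply/cvg_complexP => e e0.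
have e2 : 0 < e / 2 by rewrite divr_gt0.
move/cvgrPdist_lt/(_ _ e2) : ua => ua; move/cvgrPdist_lt/(_ _ e2) : vb => vb.
near=> t; apply: le_lt_trans (cnorm_le _) _; rewrite ReB ImB/= [ltRHS]splitr.
by rewrite ltrD// distrC; near: t.
Unshelve. all: by end_near. Qed.
End complex_limits.

Section complex_power.
Context {R : realType}.

(** The value 0 at 0 encodes the omission of zero weights, so that [power_sum] becomes an
    unrestricted sum. *)
Definition cpow0 (s : R[i]) (y : R) : R[i] := if 0 < y then cpow y s else 0.

Lemma cpowE (y : R) (s : R[i]) : cpow y s = cexp (s * (ln y)%:C).
Proof.
by rewrite /cpow /cexp [s * _]mulrC ReMr ImMr ![ln y * _]mulrC.
Qed.

Lemma cnorm_cexp (z : R[i]) : cnorm (cexp z) = expR (complex.Re z).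
Proof.
rewrite /cexp cnormM cnorm_real ger0_norm ?expR_ge0// [X in _ * X]cnormE/= cos2Dsin2.
by rewrite sqrtr1 mulr1.
Qed.

Lemma cnorm_cpow0 (s : R[i]) y : 0 <= y <= 1 -> 1 <= complex.Re s -> cnorm (cpow0 s y) <= y.
Proof.
move=> /andP[y0 y1] s1; rewrite /cpow0; case: ifPn => [yp|_]; last first.
  by rewrite -[0]/(0%:C) cnorm_real normr0.
rewrite cpowE cnorm_cexp [s * _]mulrC ReMr.
rewrite -[leRHS](lnK (_ : y \is Num.pos)) ?posrE// ler_expR.
have : ln y <= 0 by exact: ln_le0.
by move=> l0; rewrite -[leRHS]mulr1 ler_wnM2l.
Qed.

Lemma measurable_cpow0 (s : R[i]) : measurable_fun setT (fun y => complex.Re (cpow0 s y)) /\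
  measurable_fun setT (fun y => complex.Im (cpow0 s y)).
Proof.
have me : measurable_fun setT (fun y : R => expR (complex.Re s * ln y)).
  apply: (measurableT_comp (@measurable_expR R)); exact: measurable_funM.
have mb : measurable_fun setT (fun y : R => complex.Im s * ln y).
  by exact: measurable_funM.
have mif (f : R -> R) : measurable_fun setT f -> measurable_fun setT (fun y : R => if 0 < y then f y else 0).
  move=> mf; apply: measurable_fun_ifT => //.
  by apply: measurable_fun_ltr.
split.
- rewrite (_ : (fun y => _) = (fun y => if 0 < y then expR (complex.Re s * ln y) * cos (complex.Im s * ln y) else 0)).
    apply: mif; apply: measurable_funM => //; apply: measurableT_comp mb.
    by apply: continuous_measurable_fun; exact: continuous_cos.
  by apply/funext => y; rewrite /cpow0; case: ifP => // _; rewrite /cpow ReMr.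
- rewrite (_ : (fun y => _) = (fun y => if 0 < y then expR (complex.Re s * ln y) * sin (complex.Im s * ln y) else 0)).
    apply: mif; apply: measurable_funM => //; apply: measurableT_comp mb.
    by apply: continuous_measurable_fun; exact: continuous_sin.
  by apply/funext => y; rewrite /cpow0; case: ifP => // _; rewrite /cpow ImMr.
Qed.

Lemma weight_dom_cpow0 (s : R[i]) : 1 <= complex.Re s ->
  cweight_dom (cpow0 s) 1.
Proof.
move=> s1; have [m1 m2] := measurable_cpow0 s.
split; split => // y y01; rewrite mul1r; apply: le_trans (cnorm_cpow0 y01 s1).
- exact: Re_le_cnorm.
- exact: Im_le_cnorm.
Qed.

Lemma cpow0_real (s y : R) : s != 0 -> 0 <= y -> cpow0 s%:C y = (y `^ s)%:C.
Proof.
move=> s0; rewrite le_eqVlt => /predU1P[<-|y0]; first by rewrite /cpow0 ltxx powR0.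
rewrite /cpow0 y0 /cpow/= mul0r cos0 sin0 /powR gt_eqF//.
by rewrite -[1 +i* 0]/(1%:C) mulr1.
Qed.
End complex_power.

Section power_moment.
Context d (T : measurableType d) (R : realType) (P : probability T R).
Variables (p x : nat -> T -> R) (X : T -> R).
Hypothesis HW : iid_weighted P p x X.
Let p0 := iw_p0 HW.
Let p1 := iw_p1 HW.

(** Expectation and series commute by bounded convergence: the real and imaginary parts of the
    partial sums are at most the total mass of the weights in absolute value. *)
Lemma power_momentE (W : nat -> T -> R) (s : R[i]) :
  {ae P, forall w, forall n, p n w = W n w} -> 1 <= complex.Re s ->
  power_moment P W s = complex_extension (weight_functional P p) (cpow0 s).
Proof.
move=> pW s1; have [dRe dIm] := weight_dom_cpow0 s1.
have cvgf (f : R -> R) C w : weight_dom f C -> cvgn (fun n => \sum_(j < n) f (p j w)).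
  move=> df; have H n : `|f (p n w)| <= C * p n w.
    by case: df => _; apply; rewrite p0 (weight_le1 HW).
  refine (cvg_dominated_series (fun n => p0 n w) (fun n => p1 n w) H).
have psE : {ae P, forall w, power_sum (W ^~ w) s =
    limn (fun n => \sum_(j < n) complex.Re (cpow0 s (p j w))) +i*
    limn (fun n => \sum_(j < n) complex.Im (cpow0 s (p j w)))}.
  apply: filterS pW => w pw.
  apply: (@cvg_lim R[i]^o); first exact: norm_hausdorff.
  rewrite [X in X @ _ --> _](_ : _ = (fun n => (\sum_(j < n) complex.Re (cpow0 s (p j w))) +i*
     (\sum_(j < n) complex.Im (cpow0 s (p j w))))).
    by apply: cvg_complex; [exact: cvgf dRe|exact: cvgf dIm].
  apply/funext => n; rewrite big_mkord big_mkcond/=.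
  rewrite (eq_bigr (fun j : 'I_n => cpow0 s (p j w))); last first.
    by move=> j _; rewrite pw.
  elim: n => [|n IH]; first by rewrite !big_ord0.
  rewrite !big_ord_recr/= IH; apply/eqP; rewrite eq_complex/= !raddfD/= eqxx/=.
  by [].
have int (f : R -> R) C (G : T -> R) : weight_dom f C ->
    {ae P, forall w, G w = limn (fun n => \sum_(j < n) f (p j w))} ->
    \int[P]_w G w = weight_functional P p f.
  move=> df GE; apply/esym; apply: cvg_lim => //.
  have [] := @bounded_convergence _ _ _ P (fun n w => \sum_(j < n) f (p j w)) G C.
  - move=> n; apply: measurable_sum => j; apply: measurableT_comp (iw_mp HW j).
    by case: df.
  - move=> n w; have C0 := weight_dom_ge0 df; apply: le_trans (ler_norm_sum _ _ _) _.
    apply: (@le_trans _ _ (\sum_(j < n) C * p j w)).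
      by apply: ler_sum => j _; case: df => _; apply; rewrite p0 (weight_le1 HW).
    by rewrite -mulr_sumr ler_piMr.
  - apply: filterS GE => w ->; exact: cvgf df.
  move=> + _; rewrite [X in X @ _ --> _ -> _](_ : _ = (fun n => \sum_(j < n) \int[P]_w f (p j w)))//.
  apply/funext => n; elim: n => [|n IH].
    rewrite big_ord0 /Rintegral; under eq_integral do rewrite big_ord0.
    by rewrite integral0.
  rewrite big_ord_recr/= -IH -RintegralD//; last 2 first.
  - have := @integrable_sum _ _ _ P setT measurableT _ (index_enum 'I_n) xpredT (fun j => EFin \o (fun w => f (p j w))) (fun j _ => integrable_weight HW j df).
    by apply: eq_integrable => // w _; rewrite /= -sumEFin.
  - refine (integrable_weight HW n df).
  by apply: eq_Rintegral => w _; rewrite big_ord_recr.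
rewrite /power_moment /cexpectation /complex_extension; congr (_ +i* _).
- by apply: int dRe _; apply: filterS psE => w ->.
- by apply: int dIm _; apply: filterS psE => w ->.
Qed.
End power_moment.

(** * Ultrafilter limits and analytic continuation *)

Section ultralimits.
Context {R : realType} (I : Type).

Lemma ultra_cvg (U : set_system I) (f : I -> R) (C : R) : UltraFilter U ->
  (forall t, `|f t| <= C) -> f @ U --> lim (f @ U).
Proof.
move=> UU fC.
have UF : ProperFilter (f @ U) by apply: fmap_proper_filter; exact: ultra_proper.
have [|l [_ fl]] := @segment_compact R (- C) C (f @ U) UF.
  by rewrite /nbhs/=; apply: filterE => t; rewrite /= in_itv/= -ler_norml.
apply: (cvgP l) => B lB.
have [//|UnB] := in_ultra_setVsetC (f @^-1` B) UU.
by have [z []] := fl (~` B) B UnB lB.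
Qed.

Lemma ultra_lim_le (U : set_system I) (f : I -> R) (C : R) : UltraFilter U ->
  (forall t, `|f t| <= C) -> `|lim (f @ U)| <= C.
Proof.
move=> UU fC; have fl := ultra_cvg UU fC.
rewrite -(cvg_lim _ (cvg_norm fl))//.
by apply: limr_le; [exact: (cvgP _ (cvg_norm fl))|exact: nearW].
Qed.

(** If some neighbourhood of [l] were not reached along [F], then [F] and the set of indices outside
    would lie in a common ultrafilter, along which [f] could not tend to [l]. *)
Lemma cvg_of_ultra (F : set_system I) (f : I -> R) (C l : R) : ProperFilter F ->
  (forall t, `|f t| <= C) ->
  (forall U : set_system I, UltraFilter U -> F `<=` U -> lim (f @ U) = l) ->
  f @ F --> l.
Proof.
move=> FF fC H; apply/cvgrPdist_lt => e e0.
apply: contrapT => nF.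
pose A := [set t | `|l - f t| < e].
pose G : set_system I := [set B | exists2 D, F D & D `&` ~` A `<=` B].
have GF : ProperFilter G.
  split; last split.
  - move=> [D FD D0]; apply: nF; apply: filterS FD => t Dt.
    by apply: contrapT => nA; exact: (D0 t).
  - by exists setT => //; exact: filterT.
  - move=> B B' [D FD DB] [D' FD' DB']; exists (D `&` D'); first exact: filterI.
    by move=> t [[Dt D't] At]; split; [exact: DB|exact: DB'].
  - by move=> B B' BB' [D FD DB]; exists D => //; exact: subset_trans BB'.
have [U [UU GU]] := ultraFilterLemma GF.
have FU : F `<=` U.
  by move=> D FD; apply: GU; exists D => //; exact: subIsetl.
have := ultra_cvg UU fC; rewrite H// => /cvgrPdist_lt/(_ e e0) UA.
have UnA : U (~` A) by apply: GU; exists setT; [exact: filterT|rewrite setTI].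
have UF : ProperFilter U by apply: ultra_proper.
have [t [At nAt]] := filter_ex (filterI (UA : U A) UnA).
exact: nAt.
Qed.

(** The limit of the approximation may depend on [e]; completeness of [R] then provides a limit of
    [f]. *)
Lemma cvg_of_approx (F : set_system I) (f : I -> R) : ProperFilter F ->
  (forall e : R, 0 < e -> exists (g : I -> R) (l : R), (\forall t \near F, `|f t - g t| <= e) /\ g @ F --> l) ->
  cvg (f @ F).
Proof.
move=> FF H; apply: cauchy_cvg; apply: cauchy_exP => e e0.
have e2 : 0 < e / 2 by rewrite divr_gt0.
have [g [l [fg /cvgrPdist_lt/(_ _ e2) gl]]] := H _ e2.
exists l; suff Hb : \forall t \near F, ball (l : R) e (f t) by exact: Hb.
near=> t.
have h1 : `|l - g t| < e / 2 by near: t.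
have h2 : `|f t - g t| <= e / 2 by near: t.
rewrite /ball/=; have -> : (l : R) - f t = (l - g t) - (f t - g t) by ring.
by apply: le_lt_trans (ler_normB _ _) _; rewrite [ltRHS]splitr ltr_leD.
Unshelve. all: by end_near. Qed.
End ultralimits.

Section functional_expansion.
Context {R : realType}.
Variables (Cls : (R -> R) -> R -> Prop) (Phi : (R -> R) -> R) (B : R).
Hypotheses (ClsD : forall f g C C' k, Cls f C -> Cls g C' -> Cls (fun y => f y + k * g y) (C + `|k| * C'))
  (Phi_bound : forall f C, Cls f C -> `|Phi f| <= B * C)
  (PhiD : forall f g C C' k, Cls f C -> Cls g C' ->
     Phi (fun y => f y + k * g y) = Phi f + k * Phi g).
Variables (rem : nat -> R -> R -> R) (g : nat -> R -> R) (delta C0 : R).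
Hypotheses (delta0 : 0 < delta)
  (remS : forall N z y, rem N z y = rem N.+1 z y + z ^+ N / N`!%:R * g N y)
  (rem_cls : forall N z, `|z| <= delta -> Cls (rem N z) (C0 * (`|z| / delta) ^+ N)).

Lemma cls_coefficient n : exists C, Cls (g n) C.
Proof.
have dd : `|delta| <= delta by rewrite gtr0_norm.
have k0 : delta ^+ n / n`!%:R != 0.
  by rewrite mulf_neq0 ?invr_eq0 ?pnatr_eq0 -?lt0n ?fact_gt0// expf_neq0// gt_eqF.
(* The difference of two consecutive remainders at [delta] is a multiple of [g n]. The class is only
   known to be closed under [f + k * g], so rescaling is done as [f + k * f], with [1 + k] the
   inverse of that multiple. *)
pose k := (delta ^+ n / n`!%:R)^-1 - 1.
have h1 := ClsD (-1) (rem_cls n dd) (rem_cls n.+1 dd).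
have h2 := ClsD k h1 h1.
eexists; rewrite [g n](_ : _ = fun y => (rem n delta y + -1 * rem n.+1 delta y) +
    k * (rem n delta y + -1 * rem n.+1 delta y)); first exact: h2.
apply/funext => y; rewrite remS /k; move: (g n y) (rem n.+1 delta y) k0 => u v.
set c := delta ^+ n / _ => c0; have -> : v + c * u + -1 * v = c * u by ring.
by field.
Qed.

(** [Cls f C] acts as a bound of [f] in a seminorm. The lemma serves twice: for [weight_dom] with
    the functional of the weights, and for [growth_lip] with the functional of the sums. *)
Lemma functional_expansion :
  expansion delta delta^-1 (B * C0) (fun z => Phi (rem 0 z)) (fun n => Phi (g n) / n`!%:R).
Proof.
move=> N z zr; have zd : `|z| <= delta.
  by rewrite ler_norml; apply/andP; split; case/andP: zr => h1 h2; apply: ltW => //; exact: lt_trans h2 _.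
have -> : Phi (rem 0 z) - \sum_(i < N) Phi (g i) / i`!%:R * z ^+ i = Phi (rem N z).
  elim: N => [|N IH]; first by rewrite big_ord0 subr0.
  rewrite big_ord_recr/= opprD addrA IH.
  have [C gC] := cls_coefficient N.
  rewrite [rem N z](_ : _ = fun y => rem N.+1 z y + z ^+ N / N`!%:R * g N y); last first.
    by apply/funext => y; exact: remS.
  by rewrite (PhiD _ (rem_cls N.+1 zd) gC); ring.
by rewrite -mulrA [_^-1 * _]mulrC; apply: Phi_bound; exact: rem_cls.
Qed.
End functional_expansion.

(** * Taylor remainders of powers in the exponent *)

Section power_remainders.
Context {R : realType}.
Implicit Types (b z delta q y : R) (N n : nat).

(** For [y > 0], the [n]-th derivative of the power of [y] with respect to its exponent, at [b];
    [pow_rem] is the corresponding Taylor remainder of order [N]. *)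
Definition powlog b n y : R := y `^ b * ln y ^+ n.

Definition pow_rem b N z y : R := y `^ b * exp_rem N (z * ln y).

Lemma pow_remS b N z y : pow_rem b N z y = pow_rem b N.+1 z y + z ^+ N / N`!%:R * powlog b N y.
Proof. by rewrite /pow_rem /powlog exp_remS exprMn; ring. Qed.

Lemma pow_rem0 b z y : b != 0 -> b + z != 0 -> 0 <= y -> pow_rem b 0 z y = y `^ (b + z).
Proof.
move=> b0 bz0; rewrite le_eqVlt => /predU1P[<-|y0]; first by rewrite /pow_rem !powR0 ?mul0r.
by rewrite /pow_rem exp_rem0 /powR gt_eqF// -expRD mulrDl.
Qed.

Lemma measurable_exp_rem N : measurable_fun setT (@exp_rem R N).
Proof.
apply: measurable_funB; first exact: measurable_expR.
by apply: measurable_sum => j; apply: measurable_funM => //; apply: measurable_funM => //; exact: measurable_funX.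
Qed.

Lemma measurable_pow_rem b N z : measurable_fun setT (pow_rem b N z).
Proof.
apply: measurable_funM; first exact: measurable_powR.
by apply: (measurableT_comp (measurable_exp_rem N)); apply: measurable_funM => //; exact: measurable_ln.
Qed.

Lemma measurable_powlog b n : measurable_fun setT (powlog b n).
Proof.
apply: measurable_funM; first exact: measurable_powR.
by apply: measurable_funX; exact: measurable_ln.
Qed.

Lemma powR_expR_ln b delta y : 0 < y <= 1 -> y `^ b * expR (delta * `|ln y|) = y `^ (b - delta).
Proof.
move=> /andP[y0 y1]; rewrite /powR gt_eqF// -expRD ler0_norm; last exact: ln_le0.
by congr expR; ring.
Qed.

Lemma powR_expR_ln_ge1 b delta y : 1 <= y -> y `^ b * expR (delta * `|ln y|) = y `^ (b + delta).
Proof.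
move=> y1; have y0 : 0 < y by exact: lt_le_trans ltr01 y1.
by rewrite /powR gt_eqF// -expRD ger0_norm; [congr expR; ring|exact: ln_ge0].
Qed.

Lemma powR_le_id (s y : R) : 1 <= s -> 0 <= y <= 1 -> y `^ s <= y.
Proof.
move=> s1 /andP[]; rewrite le_eqVlt => /predU1P[<- _|y0 y1].
  by rewrite powR0// gt_eqF//; lra.
by rewrite ge1r_powR// y0 y1.
Qed.

Lemma normr_pow_rem b N z delta y : 0 < delta -> `|z| <= delta ->
  `|pow_rem b N z y| <= (`|z| / delta) ^+ N * (y `^ b * expR (delta * `|ln y|)).
Proof.
move=> d0 zd; rewrite normrM (ger0_norm (powR_ge0 _ _)) mulrCA ler_wpM2l ?powR_ge0//.
exact: normr_exp_rem.
Qed.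

(** For [y <= 1] the exponential factor lowers the exponent by [delta], and an exponent of at least
    1 must remain. Hence [b - 1] is the radius of the discs used later. *)
Lemma weight_dom_pow_rem b N z delta : 0 < delta -> delta <= b - 1 -> `|z| <= delta ->
  weight_dom (pow_rem b N z) ((`|z| / delta) ^+ N).
Proof.
move=> d0 db zd; split; first exact: measurable_pow_rem.
have t0 : 0 <= (`|z| / delta) ^+ N by rewrite exprn_ge0// divr_ge0// ltW.
move=> y /andP[]; rewrite le_eqVlt => /predU1P[<- _|y0 y1].
  by rewrite /pow_rem powR0 ?mul0r ?normr0 ?mulr0// gt_eqF//; lra.
apply: le_trans (normr_pow_rem b N y d0 zd) _; rewrite ler_wpM2l//.
rewrite powR_expR_ln ?y0// powR_le_id ?(ltW y0)//; lra.
Qed.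

Lemma pow_weight_le b delta q c : 0 < c -> 0 < delta -> 1 <= b - delta -> b + delta - 1 <= q -> 1 <= q ->
  c `^ b * expR (delta * `|ln c|) <= c * (1 + c `^ q).
Proof.
move=> c0 d0 bd bq q1; have [c1|c1] := leP c 1.
  rewrite powR_expR_ln ?c0//; apply: le_trans (powR_le_id bd _) _; first by rewrite (ltW c0).
  by rewrite ler_pMr// lerDl powR_ge0.
rewrite powR_expR_ln_ge1 ?(ltW c1)//.
apply: (@le_trans _ _ (c `^ (q + 1))); first by apply: ler_powR; [exact: ltW|lra].
rewrite powRD; last by rewrite (gt_eqF c0) implybT.
rewrite powRr1 ?(ltW c0)// mulrC ler_wpM2l ?(ltW c0)//.
by rewrite lerDr.
Qed.

(** In the variable [u = ln y] the derivative is a remainder of order [N] times [b], plus [z] times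
    one of order [N - 1]. As [|z| = delta * (|z| / delta)], both carry the same geometric factor,
    with the total coefficient [b + delta]; the mean value theorem concludes. *)
Lemma growth_lip_pow_rem b N z delta q : 0 < delta -> 1 <= b - delta -> b + delta - 1 <= q -> 1 <= q ->
  `|z| <= delta -> growth_lip q (fun x => pow_rem b N z `|x|) ((b + delta) * (`|z| / delta) ^+ N).
Proof.
move=> d0 bd bq q1 zd; set th := (`|z| / delta) ^+ N.
have th0 : 0 <= th by rewrite exprn_ge0// divr_ge0// ltW.
have C0 : 0 <= (b + delta) * th by rewrite mulr_ge0//; lra.
have q0 : 0 < q by lra.
pose h u := expR (b * u) * exp_rem N (z * u).
(* At [N = 0] the truncated predecessor is the right index, because [exp_rem 0] is the exponential,
   its own derivative up to the factor [z]. *)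
pose h' u := expR (b * u) * (z * exp_rem N.-1 (z * u)) + exp_rem N (z * u) * (b * expR (b * u)).
have dh (u : R) : is_derive u 1 h (h' u).
  case: N @h @h' @th th0 C0 => [|M] h h' th th0 C0.
    rewrite /h /h'; have -> : (fun u => expR (b * u) * exp_rem 0 (z * u)) = (fun u => expR (b * u)) * (fun u => expR (z * u)).
      by apply/funext => v; rewrite exp_rem0.
    rewrite /= !exp_rem0.
    have := is_deriveM (is_derive_expRM b u) (is_derive_expRM z u).
    by rewrite /GRing.scale/=.
  have := is_deriveM (is_derive_expRM b u) (is_derive_exp_rem z M u).
  by rewrite /GRing.scale/=.
have h'_le u : `|h' u| <= (b + delta) * th * (expR (b * u) * expR (delta * `|u|)).
  have r1 : `|exp_rem N (z * u)| <= th * expR (delta * `|u|) by exact: normr_exp_rem.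
  have r2 : `|z * exp_rem N.-1 (z * u)| <= delta * th * expR (delta * `|u|).
    rewrite normrM /th; case: (N) => [|M] /=.
      rewrite expr0 mulr1 ler_pM//.
      by have := normr_exp_rem 0 u d0 zd; rewrite expr0 mul1r.
    have -> : delta * (`|z| / delta) ^+ M.+1 * expR (delta * `|u|) = `|z| * ((`|z| / delta) ^+ M * expR (delta * `|u|)).
      by rewrite exprS; field; rewrite gt_eqF.
    by rewrite ler_wpM2l// normr_exp_rem.
  apply: le_trans (ler_normD _ _) _; rewrite !normrM (ger0_norm (expR_ge0 _)).
  rewrite -normrM (ger0_norm (_ : 0 <= b)); last lra.
  have e0 := expR_ge0 (b * u).
  apply: le_trans (lerD (ler_wpM2l e0 r2) (ler_wpM2r (mulr_ge0 (_ : 0 <= b) e0) r1)) _; first lra.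
  by rewrite le_eqVlt; apply/orP; left; apply/eqP; ring.
have gE y : 0 < y -> pow_rem b N z y = h (ln y).
  by move=> y0; rewrite /pow_rem /h /powR gt_eqF.
have dg (y : R) : 0 < y -> is_derive y 1 (h \o @ln R) (h' (ln y) * y^-1).
  by move=> y0; apply: is_derive1_comp; exact: is_derive1_ln.
have g_le y : 0 < y -> `|pow_rem b N z y| <= th * (y * (1 + y `^ q)).
  move=> y0; apply: le_trans (normr_pow_rem b N y d0 zd) _; rewrite ler_wpM2l//.
  exact: pow_weight_le.
have g'_le y : 0 < y -> `|h' (ln y) * y^-1| <= (b + delta) * th * (1 + y `^ q).
  move=> y0; rewrite normrM normfV (gtr0_norm y0) ler_pdivrMr//.
  apply: le_trans (h'_le _) _.
  rewrite [leRHS](_ : _ = (b + delta) * th * (y * (1 + y `^ q))); last by ring.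
  rewrite ler_wpM2l//.
  by have := pow_weight_le y0 d0 bd bq q1; rewrite {1}/powR gt_eqF.
have key x y : 0 <= x <= y -> `|pow_rem b N z y - pow_rem b N z x| <= (b + delta) * th * ((y - x) * (1 + y `^ q)).
  move=> /andP[]; rewrite le_eqVlt => /predU1P[<- y0|x0].
    rewrite [pow_rem b N z 0]/pow_rem powR0 ?mul0r ?subr0; last by rewrite gt_eqF//; lra.
    move: y0; rewrite le_eqVlt => /predU1P[<-|y0].
      by rewrite /pow_rem powR0 ?mul0r ?normr0 ?mulr0// gt_eqF//; lra.
    apply: le_trans (g_le _ y0) _; rewrite ler_wpM2r//.
      by rewrite mulr_ge0 ?(ltW y0)// addr_ge0// powR_ge0.
    by rewrite ler_peMl//; lra.
  rewrite le_eqVlt => /predU1P[<-|xy]; first by rewrite !subrr normr0 mul0r mulr0.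
  have y0 : 0 < y by exact: lt_trans xy.
  rewrite !gE//.
  have dgi (v : R) : v \in `]x, y[ -> is_derive v 1 (h \o @ln R) (h' (ln v) * v^-1).
    by rewrite in_itv/= => /andP[xv _]; apply: dg; exact: lt_trans xv.
  have [|c /[!in_itv]/= /andP[xc cy] ->] := MVT xy dgi.
    apply: continuous_in_subspaceT => v; rewrite inE/= in_itv/= => /andP[xv _].
    apply/differentiable_continuous/derivable1_diffP.
    by have [] := dg v (lt_le_trans x0 xv).
  have c0 : 0 < c by exact: lt_trans xc.
  have yx : 0 < y - x by rewrite subr_gt0.
  rewrite normrM (gtr0_norm yx) [leRHS](_ : _ = (b + delta) * th * (1 + y `^ q) * (y - x)); last by ring.
  rewrite ler_wpM2r ?(ltW yx)//.
  apply: le_trans (g'_le _ c0) _; rewrite ler_wpM2l// lerD2l.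
  by rewrite ge0_ler_powR ?nnegrE ?(ltW q0) ?(ltW c0) ?(ltW y0)// ltW.
split.
- by apply: (measurableT_comp (measurable_pow_rem b N z)); exact: normr_measurable.
- by rewrite normr0 /pow_rem powR0 ?mul0r// gt_eqF//; lra.
move=> x y; wlog xy : x y / `|x| <= `|y|.
  move=> H; have [xy|/ltW xy] := leP `|x| `|y|; first exact: H.
  by rewrite distrC (distrC x) addrAC; exact: H.
rewrite distrC; apply: le_trans (key _ _ _) _; first by rewrite normr_ge0.
rewrite ler_wpM2l//; apply: ler_pM.
- by rewrite subr_ge0.
- by rewrite addr_ge0// powR_ge0.
- by rewrite distrC; apply: le_trans (lerB_dist _ _).
- by rewrite lerD2r lerDl powR_ge0.
Qed.
End power_remainders.

Section complex_expansion.
Context {R : realType}.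
Implicit Types (b delta eta y : R) (N n : nat) (zeta : R[i]).

(** The power of the logarithm is carried along so that an expansion at [b] gives every Taylor
    coefficient at a nearby center, not only the value there. *)
Definition cpow_rem b n N zeta y : R[i] := (powlog b n y)%:C * cexp_rem N (zeta * (ln y)%:C).

Lemma cpow_remS b n N zeta y : cpow_rem b n N zeta y =
  cpow_rem b n N.+1 zeta y + zeta ^+ N / N`!%:R * (powlog b (n + N) y)%:C.
Proof.
rewrite /cpow_rem cexp_remS /powlog exprD exprMn !rmorphM/= !rmorphXn/=.
by set u := (y `^ b)%:C; set v := (ln y)%:C; field; rewrite pnatr_eq0 -lt0n fact_gt0.
Qed.

Lemma measurable_cpow_rem b n N zeta :
  measurable_fun setT (fun y => complex.Re (cpow_rem b n N zeta y)) /\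
  measurable_fun setT (fun y => complex.Im (cpow_rem b n N zeta y)).
Proof.
have ml (k : R) : measurable_fun setT (fun y : R => k * ln y).
  by apply: measurable_funM => //; exact: measurable_ln.
have me c : measurable_fun setT (fun y : R => egf c N (ln y)).
  apply: measurable_sum => j; apply: measurable_funM => //; apply: measurable_funM => //.
  by apply: measurable_funX; exact: measurable_ln.
split.
- rewrite (_ : (fun y => _) = (fun y => powlog b n y * (expR (complex.Re zeta * ln y) * cos (complex.Im zeta * ln y) -
    egf (fun j => complex.Re (zeta ^+ j)) N (ln y)))); last first.
    by apply/funext => y; rewrite /cpow_rem ReMr [zeta * _]mulrC Re_cexp_rem.
  apply: measurable_funM; first exact: measurable_powlog.
  apply: measurable_funB => //; apply: measurable_funM.
    by apply: (measurableT_comp (@measurable_expR R)).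
  apply: (measurableT_comp (f := @cos R)) => //.
  by apply: continuous_measurable_fun; exact: continuous_cos.
- rewrite (_ : (fun y => _) = (fun y => powlog b n y * (expR (complex.Re zeta * ln y) * sin (complex.Im zeta * ln y) -
    egf (fun j => complex.Im (zeta ^+ j)) N (ln y)))); last first.
    by apply/funext => y; rewrite /cpow_rem ImMr [zeta * _]mulrC Im_cexp_rem.
  apply: measurable_funM; first exact: measurable_powlog.
  apply: measurable_funB => //; apply: measurable_funM.
    by apply: (measurableT_comp (@measurable_expR R)).
  apply: (measurableT_comp (f := @sin R)) => //.
  by apply: continuous_measurable_fun; exact: continuous_sin.
Qed.

Lemma normr_ln_exp n eta y : 0 < eta -> `|ln y| ^+ n <= n`!%:R / eta ^+ n * expR (eta * `|ln y|).
Proof.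
move=> e0; have h0 : 0 <= eta * `|ln y| by rewrite mulr_ge0 ?(ltW e0).
have := exp_rem_ge0 n.+1 h0; rewrite exp_remS subr_ge0 => H.
have := le_trans H (exp_rem_le n h0); rewrite exprMn ler_pdivrMr ?ltr0n ?fact_gt0// => H'.
by rewrite mulrAC ler_pdivlMr ?exprn_gt0// mulrC [leRHS]mulrC.
Qed.

(** The distance [b - 1] to the exponent 1 is shared: [delta] pays for the remainder of the
    exponential, [eta] for the powers of the logarithm. *)
Lemma cnorm_cpow_rem b n N zeta delta eta y : 0 < delta -> 0 < eta -> delta + eta <= b - 1 ->
  cnorm zeta <= delta -> 0 <= y <= 1 ->
  cnorm (cpow_rem b n N zeta y) <= n`!%:R / eta ^+ n * (cnorm zeta / delta) ^+ N * y.
Proof.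
move=> d0 e0 db zd /andP[]; rewrite le_eqVlt => /predU1P[<- _|y0 y1].
  rewrite /cpow_rem /powlog powR0; last by rewrite gt_eqF//; lra.
  by rewrite mul0r mul0r -[0]/(0%:C) cnorm_real normr0 mulr0.
rewrite /cpow_rem cnormM cnorm_real normrM (ger0_norm (powR_ge0 _ _)) normrX.
have h1 := normr_ln_exp n y e0.
have h2 := cnorm_cexp_rem N (ln y) d0 zd.
have t0 : 0 <= (cnorm zeta / delta) ^+ N by rewrite exprn_ge0// divr_ge0 ?cnorm_ge0 ?(ltW d0).
have f0 : 0 <= n`!%:R / eta ^+ n by rewrite divr_ge0 ?exprn_ge0// ltW.
rewrite -(mulrA (y `^ b)); apply: (@le_trans _ _ (y `^ b * ((n`!%:R / eta ^+ n * expR (eta * `|ln y|)) *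
   ((cnorm zeta / delta) ^+ N * expR (delta * `|ln y|))))).
  by rewrite ler_wpM2l ?powR_ge0// ler_pM ?exprn_ge0 ?cnorm_ge0.
have -> : y `^ b * ((n`!%:R / eta ^+ n * expR (eta * `|ln y|)) * ((cnorm zeta / delta) ^+ N * expR (delta * `|ln y|))) =
  n`!%:R / eta ^+ n * (cnorm zeta / delta) ^+ N * (y `^ b * expR ((delta + eta) * `|ln y|)).
  by rewrite mulrDl expRD; ring.
have y01 : 0 < y <= 1 by rewrite y0.
rewrite (powR_expR_ln _ _ y01); apply: ler_wpM2l; first exact: mulr_ge0.
by apply: powR_le_id; [lra|rewrite (ltW y0)].
Qed.

Lemma weight_dom_cpow_rem b n N zeta delta eta : 0 < delta -> 0 < eta -> delta + eta <= b - 1 ->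
  cnorm zeta <= delta ->
  weight_dom (fun y => complex.Re (cpow_rem b n N zeta y)) (n`!%:R / eta ^+ n * (cnorm zeta / delta) ^+ N) /\
  weight_dom (fun y => complex.Im (cpow_rem b n N zeta y)) (n`!%:R / eta ^+ n * (cnorm zeta / delta) ^+ N).
Proof.
move=> d0 e0 db zd; have [m1 m2] := measurable_cpow_rem b n N zeta.
split; split => // y y01.
- by apply: le_trans (Re_le_cnorm _) _; exact: (cnorm_cpow_rem n N d0 e0 db zd y01).
- by apply: le_trans (Im_le_cnorm _) _; exact: (cnorm_cpow_rem n N d0 e0 db zd y01).
Qed.

Lemma cpow_rem_cpow0 b zeta y : b != 0 -> 0 <= y -> cpow_rem b 0 0 zeta y = cpow0 (b%:C + zeta) y.
Proof.
move=> b0; rewrite le_eqVlt => /predU1P[<-|y0].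
  by rewrite /cpow0 ltxx /cpow_rem /powlog powR0// mul0r mul0r.
rewrite /cpow_rem /powlog expr0 mulr1 cexp_rem0 /cpow0 y0 cpowE.
rewrite /cexp ![_ * (ln y)%:C]mulrC !ReMr !ImMr /= !raddfD/= add0r mulrDr expRD rmorphM/= mulrA.
by congr (_ * _ * _); rewrite /powR gt_eqF// mulrC.
Qed.

Lemma Re_cpow_rem_real b n (z : R) y : 0 <= y -> b != 0 -> b + z != 0 ->
  complex.Re (cpow_rem b n 0 z%:C y) = powlog (b + z) n y.
Proof.
move=> y0 b0 bz0; rewrite /cpow_rem ReMr cexp_rem0 /cexp ReMr -rmorphM/= cos0 mulr1.
rewrite /powlog mulrAC; congr (_ * _).
move: y0; rewrite le_eqVlt => /predU1P[<-|y0]; first by rewrite !powR0 ?mul0r.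
by rewrite /powR gt_eqF// -expRD mulrDl.
Qed.

Lemma weight_dom_powlog b n : 1 < b -> exists C, weight_dom (powlog b n) C.
Proof.
move=> b1; pose d : R := (b - 1) / 2.
have d0 : 0 < d by rewrite divr_gt0// subr_gt0.
exists (n`!%:R / d ^+ n * (cnorm 0 / d) ^+ 0); split; first exact: measurable_powlog.
have [||] := @weight_dom_cpow_rem b n 0 0 d d d0 d0; first by rewrite /d; lra.
  by rewrite -[0]/(0%:C) cnorm_real normr0 ltW.
move=> [_ H] _ y y01; have := H y y01.
have y0 : 0 <= y by case/andP: y01.
have b0 : b != 0 by rewrite gt_eqF//; lra.
by have -> : complex.Re (cpow_rem b n 0 0 y) = powlog b n y by have := @Re_cpow_rem_real b n 0 y y0 b0; rewrite addr0; apply.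
Qed.
End complex_expansion.

(** * Analytic continuation for bounded functionals *)

Section bounded_functional.
Context {R : realType}.
Variables (Lam : (R -> R) -> R) (B : R).
Hypotheses (Lam_bound : forall f C, weight_dom f C -> `|Lam f| <= B * C)
  (LamD : forall f g C C' k, weight_dom f C -> weight_dom g C' ->
     Lam (fun y => f y + k * g y) = Lam f + k * Lam g).

Lemma weight_domD (f g : R -> R) C C' k : weight_dom f C -> weight_dom g C' ->
  weight_dom (fun y => f y + k * g y) (C + `|k| * C').
Proof.
move=> [m1 H1] [m2 H2]; split.
  by apply: measurable_funD => //; exact: measurable_funM.
move=> y y01; apply: le_trans (ler_normD _ _) _; rewrite mulrDl lerD ?H1//.
by rewrite normrM -mulrA ler_wpM2l// H2.
Qed.

(** The difference is dominated with constant 0, so the bound annihilates it; values outside the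
    unit interval do not matter. *)
Lemma functional_ext (f g : R -> R) C C' : weight_dom f C -> weight_dom g C' ->
  (forall y, 0 <= y <= 1 -> f y = g y) -> Lam f = Lam g.
Proof.
move=> df dg fg; apply/eqP; rewrite -subr_eq0 -normr_le0.
have -> : Lam f - Lam g = Lam (fun y => f y + -1 * g y).
  by rewrite (LamD _ df dg) mulN1r.
rewrite -[leRHS](mulr0 B); apply: Lam_bound; split.
  by case: (weight_domD (-1) df dg).
by move=> y y01; rewrite fg// mulN1r subrr normr0 mul0r.
Qed.

Local Notation LC := (complex_extension Lam).

Lemma complex_extension_bound F C : cweight_dom F C -> cnorm (LC F) <= 2 * (B * C).
Proof.
move=> [d1 d2]; apply: le_trans (cnorm_le _) _ => /=.
by rewrite mulr_natl mulr2n lerD// Lam_bound.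
Qed.

Lemma cweight_domD F G C C' (k : R[i]) : cweight_dom F C -> cweight_dom G C' ->
  cweight_dom (fun y => F y + k * G y) (C + `|complex.Re k| * C' + `|complex.Im k| * C').
Proof.
move=> [d1 d2] [e1 e2]; split.
- have := weight_domD (- complex.Im k) (weight_domD (complex.Re k) d1 e1) e2; rewrite normrN.
  by congr weight_dom; apply/funext => y; rewrite raddfD/= ReM; ring.
- have := weight_domD (complex.Im k) (weight_domD (complex.Re k) d2 e2) e1.
  by congr weight_dom; apply/funext => y; rewrite raddfD/= ImM; ring.
Qed.

Lemma complex_extensionD F G C C' (k : R[i]) : cweight_dom F C -> cweight_dom G C' ->
  LC (fun y => F y + k * G y) = LC F + k * LC G.
Proof.
move=> [d1 d2] [e1 e2]; apply/eqP; rewrite eq_complex !raddfD/= ReM ImM/=.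
apply/andP; split; apply/eqP.
- transitivity (Lam (fun y => (complex.Re (F y) + complex.Re k * complex.Re (G y)) + (- complex.Im k) * complex.Im (G y))).
    by congr Lam; apply/funext => y; rewrite raddfD/= ReM; ring.
  by rewrite (LamD _ (weight_domD _ d1 e1) e2) (LamD _ d1 e1); ring.
- transitivity (Lam (fun y => (complex.Im (F y) + complex.Re k * complex.Im (G y)) + complex.Im k * complex.Re (G y))).
    by congr Lam; apply/funext => y; rewrite raddfD/= ImM; ring.
  by rewrite (LamD _ (weight_domD _ d2 e2) e1) (LamD _ d2 e2); ring.
Qed.

Lemma complex_extension_ext F G C C' : cweight_dom F C -> cweight_dom G C' ->
  (forall y, 0 <= y <= 1 -> F y = G y) -> LC F = LC G.
Proof.
move=> [d1 d2] [e1 e2] FG; rewrite /complex_extension; congr (_ +i* _).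
- by apply: functional_ext d1 e1 _ => y y01; rewrite FG.
- by apply: functional_ext d2 e2 _ => y y01; rewrite FG.
Qed.

Lemma complex_extension_powlog b n : 1 < b ->
  LC (fun y => (powlog b n y)%:C) = (Lam (powlog b n))%:C.
Proof.
move=> b1; rewrite /complex_extension /=; congr (_ +i* _).
apply/eqP; rewrite -normr_le0 -[leRHS](mulr0 B); apply: Lam_bound; split => //.
by move=> y _; rewrite normr0 mul0r.
Qed.

Lemma cweight_dom_real (f : R -> R) C : weight_dom f C -> cweight_dom (fun y => (f y)%:C) C.
Proof.
move=> df; split => //=; split => // y /andP[y0 _]; rewrite normr0 mulr_ge0//.
exact: weight_dom_ge0 df.
Qed.

Lemma complex_extension_expand b n N (zeta : R[i]) : 1 < b -> cnorm zeta < b - 1 ->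
  LC (cpow_rem b n 0 zeta) =
  \sum_(j < N) zeta ^+ j / j`!%:R * (Lam (powlog b (n + j)))%:C + LC (cpow_rem b n N zeta).
Proof.
move=> b1 zb; elim: N => [|N IH]; first by rewrite big_ord0 add0r.
rewrite big_ord_recr/= IH -addrA; congr (_ + _).
(* Halfway between [|zeta|] and [b - 1]: the rest of the distance is left to the logarithms. *)
pose dl : R := (b - 1 + cnorm zeta) / 2.
have z0 := cnorm_ge0 zeta.
have d0 : 0 < dl by rewrite /dl; lra.
have zd : cnorm zeta <= dl by rewrite /dl; lra.
have e0 : 0 < b - 1 - dl by rewrite /dl; lra.
have de : dl + (b - 1 - dl) <= b - 1 by lra.
have h1 := weight_dom_cpow_rem n N.+1 d0 e0 de zd.
have [C pC] := weight_dom_powlog (n + N) b1.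
have := @complex_extensionD _ _ _ _ (zeta ^+ N / N`!%:R) h1 (cweight_dom_real pC).
rewrite complex_extension_powlog// addrC => <-.
by congr LC; apply/funext => y; exact: cpow_remS.
Qed.

Lemma complex_extension_rem b n N (zeta : R[i]) dl eta : 0 < dl -> 0 < eta -> dl + eta <= b - 1 ->
  cnorm zeta <= dl ->
  cnorm (LC (cpow_rem b n N zeta)) <= 2 * (B * (n`!%:R / eta ^+ n * (cnorm zeta / dl) ^+ N)).
Proof.
move=> d0 e0 de zd; apply: complex_extension_bound.
exact: weight_dom_cpow_rem.
Qed.

Lemma geometric_squeeze (a K th : R) : 0 <= th < 1 -> (forall N, a <= K * th ^+ N) -> a <= 0.
Proof.
move=> /andP[th0 th1] H.
have c : (fun N => K * th ^+ N) @ \oo --> 0.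
  by rewrite -[X in _ --> X](mulr0 K); apply: cvgMr; apply: cvg_expr; rewrite ger0_norm.
by rewrite -(cvg_lim _ c)//; apply: limr_ge; [exact: cvgP c|exact: nearW].
Qed.

Definition vanishes_at b := forall n, Lam (powlog b n) = 0.

(** When all coefficients vanish, the extension equals its remainder of every order, and these decay
    geometrically inside the disc. *)
Lemma vanishes_disc b n (zeta : R[i]) : 1 < b -> vanishes_at b -> cnorm zeta < b - 1 ->
  LC (cpow_rem b n 0 zeta) = 0.
Proof.
move=> b1 vb zb.
pose dl : R := (b - 1 + cnorm zeta) / 2.
have z0 := cnorm_ge0 zeta.
have d0 : 0 < dl by rewrite /dl; lra.
have zd : cnorm zeta < dl by rewrite /dl; lra.
have e0 : 0 < b - 1 - dl by rewrite /dl; lra.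
have de : dl + (b - 1 - dl) <= b - 1 by lra.
have E N : LC (cpow_rem b n 0 zeta) = LC (cpow_rem b n N zeta).
  rewrite (complex_extension_expand n N b1 zb) big1 ?add0r// => j _.
  by rewrite vb -[0%:C]/(0 : R[i]) mulr0.
apply: Normc.eq0_normc; apply/eqP; rewrite -/(cnorm _) eq_le cnorm_ge0 andbT.
apply: (@geometric_squeeze _ (2 * (B * (n`!%:R / (b - 1 - dl) ^+ n))) (cnorm zeta / dl)).
  by rewrite divr_ge0 ?(ltW d0)//= ltr_pdivrMr// mul1r.
move=> N; rewrite (E N) -!mulrA.
have := complex_extension_rem n N d0 e0 de (ltW zd).
by rewrite -!mulrA.
Qed.

Lemma vanishes_near b b' : 1 < b -> 1 < b' -> vanishes_at b -> `|b' - b| < b - 1 -> vanishes_at b'.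
Proof.
move=> b1 b'1 vb bb n.
have := @vanishes_disc b n (b' - b)%:C b1 vb; rewrite cnorm_real => /(_ bb) /(congr1 (@complex.Re R)) /= H.
have [C pC] := weight_dom_powlog n b'1.
rewrite -H; pose dl : R := (b - 1 + `|b' - b|) / 2.
have z0 := normr_ge0 (b' - b).
have d0 : 0 < dl by rewrite /dl; lra.
have e0 : 0 < b - 1 - dl by rewrite /dl; lra.
have de : dl + (b - 1 - dl) <= b - 1 by lra.
have [|h1 _] := @weight_dom_cpow_rem R b n 0 (b' - b)%:C _ _ d0 e0 de.
  by rewrite cnorm_real /dl; lra.
apply: functional_ext pC h1 _ => y /andP[y0 _].
by rewrite Re_cpow_rem_real//; [congr powlog; ring|rewrite gt_eqF//; lra|rewrite gt_eqF//; lra].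
Qed.

(* The Taylor expansion of [s |-> Lam (y ^ s)] at [b] is valid in the disc of
   radius [b - 1], so centers can be moved from [b] to [1 + 3/2 (b - 1)]. *)
Lemma vanishes_line b b' : 1 < b -> 1 < b' -> vanishes_at b -> vanishes_at b'.
Proof.
move=> b1 b'1 vb.
have up k : vanishes_at (1 + (3 / 2) ^+ k * (b - 1)) /\ 1 < 1 + (3 / 2) ^+ k * (b - 1).
  elim: k => [|k [IH IH1]].
    by rewrite expr0 mul1r (_ : 1 + (b - 1) = b)//; ring.
  have h : 1 < 1 + (3 / 2) ^+ k.+1 * (b - 1) by rewrite exprS; lra.
  split => //; apply: vanishes_near IH _ => //.
  rewrite exprS ger0_norm; lra.
(* It is enough to move the center beyond [b']: a disc of radius [c - 1] about [c] reaches down to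
   1, hence contains every [b'] with [1 < b' <= c]. Bernoulli's inequality shows that the centers
   are unbounded. *)
have [k kb] : exists k, b' <= 1 + (3 / 2) ^+ k * (b - 1).
  have bern k : 1 + k%:R / 2 <= (3 / 2) ^+ k :> R.
    elim: k => [|k IH]; first by rewrite expr0 mul0r addr0.
    by rewrite exprS -natr1; have : 0 <= k%:R :> R by []; lra.
  have [k Hk] : exists k : nat, 2 * (b' / (b - 1)) <= k%:R.
    exists (Num.truncn (2 * (b' / (b - 1)))).+1; apply: ltW; exact: truncnS_gt.
  exists k; apply: (@le_trans _ _ ((3 / 2) ^+ k * (b - 1))); last lra.
  rewrite -ler_pdivrMr ?subr_gt0//; apply: le_trans (bern k).
  lra.
have [vk k1] := up k.
by apply: (vanishes_near k1 b'1 vk); rewrite ler0_norm; lra.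
Qed.

(* The discs of center [b] and radius [b - 1] are tangent to the line
   [Re s = 1]. *)
Lemma disc_cover (s : R[i]) : 1 < complex.Re s -> exists2 b, 1 < b & cnorm (s - b%:C) < b - 1.
Proof.
case: s => x t /= x1.
(* Squared out, the condition on [b] reads [2 * b * (x - 1) > x ^ 2 + t ^ 2 - 1], which holds as
   soon as [b >= M]. *)
pose M := (x ^+ 2 + t ^+ 2) / (2 * (x - 1)).
have M0 : 0 <= M by rewrite divr_ge0 ?addr_ge0 ?sqr_ge0//; lra.
exists (M + 1 + 1); first lra.
rewrite /= subr0; set b := M + 1 + 1.
have b1 : 0 < b - 1 by rewrite /b; lra.
rewrite -[ltRHS]gtr0_norm// -sqrtr_sqr ltr_sqrt ?exprn_gt0//.
have MM : x ^+ 2 + t ^+ 2 = M * (2 * (x - 1)) by rewrite /M divfK// gt_eqF//; lra.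
rewrite -subr_gt0.
have -> : (b - 1) ^+ 2 - ((x - b) ^+ 2 + t ^+ 2) = 1 - 2 * b + 2 * b * x - (x ^+ 2 + t ^+ 2) by ring.
rewrite MM /b.
have -> : 1 - 2 * (M + 1 + 1) + 2 * (M + 1 + 1) * x - M * (2 * (x - 1)) = 1 + 4 * (x - 1) by ring.
lra.
Qed.

Lemma complex_extension_cpow0 b (s : R[i]) : 1 < b -> cnorm (s - b%:C) < b - 1 -> 1 <= complex.Re s ->
  LC (cpow0 s) = LC (cpow_rem b 0 0 (s - b%:C)).
Proof.
move=> b1 sb s1; have z0 := cnorm_ge0 (s - b%:C).
pose dl : R := (b - 1 + cnorm (s - b%:C)) / 2.
have d0 : 0 < dl by rewrite /dl; lra.
have e0 : 0 < b - 1 - dl by rewrite /dl; lra.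
have de : dl + (b - 1 - dl) <= b - 1 by lra.
have zd : cnorm (s - b%:C) <= dl by rewrite /dl; lra.
apply: (complex_extension_ext (weight_dom_cpow0 s1) (weight_dom_cpow_rem 0 0 d0 e0 de zd)).
move=> y /andP[y0 _]; rewrite cpow_rem_cpow0//; last by rewrite gt_eqF//; lra.
by rewrite subrKC.
Qed.

End bounded_functional.

Section holomorphy.
Context {R : realType}.
Variables (Lam : (R -> R) -> R) (B : R).
Hypotheses (B0 : 0 <= B) (Lam_bound : forall f C, weight_dom f C -> `|Lam f| <= B * C)
  (LamD : forall f g C C' k, weight_dom f C -> weight_dom g C' ->
     Lam (fun y => f y + k * g y) = Lam f + k * Lam g).
Local Notation LC := (complex_extension Lam).

Lemma measurable_cmul (F G : R -> R[i]) :
  measurable_fun setT (fun y => complex.Re (F y)) -> measurable_fun setT (fun y => complex.Im (F y)) ->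
  measurable_fun setT (fun y => complex.Re (G y)) -> measurable_fun setT (fun y => complex.Im (G y)) ->
  measurable_fun setT (fun y => complex.Re (F y * G y)) /\ measurable_fun setT (fun y => complex.Im (F y * G y)).
Proof.
move=> m1 m2 m3 m4; split.
- under eq_fun do rewrite ReM; apply: measurable_funB; exact: measurable_funM.
- under eq_fun do rewrite ImM; apply: measurable_funD; exact: measurable_funM.
Qed.

Lemma cweight_dom_cnorm (F : R -> R[i]) C :
  measurable_fun setT (fun y => complex.Re (F y)) -> measurable_fun setT (fun y => complex.Im (F y)) ->
  (forall y, 0 <= y <= 1 -> cnorm (F y) <= C * y) -> cweight_dom F C.
Proof.
move=> m1 m2 H; split; split => // y y01; apply: le_trans (H y y01).
- exact: Re_le_cnorm.
- exact: Im_le_cnorm.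
Qed.

Lemma cnorm_cpow0E (s : R[i]) y : 0 < y -> cnorm (cpow0 s y) = y `^ complex.Re s.
Proof.
move=> y0; rewrite /cpow0 y0 cpowE cnorm_cexp [s * _]mulrC ReMr /powR gt_eqF//.
by rewrite mulrC.
Qed.

Lemma cpow0_at0 (s : R[i]) : cpow0 s 0 = 0. Proof. by rewrite /cpow0 ltxx. Qed.

Lemma cexp_rem_at0 N (h : R[i]) : measurable_fun setT (fun y => complex.Re (cexp_rem N (h * (ln y)%:C))) /\
  measurable_fun setT (fun y => complex.Im (cexp_rem N (h * (ln y)%:C))).
Proof.
have E y : cpow_rem 0 0 N h y = cexp_rem N (h * (ln y)%:C).
  by rewrite /cpow_rem /powlog powRr0 expr0 mul1r -[1%:C]/(1 : R[i]) mul1r.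
have [m1 m2] := measurable_cpow_rem 0 0 N h.
by split; [move: m1|move: m2]; congr (measurable_fun _ _); apply/funext => y; rewrite E.
Qed.

(** Derivability in direction 1 over the field [R[i]] is complex differentiability. The derivative
    is the extension evaluated at [F1], the power times the logarithm, because the remainder of
    order 2 is bounded by a multiple of [|h| ^ 2]. *)
Lemma derivable_complex_extension (s : R[i]) : 1 < complex.Re s ->
  derivable (fun s : R[i]^o => LC (cpow0 s) : R[i]^o) s 1.
Proof.
move=> s1; pose dl := complex.Re s - 1.
have d0 : 0 < dl by rewrite subr_gt0.
have [ms1 ms2] := measurable_cpow0 s.
pose F1 y := cpow0 s y * (ln y)%:C.
have dF1 : cweight_dom F1 (1`!%:R / dl ^+ 1).
  have [m1 m2] : measurable_fun setT (fun y => complex.Re (F1 y)) /\ measurable_fun setT (fun y => complex.Im (F1 y)).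
    by apply: measurable_cmul => //=; exact: measurable_ln.
  apply: cweight_dom_cnorm => // y /andP[]; rewrite le_eqVlt => /predU1P[<- _|y0 y1].
    by rewrite /F1 cpow0_at0 mul0r -[0]/(0%:C : R[i]) cnorm_real normr0 mulr0.
  rewrite /F1 cnormM cnorm_cpow0E// cnorm_real.
  have := normr_ln_exp 1 y d0; rewrite expr1 => /(ler_wpM2l (powR_ge0 y (complex.Re s))) h.
  apply: le_trans h _; rewrite mulrCA powR_expR_ln ?y0// /dl subKr powRr1 ?(ltW y0)//.
pose rem h y := cpow0 s y * cexp_rem 2 (h * (ln y)%:C).
have drem h : cnorm h <= dl -> cweight_dom (rem h) ((cnorm h / dl) ^+ 2).
  move=> hd; have [mr1 mr2] := cexp_rem_at0 2 h.
  have [m1 m2] : measurable_fun setT (fun y => complex.Re (rem h y)) /\ measurable_fun setT (fun y => complex.Im (rem h y)).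
    exact: measurable_cmul.
  apply: cweight_dom_cnorm => // y /andP[]; rewrite le_eqVlt => /predU1P[<- _|y0 y1].
    by rewrite /rem cpow0_at0 mul0r -[0]/(0%:C : R[i]) cnorm_real normr0 mulr0.
  rewrite /rem cnormM cnorm_cpow0E//.
  have := cnorm_cexp_rem 2 (ln y) d0 hd => /(ler_wpM2l (powR_ge0 y (complex.Re s))) h'.
  by apply: le_trans h' _; rewrite mulrCA powR_expR_ln ?y0// /dl subKr powRr1 ?(ltW y0)//.
have E h y : cpow0 (s + h) y = (cpow0 s y + h * F1 y) + 1 * rem h y.
  rewrite /F1 /rem /cpow0; case: ifPn => y0; last by rewrite !mul0r !mulr0 !addr0.
  rewrite !cpowE !cexp_remS cexp_rem0 mulrDl.
  have -> : cexp (s * (ln y)%:C + h * (ln y)%:C) = cexp (s * (ln y)%:C) * cexp (h * (ln y)%:C).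
    set u := s * _; set v := h * _; rewrite /cexp !raddfD/= expRD cosD sinD.
    apply/eqP; rewrite eq_complex !(ReM, ImM)/=; apply/andP; split; apply/eqP; ring.
  rewrite expr0 expr1 fact0 divr1 (_ : 1`!%:R = 1) ?divr1//; ring.
have key h : cnorm h <= dl -> cnorm (LC (cpow0 (s + h)) - LC (cpow0 s) - h * LC F1) <= 2 * (B * (cnorm h / dl) ^+ 2).
  move=> hd; have d1 := weight_dom_cpow0 (ltW s1).
  have d2 := cweight_domD h d1 dF1.
  have -> : LC (cpow0 (s + h)) = LC (cpow0 s) + h * LC F1 + 1 * LC (rem h).
    rewrite -(complex_extensionD LamD h d1 dF1) -(complex_extensionD LamD 1 d2 (drem _ hd)).
    by congr LC; apply/funext => y; exact: E.
  rewrite mul1r (_ : _ - _ - _ = LC (rem h)); last by ring.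
  exact: (complex_extension_bound Lam_bound (drem _ hd)).
apply: (cvgP (LC F1 : R[i]^o)); apply/cvg_complexP => e e0.
pose K := 2 * (B * (dl ^- 2)).
have K0 : 0 <= K by rewrite mulr_ge0// mulr_ge0// invr_ge0 exprn_ge0// ltW.
have small : \forall h \near (0 : R[i]^o)^', h != 0 /\ cnorm h < Num.min dl (e / (K + 1)).
  have m0 : 0 < (Num.min dl (e / (K + 1)))%:C :> R[i].
    by rewrite ltcR lt_min d0 divr_gt0// ltr_wpDl.
  have nz : \forall h \near (0 : R[i]^o)^', h != 0 by rewrite /dnbhs near_withinE; exact: nearW.
  apply: filterS2 nz (@dnbhs0_lt _ R[i]^o _ m0) => h h0.
  have -> : `|h| = (cnorm h)%:C := norm_complexE h.
  by rewrite ltcR.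
apply: filterS small => h [h0]; rewrite lt_min => /andP[hd he].
have nh0 : 0 < cnorm h.
  by rewrite lt_neqAle cnorm_ge0 andbT eq_sym; apply: contra h0 => /eqP/Normc.eq0_normc ->.
have := key h (ltW hd); rewrite /= => kh.
have -> : h^-1 *: (LC (cpow0 (h *: 1 + s)) - LC (cpow0 s)) - LC F1 =
   h^-1 * (LC (cpow0 (s + h)) - LC (cpow0 s) - h * LC F1).
  rewrite /GRing.scale/= mulr1 addrC [h + s]addrC; field; exact: h0.
rewrite cnormM /cnorm Normc.normcV -/(cnorm _) -/(cnorm _) mulrC ltr_pdivrMr//.
apply: le_lt_trans kh _.
have -> : 2 * (B * (cnorm h / dl) ^+ 2) = K * cnorm h * cnorm h.
  by rewrite /K exprMn exprVn; ring.
rewrite ltr_pM2r//; move: he; rewrite ltr_pdivlMr ?ltr_wpDl// mulrDr mulr1 mulrC => he.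
by apply: le_lt_trans he; rewrite lerDl cnorm_ge0.
Qed.
End holomorphy.

Lemma continuous_growth_lip (R : realType) (q C : R) (phi : R -> R) : 0 < q -> growth_lip q phi C -> continuous phi.
Proof.
move=> q0 Hl x; have C0 := growth_lip_ge0 Hl; case: Hl => _ _ Hl.
pose D := C * (1 + `|x| `^ q + (`|x| + 1) `^ q) + 1.
have D0 : 0 < D by rewrite ltr_wpDl// mulr_ge0// !addr_ge0// powR_ge0.
apply/cvgrPdist_le => e e0; near=> y.
have y1 : `|x - y| <= 1 by near: y; exists 1 => //= z /= /ltW.
have y2 : `|x - y| <= e / D.
  by near: y; exists (e / D); [exact: divr_gt0|move=> z /= /ltW].
apply: le_trans (Hl x y) _; rewrite mulrCA.
apply: (@le_trans _ _ (e / D * D)); last by rewrite divfK// gt_eqF.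
apply: ler_pM => //.
  by rewrite mulr_ge0// !addr_ge0// powR_ge0.
rewrite /D -[leLHS]addr0 lerD// ler_wpM2l// lerD2l ge0_ler_powR ?nnegrE ?(ltW q0)//.
rewrite -[y](subKr x); apply: le_trans (ler_normB _ _) _; exact: lerD.
Unshelve. all: by end_near. Qed.

Lemma continuous_trunc_pow (R : realType) (s M : R) : 1 < s -> 0 < M -> continuous (trunc_pow s M : R -> R).
Proof.
move=> s1 M0.
have h0 : 0 < (s - 1) / 2 by lra.
have [C Hl] : exists C, growth_lip (2 * s) (fun x : R => `|x| `^ s) C.
  exists ((s + (s - 1) / 2) * (`|0 : R| / ((s - 1) / 2)) ^+ 0).
  have -> : (fun x : R => `|x| `^ s) = (fun x => pow_rem s 0 0 `|x|).
    by apply/funext => x; rewrite pow_rem0 ?addr0// gt_eqF//; lra.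
  by apply: growth_lip_pow_rem => //; rewrite ?normr0; lra.
have s0 : 0 < 2 * s by lra.
have c := continuous_growth_lip s0 Hl.
have -> : trunc_pow s M = (fun y : R => `|y| `^ s) \o (fun y : R => Num.min `|y| M).
  apply/funext => y /=; rewrite /trunc_pow [X in _ = X `^ s]ger0_norm// le_min normr_ge0 ltW//.
move=> y; apply: continuous_comp; last exact: c.
apply: continuous_min; [exact: norm_continuous|exact: cvg_cst].
Qed.

(** * Convergence of the moments of the weighted sums *)

Section family.
Context d (T : measurableType d) (R : realType) (P : probability T R).
Variables (I : Type) (F : set_system I).
Hypothesis FF : ProperFilter F.
Variables (p : I -> nat -> T -> R) (x : nat -> T -> R) (X : T -> R) (Z : I -> T -> R).
Hypothesis HW : forall t, iid_weighted P (p t) x X.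
Hypothesis ZE : forall t, {ae P, forall w, Z t w = weighted_sum (p t) x w}.
Hypothesis Zcvg : forall f : R -> R, continuous f -> bounded_fun f ->
  cvg ((fun t => \int[P]_w f (Z t w)) @ F).
Variable k1 : R.
Hypotheses (k1E : (\int[P]_w `|X w|%:E = k1%:E)%E).

(** [l] is the limit of the moments of the partial sums. The truncation error is uniform in [n] and
    passes to the limit, so the moment of [Z t] itself never has to be computed. *)
Lemma weighted_sum_trunc t (s s' k' M l : R) :
  1 < s -> s < s' -> (\int[P]_w (`|X w| `^ s')%:E = k'%:E)%E -> 0 < M ->
  (fun n => \int[P]_w `|weighted_partial_sum (p t) x n w| `^ s) @ \oo --> l ->
  `|l - \int[P]_w trunc_pow s M (Z t w)| <= M `^ (s - s') * k'.
Proof.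
move=> s1 ss k'E M0 c1.
have ct := continuous_trunc_pow s1 M0.
have s0 : 0 < s by exact: lt_trans ltr01 s1.
have mX := iw_mX (HW t).
have Xs : (\int[P]_w (`|X w| `^ s)%:E <= (1 + k')%:E)%E.
  rewrite EFinD -k'E; apply: moment_le1D => //; last exact: ltW.
  exact: (measurableT_comp (@normr_measurable R setT)).
have tb y : `|trunc_pow s M y| <= M `^ s.
  by have /andP[h1 h2] := trunc_pow_bounds y s0 M0; rewrite ger0_norm.
have [c2 _] := cvg_expectation_partial_sum (HW t) k1E ct tb (ZE t).
have c3 : (fun n => `|\int[P]_w `|weighted_partial_sum (p t) x n w| `^ s -
    \int[P]_w trunc_pow s M (weighted_partial_sum (p t) x n w)|) @ \oo -->
    `|l - \int[P]_w trunc_pow s M (Z t w)| by apply: cvg_norm; exact: cvgB.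
rewrite -(cvg_lim _ c3)//; apply: limr_le; first exact: cvgP c3.
apply: nearW => n.
apply: trunc_moment_le => //.
- exact: measurable_partial_sum (HW t) _.
- exact: ltW.
- apply: le_lt_trans (moment_partial_sum_le (HW t) n (ltW s1)) _.
  by apply: le_lt_trans Xs _; exact: ltry.
- rewrite -k'E; apply: (moment_partial_sum_le (HW t) n _).
  by apply: le_trans (ltW s1) _; exact: ltW.
Qed.

Lemma cvg_limit_moment (s s' k' : R) (l : I -> R) :
  1 < s -> s < s' -> (\int[P]_w (`|X w| `^ s')%:E = k'%:E)%E ->
  (forall t, (fun n => \int[P]_w `|weighted_partial_sum (p t) x n w| `^ s) @ \oo --> l t) ->
  cvg (l @ F).
Proof.
move=> s1 ss k'E Hl; apply: cvg_of_approx => e e0.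
have k0 : 0 <= k'.
  by rewrite -lee_fin -k'E; apply: integral_ge0 => w _; rewrite lee_fin powR_ge0.
(* [M] is chosen so that [M ^ (s - s') = e / (k' + 1)]. *)
pose b := (k' + 1) / e; have b0 : 0 < b by rewrite divr_gt0// ltr_wpDl.
pose M := b `^ (s' - s)^-1; have M0 : 0 < M by rewrite powR_gt0.
have cc := continuous_trunc_pow s1 M0.
have bb : bounded_fun (trunc_pow s M : R -> R).
  exists (M `^ s); split; first exact: num_real.
  move=> B MB y _ /=; have /andP[h1 h2] := trunc_pow_bounds y (lt_trans ltr01 s1) M0.
  by rewrite ger0_norm// (le_trans h2)// ltW.
have /cvg_ex[/= g0 Hg] := Zcvg cc bb.
exists (fun t => \int[P]_w trunc_pow s M (Z t w)), g0; split => //.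
apply: nearW => t; apply: le_trans (weighted_sum_trunc s1 ss k'E M0 (Hl t)) _.
rewrite -(opprB s' s) powRN /M -powRrM mulVf ?subr_eq0 ?gt_eqF// powRr1 ?(ltW b0)//.
by rewrite mulrC ler_pdivrMr// /b mulrCA divff ?gt_eqF// mulr1; lra.
Qed.
End family.

Section ultra_functional.
Context {R : realType} (I : Type).
Variables (Cls : (R -> R) -> R -> Prop) (G : I -> (R -> R) -> R) (B : R).
Hypotheses (G_bound : forall t f C, Cls f C -> `|G t f| <= B * C)
  (GD : forall t f g C C' k, Cls f C -> Cls g C' ->
     G t (fun y => f y + k * g y) = G t f + k * G t g).

Definition ultra_functional (U : set_system I) f := lim ((fun t => G t f) @ U).
Definition ultra_difference (U V : set_system I) f := ultra_functional U f - ultra_functional V f.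

Section limit.
Variable U : set_system I.
Hypothesis UU : UltraFilter U.

Lemma ultra_functional_cvg f C : Cls f C -> (fun t => G t f) @ U --> ultra_functional U f.
Proof. by move=> fC; apply: (ultra_cvg UU (fun t => G_bound t fC)). Qed.

Lemma ultra_functional_bound f C : Cls f C -> `|ultra_functional U f| <= B * C.
Proof. by move=> fC; apply: (ultra_lim_le UU (fun t => G_bound t fC)). Qed.

Lemma ultra_functionalD f g C C' k : Cls f C -> Cls g C' ->
  ultra_functional U (fun y => f y + k * g y) = ultra_functional U f + k * ultra_functional U g.
Proof.
move=> fC gC; have UF : ProperFilter U by exact: ultra_proper.
apply: cvg_lim => //.
have -> : (fun t => G t (fun y => f y + k * g y)) = (fun t => G t f + k * G t g).
  by apply/funext => t; exact: GD fC gC.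
apply: cvgD; first exact: ultra_functional_cvg fC.
by apply: cvgMr; exact: ultra_functional_cvg gC.
Qed.
End limit.

Variables U V : set_system I.
Hypotheses (UU : UltraFilter U) (VV : UltraFilter V).

Lemma ultra_difference_bound f C : Cls f C -> `|ultra_difference U V f| <= 2 * B * C.
Proof.
move=> fC; apply: le_trans (ler_normB _ _) _; rewrite -mulrA mulr_natl mulr2n.
by apply: lerD; exact: ultra_functional_bound fC.
Qed.

Lemma ultra_differenceD f g C C' k : Cls f C -> Cls g C' ->
  ultra_difference U V (fun y => f y + k * g y) = ultra_difference U V f + k * ultra_difference U V g.
Proof.
by move=> fC gC; rewrite /ultra_difference (ultra_functionalD UU k fC gC) (ultra_functionalD VV k fC gC); ring.
Qed.
End ultra_functional.

Lemma cross_difference (R : comRingType) (k u v u' v' : R) : u + k * v = u' + k * v' -> (v - v') * k = u' - u.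
Proof. by move=> E; rewrite -[in RHS](addrK (k * v') u') -E; ring. Qed.

(** * Comparison of ultrafilter limits at the abscissa *)

Section moment_rigidity.
Context d (T : measurableType d) (R : realType) (P : probability T R).
Variables (I : Type) (F : set_system I).
Hypothesis FF : ProperFilter F.
Variables (p : I -> nat -> T -> R) (x : nat -> T -> R) (X : T -> R) (Z : I -> T -> R).
Hypothesis HW : forall t, iid_weighted P (p t) x X.
Hypothesis ZE : forall t, {ae P, forall w, Z t w = weighted_sum (p t) x w}.
Hypothesis Zcvg : forall f : R -> R, continuous f -> bounded_fun f ->
  cvg ((fun t => \int[P]_w f (Z t w)) @ F).
Hypothesis mX : measurable_fun setT X.
Variables (a k1 : R).
Hypotheses (a1 : 1 < a) (k1E : (\int[P]_w `|X w|%:E = k1%:E)%E)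
  (fin_moment : forall s, 1 < s < a -> exists k, (\int[P]_w (`|X w| `^ s)%:E = k%:E)%E)
  (inf_moment : forall e : R, 0 < e -> (\int[P]_w (`|X w| `^ (a + e))%:E = +oo)%E).

(** These choices give [1 < a - delta], [a + delta - 1 <= q] and [q < a]. The moment of order [q] is
    therefore finite, while functions of degree up to [a + delta] still satisfy the growth
    condition. *)
Let delta := Num.min ((a - 1) / 2) 2^-1.
Let q := Num.max 1 (a - 2^-1).

Let delta0 : 0 < delta. Proof. by have h := a1; rewrite lt_min; apply/andP; split; lra. Qed.
Let delta_le : delta <= (a - 1) / 2. Proof. by rewrite ge_min lexx. Qed.
Let delta_le2 : delta <= 2^-1. Proof. by rewrite ge_min lexx orbT. Qed.
Let q1 : 1 <= q. Proof. by rewrite le_max lexx. Qed.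
Let qa : a - 2^-1 <= q. Proof. by rewrite le_max lexx orbT. Qed.

Let kq_ex : exists kq, (\int[P]_w (`|X w| `^ q)%:E = kq%:E)%E.
Proof.
have h1 := a1; rewrite /q; have [h|h] := leP 1 (a - 2^-1).
  move: h; rewrite le_eqVlt => /predU1P[<-|h]; last by apply: fin_moment; lra.
  by exists k1; rewrite -k1E; apply: eq_integral => w _; rewrite powRr1.
by exists k1; rewrite -k1E; apply: eq_integral => w _; rewrite powRr1.
Qed.

Let L t := weight_functional P (p t).
Let H t := sum_functional P (p t) x.
(** Composition with the absolute value lets the same functions [pow_rem a N z] serve both
    functionals. *)
Let gl (f : R -> R) C := growth_lip q (fun y => f `|y|) C.
Let H' t (f : R -> R) := H t (fun y => f `|y|).

Let L_bound t f C : weight_dom f C -> `|L t f| <= 1 * C.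
Proof. by move=> h; rewrite mul1r; exact: (weight_functional_bound (HW t)). Qed.

Let L_D t f g C C' k : weight_dom f C -> weight_dom g C' ->
  L t (fun y => f y + k * g y) = L t f + k * L t g.
Proof. exact: (weight_functionalD (HW t)). Qed.

Variables U V : set_system I.
Hypotheses (UU : UltraFilter U) (VV : UltraFilter V) (FU : F `<=` U) (FV : F `<=` V).

Let Lam := ultra_difference L U V.
(** The ultrafilters are swapped with respect to [Lam], which absorbs the sign when [H] is moved to
    the other side of the equation. *)
Let Phi := ultra_difference H' V U.

Let pow_identity (z : R) : - delta < z < 0 ->
  Lam (pow_rem a 0 z) * big_moment P X (a + z) = Phi (pow_rem a 0 z).
Proof.
move=> /andP[z1 z2]; have [kq kqE] := kq_ex.
have [h1 h2 h3 h4 h5] := And5 a1 delta0 delta_le delta_le2 qa.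
have zd : `|z| <= delta by rewrite ltr0_norm; lra.
have wd := weight_dom_pow_rem 0 delta0 (_ : delta <= a - 1) zd.
have {}wd := wd ltac:(lra).
have gd := @growth_lip_pow_rem R a 0 z delta q delta0 ltac:(lra) ltac:(lra) q1 zd.
set f := pow_rem a 0 z in wd gd *.
have fE y : 0 <= y -> f y = y `^ (a + z).
  by move=> y0; rewrite /f pow_rem0// gt_eqF//; lra.
set s := a + z in fE *.
have s1 : 1 < s by rewrite /s; lra.
have [ks ksE] : exists k, (\int[P]_w (`|X w| `^ s)%:E = k%:E)%E by apply: fin_moment; rewrite /s; lra.
(* An order strictly between [s] and [a] has a finite moment, which supplies the uniform
   integrability for order [s]. *)
have [k' k'E] : exists k, (\int[P]_w (`|X w| `^ (a + z / 2))%:E = k%:E)%E by apply: fin_moment; rewrite /s; lra.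
have gE : (fun y : R => f `|y|) = (fun y => `|y| `^ s).
  by apply/funext => y; rewrite fE.
have Hg : growth_lip q (fun y : R => `|y| `^ s) ((a + delta) * (`|z| / delta) ^+ 0) by rewrite -gE.
have wd' := weight_dom_powR (ltW s1).
have LE t : L t f = L t (fun y => y `^ s).
  apply: (functional_ext (B := 1) (@L_bound t) (@L_D t) wd wd') => y /andP[y0 _].
  exact: fE.
have Hl t := cvg_moment_partial_sum (HW t) q1 k1E kqE (ltW s1) ksE Hg.
have ss : s < a + z / 2 by rewrite /s; lra.
have /cvg_ex[/= l Hc] := cvg_limit_moment FF HW ZE Zcvg k1E s1 ss k'E Hl.
have uq W : UltraFilter W -> F `<=` W ->
    ultra_functional H' W f + big_moment P X s * ultra_functional L W f = l.
  move=> WW FW; have WF : ProperFilter W by exact: ultra_proper.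
  have cl : (fun t => H t (fun y => `|y| `^ s) + big_moment P X s * L t (fun y => y `^ s)) @ W --> l.
    by apply: cvg_trans Hc => A; exact: FW.
  rewrite -(cvg_lim _ cl)//; apply/esym/cvg_lim => //.
  under eq_fun do rewrite -LE -gE.
  apply: cvgD; last first.
    by apply: cvgMr; exact: (ultra_functional_cvg L_bound WW wd).
  apply: (@ultra_functional_cvg R I gl H' _ _ W WW f _ gd).
  by move=> t g C gC; rewrite mulrC; exact: (sum_functional_bound (HW t) q1 k1E kqE gC).
have := uq U UU FU; rewrite -(uq V VV FV) => E.
exact: cross_difference E.
Qed.

(* If [k] is the least index of a nonzero coefficient, then dividing the two
   expansions expands [big_moment P X] at [a] from the left, and Landau's theorem
   yields a finite moment of order larger than [a]. *)
Lemma powlog_rigidity k (B : R) : (forall j, (j < k)%N -> Lam (powlog a j) = 0) ->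
  (k = 0%N \/ forall s, 1 < s < a -> `|big_moment P X s| <= B) -> Lam (powlog a k) = 0.
Proof.
move=> Hj HB; apply: contrapT => /eqP Lk; have [kq kqE] := kq_ex.
have [h1 h2 h3 h4 h5] := And5 a1 delta0 delta_le delta_le2 qa.
pose CL : R := 2 * 1 * 1.
pose CP : R := 2 * (growth_const q * moment_bound k1 kq) * (a + delta).
have H_bound t f C : gl f C -> `|H' t f| <= (growth_const q * moment_bound k1 kq) * C.
  by move=> gC; rewrite mulrC; exact: (sum_functional_bound (HW t) q1 k1E kqE gC).
have H_D t f g C C' c : gl f C -> gl g C' -> H' t (fun y => f y + c * g y) = H' t f + c * H' t g.
  by move=> fC gC; exact: (sum_functionalD (HW t) q1 k1E kqE c fC gC).
have b1 f C : weight_dom f C -> `|Lam f| <= 2 * 1 * C by exact: (ultra_difference_bound L_bound UU VV).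
have d1 f g C C' c : weight_dom f C -> weight_dom g C' -> Lam (fun y => f y + c * g y) = Lam f + c * Lam g.
  exact: (ultra_differenceD L_bound L_D UU VV c).
have r1 N z : `|z| <= delta -> weight_dom (pow_rem a N z) (1 * (`|z| / delta) ^+ N).
  by move=> zd; rewrite mul1r; apply: weight_dom_pow_rem => //; lra.
have e1 : expansion delta delta^-1 CL (fun z => Lam (pow_rem a 0 z)) (fun n => Lam (powlog a n) / n`!%:R).
  exact: (functional_expansion (@weight_domD R) b1 d1 delta0 (@pow_remS R a) r1).
have b2 f C : gl f C -> `|Phi f| <= 2 * (growth_const q * moment_bound k1 kq) * C.
  exact: (ultra_difference_bound H_bound VV UU).
have d2 f g C C' c : gl f C -> gl g C' -> Phi (fun y => f y + c * g y) = Phi f + c * Phi g.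
  exact: (ultra_differenceD H_bound H_D VV UU c).
have r2 N z : `|z| <= delta -> gl (pow_rem a N z) ((a + delta) * (`|z| / delta) ^+ N).
  by move=> zd; apply: growth_lip_pow_rem => //; lra.
have D2 f g C C' c : gl f C -> gl g C' -> gl (fun y => f y + c * g y) (C + `|c| * C').
  exact: growth_lipD.
have e2 : expansion delta delta^-1 CP (fun z => Phi (pow_rem a 0 z)) (fun n => Phi (powlog a n) / n`!%:R).
  exact: (functional_expansion D2 b2 d2 delta0 (@pow_remS R a) r2).
have di0 : 0 < delta^-1 by rewrite invr_gt0.
have CC : CL <= Num.max CL CP by rewrite le_max lexx.
have CC' : CP <= Num.max CL CP by rewrite le_max lexx orbT.
have C0 : 0 <= Num.max CL CP by apply: le_trans CC; rewrite /CL; lra.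
have f0 : k`!%:R != 0 :> R by rewrite pnatr_eq0 -lt0n fact_gt0.
have dk : Lam (powlog a k) / k`!%:R != 0 by rewrite mulf_neq0// invr_eq0.
have dj j : (j < k)%N -> Lam (powlog a j) / j`!%:R = 0 by move=> jk; rewrite Hj// mul0r.
have HB' : k = 0%N \/ forall z, - delta < z < 0 -> `|big_moment P X (a + z)| <= B.
  by case: HB => HB; [left|right => z zd; apply: HB; lra].
have [r' [A [sigma [c [r0 s0 A0 cA asy]]]]] := expansion_div delta0 di0 C0 (expansion_le (ltW di0) CC e1)
  (expansion_le (ltW di0) CC' e2) pow_identity dk dj HB'.
(* With density [Y] and exponent [u], both zero where [|X| <= 1], the big moment of order [a + z]
   becomes the integral of [Y * expR (z * u)], the form required by [landau]. *)
pose Y w := if 1 < `|X w| then `|X w| `^ a else 0.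
pose u w := if 1 < `|X w| then ln `|X w| else 0.
have m1 : measurable_fun setT (fun w => 1 < `|X w|).
  by apply: measurable_fun_ltr => //; exact: (measurableT_comp (@normr_measurable R setT)).
have mY : measurable_fun setT Y.
  by apply: measurable_fun_ifT => //; exact: (measurableT_comp (measurable_absX a)).
have m_u : measurable_fun setT u.
  apply: measurable_fun_ifT => //; apply: (measurableT_comp (@measurable_ln R)).
  exact: (measurableT_comp (@normr_measurable R setT)).
have Y0 w : 0 <= Y w by rewrite /Y; case: ifP => // _; exact: powR_ge0.
have u0 w : 0 <= u w by rewrite /u; case: ifP => // /ltW; exact: ln_ge0.
have YuE z w : Y w * expR (z * u w) = if 1 < `|X w| then `|X w| `^ (a + z) else 0.
  rewrite /Y /u; case: ifPn => [X1|_]; last by rewrite mul0r.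
  have X0 : 0 < `|X w| by exact: lt_trans X1.
  by rewrite /powR gt_eqF// -expRD mulrDl.
case/andP: r0 => r0 rd.
have KE (z : R) : - r' < z < 0 -> (\int[P]_w (Y w * expR (z * u w))%:E = (big_moment P X (a + z))%:E)%E.
  move=> /andP[z1 z2]; have zs : 1 < a + z < a by apply/andP; split; lra.
  have [ks ksE] := fin_moment zs.
  have [t0 _] := filter_ex (filterT (F := F)).
  by rewrite -(big_momentE (HW t0) ksE); apply: eq_integral => w _; rewrite YuE.
have [e e0] := landau (mu := P) mY m_u Y0 u0 r0 s0 A0 cA asy KE.
apply/negP; rewrite -leNgt.
suff : (\int[P]_w (`|X w| `^ (a + e))%:E <= 1%:E + \int[P]_w (Y w * expR (e * u w))%:E)%E.
  by rewrite inf_moment// leye_eq; case: (\int[P]_w (Y w * _)%:E)%E.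
rewrite -(integral_prob_cst P 1) -ge0_integralD//; last 2 first.
- by move=> w _; rewrite lee_fin mulr_ge0// expR_ge0.
- apply/measurable_EFinP; apply: measurable_funM => //.
  by apply: (measurableT_comp (@measurable_expR R)); exact: measurable_funM.
apply: ge0_le_integral => //.
- by apply/measurable_EFinP; exact: (measurableT_comp (measurable_absX (a + e))).
- apply: emeasurable_funD => //; apply/measurable_EFinP; apply: measurable_funM => //.
  by apply: (measurableT_comp (@measurable_expR R)); exact: measurable_funM.
move=> w _; rewrite YuE -EFinD lee_fin; case: ifPn => [_|]; first by rewrite lerDr.
rewrite -leNgt addr0 => h; have -> : (1 : R) = 1 `^ (a + e) by rewrite powR1.
by rewrite ge0_ler_powR ?nnegrE//; lra.
Qed.
End moment_rigidity.

(** * Locally uniform convergence on the half plane *)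

Section uniform_limits.
Context {R : realType} (I : Type) (F : set_system I).
Hypothesis FF : ProperFilter F.
Variables (L : I -> (R -> R) -> R).
Hypotheses (L_bound : forall t f C, weight_dom f C -> `|L t f| <= 1 * C)
  (L_D : forall t f g C C' k, weight_dom f C -> weight_dom g C' ->
     L t (fun y => f y + k * g y) = L t f + k * L t g).
Variables (U : set_system I) (b0 : R).
Hypotheses (UU : UltraFilter U) (b01 : 1 < b0)
  (vanish : forall V, UltraFilter V -> F `<=` V -> vanishes_at (ultra_difference L U V) b0).

Let M := ultra_functional L U.
Let M_bound f C : weight_dom f C -> `|M f| <= 1 * C. Proof. exact: ultra_functional_bound. Qed.
Let M_D f g C C' k : weight_dom f C -> weight_dom g C' -> M (fun y => f y + k * g y) = M f + k * M g.
Proof. exact: (ultra_functionalD L_bound L_D UU). Qed.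

Lemma cvg_powlog b n : 1 < b -> (fun t => L t (powlog b n)) @ F --> M (powlog b n).
Proof.
move=> b1; have [C wC] := weight_dom_powlog n b1.
apply: (cvg_of_ultra FF (fun t => L_bound t wC)) => V VV FV.
have v := vanishes_line (fun f C => @ultra_difference_bound _ _ _ _ _ L_bound U V UU VV f C)
  (fun f g C C' k => @ultra_differenceD _ _ _ _ _ L_bound L_D U V UU VV f g C C' k) b01 b1 (vanish VV FV).
by apply/esym/eqP; rewrite -subr_eq0; apply/eqP; exact: v.
Qed.

Lemma cvg_sum0 N (f : nat -> I -> R) : (forall j, f j @ F --> (0 : R)) -> (fun t => \sum_(j < N) f j t) @ F --> (0 : R).
Proof.
move=> f0; elim: N => [|N IH].
  by have -> : (fun t => \sum_(j < 0) f j t) = cst 0; [apply/funext => t; rewrite big_ord0|exact: cvg_cst].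
have -> : (fun t => \sum_(j < N.+1) f j t) = (fun t => \sum_(j < N) f j t) \+ f N.
  by apply/funext => t; rewrite big_ord_recr.
by rewrite -[X in _ --> X]addr0; apply: cvgD.
Qed.

(** Finitely many Taylor coefficients are compared, and each functional contributes a tail of at
    most [2 * (|s - b| / dl) ^ N]. The bound sees [s] only through its distance to [b], hence the
    uniformity. *)
Lemma complex_extension_diff_le (Lam Lam' : (R -> R) -> R) b dl N (s : R[i]) :
  (forall f C, weight_dom f C -> `|Lam f| <= 1 * C) ->
  (forall f g C C' k, weight_dom f C -> weight_dom g C' -> Lam (fun y => f y + k * g y) = Lam f + k * Lam g) ->
  (forall f C, weight_dom f C -> `|Lam' f| <= 1 * C) ->
  (forall f g C C' k, weight_dom f C -> weight_dom g C' -> Lam' (fun y => f y + k * g y) = Lam' f + k * Lam' g) ->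
  1 < b -> 0 < dl < b - 1 -> cnorm (s - b%:C) <= dl -> 1 <= complex.Re s ->
  cnorm (complex_extension Lam (cpow0 s) - complex_extension Lam' (cpow0 s)) <=
  \sum_(j < N) dl ^+ j * `|Lam (powlog b j) - Lam' (powlog b j)| + 4 * (cnorm (s - b%:C) / dl) ^+ N.
Proof.
move=> Lb LD Lb' LD' b1 /andP[d0 db] sd s1; set z := s - b%:C in sd *.
have zb : cnorm z < b - 1 by exact: le_lt_trans db.
have e0 : 0 < b - 1 - dl by rewrite subr_gt0.
have de : dl + (b - 1 - dl) <= b - 1 by rewrite addrC subrK.
rewrite (complex_extension_cpow0 Lb LD b1 zb s1) (complex_extension_cpow0 Lb' LD' b1 zb s1).
rewrite (complex_extension_expand Lb LD 0 N b1 zb) (complex_extension_expand Lb' LD' 0 N b1 zb).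
have r1 := complex_extension_rem Lb 0 N d0 e0 de sd.
have r2 := complex_extension_rem Lb' 0 N d0 e0 de sd.
rewrite fact0 expr0 divr1 !mul1r in r1 r2.
rewrite opprD addrACA -sumrB.
apply: le_trans (cnormD _ _) _; apply: lerD; last first.
  apply: le_trans (cnormD _ _) _; rewrite cnormN.
  by apply: le_trans (lerD r1 r2) _; rewrite -mulrDl -natrD.
elim/big_ind2: _ => [|u v u' v' h h'|j _].
- by rewrite -[0]/(0%:C) cnorm_real normr0.
- by apply: le_trans (cnormD _ _) _; exact: lerD.
rewrite add0n -mulrBr -raddfB cnormM cnorm_real ler_wpM2r//.
rewrite cnormM cnormX -[leRHS]mulr1 ler_pM ?cnorm_ge0 ?exprn_ge0 ?cnorm_ge0//.
  by rewrite lerXn2r ?nnegrE ?cnorm_ge0 ?(ltW d0).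
rewrite /cnorm Normc.normcV -/(cnorm _) -[_%:R](rmorph_nat (@real_complex R)) cnorm_real.
by rewrite invf_le1 normr_nat ?ler1n ?ltr0n fact_gt0.
Qed.

Lemma cvg_uniform_complex_extension (s : R[i]) : 1 < complex.Re s ->
  exists2 r, 0 < r & forall e, 0 < e -> \forall t \near F, forall w : R[i], cnorm (w - s) < r -> 1 < complex.Re w ->
    cnorm (complex_extension (L t) (cpow0 w) - complex_extension M (cpow0 w)) < e.
Proof.
move=> s1; have [b b1 sb] := disc_cover s1.
pose r0 := cnorm (s - b%:C); have r00 : 0 <= r0 by exact: cnorm_ge0.
have {}sb : r0 < b - 1 by [].
(* [r0 + r] is the midpoint of [r0] and [b - 1], and [dl] that of [r0 + r] and [b - 1]. The ball of
   radius [r] about [s] then lies in a disc about [b] on which the ratio [th] is below 1. *)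
pose dl := (r0 + 3 * (b - 1)) / 4; pose r := (b - 1 - r0) / 2.
have dl0 : 0 < dl by rewrite /dl; lra.
have dlb : dl < b - 1 by rewrite /dl; lra.
pose th := (r0 + r) / dl.
have th0 : 0 <= th by rewrite divr_ge0// ?(ltW dl0)// /r; lra.
have th1 : th < 1 by rewrite ltr_pdivrMr// mul1r /r /dl; lra.
exists r; first by rewrite /r; lra.
move=> e e0.
have [N HN] : exists N : nat, 4 * th ^+ N < e / 2.
  have c : (fun N => 4 * th ^+ N) @ \oo --> (0 : R).
    by rewrite -[X in _ --> X](mulr0 4); apply: cvgMr; apply: cvg_expr; rewrite ger0_norm.
  have e2 : 0 < e / 2 by rewrite divr_gt0.
  move/cvgrPdist_lt/(_ _ e2): c => [N _ H]; exists N.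
  have := H N (leqnn N); rewrite /= sub0r normrN ger0_norm// mulr_ge0// exprn_ge0//.
have cS : (fun t => \sum_(j < N) dl ^+ j * `|L t (powlog b j) - M (powlog b j)|) @ F --> (0 : R).
  apply: (@cvg_sum0 N (fun j t => dl ^+ j * `|L t (powlog b j) - M (powlog b j)|)) => j.
  rewrite -[X in _ --> X](mulr0 (dl ^+ j)); apply: cvgMr.
  rewrite -(normr0 R) -(subrr (M (powlog b j))); apply: cvg_norm; apply: cvgB; last exact: cvg_cst.
  exact: cvg_powlog.
have e2 : 0 < e / 2 by rewrite divr_gt0.
move/cvgrPdist_lt/(_ _ e2): cS; apply: filterS => t /=.
rewrite sub0r normrN => Ht w ws w1.
have wb : cnorm (w - b%:C) <= r0 + r.
  have -> : w - b%:C = (s - b%:C) + (w - s) by ring.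
  by apply: le_trans (cnormD _ _) _; rewrite lerD2l ltW.
have wd : cnorm (w - b%:C) <= dl by apply: le_trans wb _; rewrite /r /dl; lra.
have dd : 0 < dl < b - 1 by rewrite dl0 dlb.
apply: le_lt_trans (complex_extension_diff_le N (@L_bound t) (@L_D t) M_bound M_D b1 dd wd (ltW w1)) _.
rewrite [ltRHS]splitr; apply: ltrD; first exact: le_lt_trans (ler_norm _) Ht.
have c0 : 0 <= cnorm (w - b%:C) / dl by rewrite mulr_ge0 ?cnorm_ge0 ?invr_ge0 ?(ltW dl0).
have cth : cnorm (w - b%:C) / dl <= th by rewrite ler_wpM2r ?invr_ge0 ?(ltW dl0).
by apply: le_lt_trans HN; rewrite ler_wpM2l// lerXn2r.
Qed.

Lemma cvg_locally_uniformly_extension (f : I -> R[i]^o -> R[i]^o) :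
  (\forall t \near F, forall s : R[i], 1 < complex.Re s -> f t s = complex_extension (L t) (cpow0 s)) ->
  forall z : R[i]^o, [set s : R[i]^o | 1 < complex.Re s] z ->
  exists2 U : set R[i]^o, nbhs z U &
    {uniform U `&` [set s : R[i]^o | 1 < complex.Re s], f t @[t --> F] --> (fun s => complex_extension M (cpow0 s) : R[i]^o)}.
Proof.
move=> Hf z z1; have [r r0 H] := cvg_uniform_complex_extension z1.
exists (ball (z : R[i]^o) (r%:C : R[i])).
  by apply: nbhsx_ballx; rewrite ltcR.
move=> A /uniform_nbhs [E [EE EA]].
move: EE; rewrite -entourage_ballE => -[e /= e0 eE].
move: e0; rewrite ltcE/= => /andP[/eqP ei e0].
near=> t; apply: EA => w [zw w1]; apply: eE; rewrite /= /ball/=.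
have -> : f t w = complex_extension (L t) (cpow0 w).
  by move: w w1 {zw}; near: t; exact: Hf.
rewrite distrC norm_complexE ltcE/= ei eqxx/=.
have : forall w : R[i], cnorm (w - z) < r -> 1 < complex.Re w ->
    cnorm (complex_extension (L t) (cpow0 w) - complex_extension M (cpow0 w)) < complex.Re e.
  by near: t; exact: H.
apply => //; move: zw; rewrite /ball/= distrC norm_complexE ltcE/=.
by case/andP.
Unshelve. all: by end_near. Qed.
End uniform_limits.

Lemma iid_weighted_capped d (T : measurableType d) (R : realType) (P : probability T R)
    (W : nat -> {RV P >-> R}) (X : {RV P >-> R}) (Xs : nat -> {RV P >-> R}) :
  (forall j, distribution P (Xs j) = distribution P X) -> mutually_independent P Xs ->
  independent_families P W Xs ->
  iid_weighted P (capped W) Xs X.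
Proof.
move=> XE iX WX.
have mc j : measurable_fun setT (capped W j).
  by apply: measurable_capped => k.
(* Capped weights stay measurable for the sigma-algebra of [W], so its independence from the
   summands carries over to them. *)
have mc' j : measurable_fun setT (capped W j : g_sigma_algebraType (family_gen W) -> R).
  by apply: (@measurable_capped R _ (g_sigma_algebraType (family_gen W))) => k; exact: measurable_family.
have mXs' j : measurable_fun setT (Xs j : g_sigma_algebraType (family_gen Xs) -> R).
  exact: measurable_family.
split => //.
- by move=> j w; exact: capped_ge0.
- by move=> n w; rewrite -capped_sumE; exact: capped_sum_le1.
- move=> j s f s0 mf f0.
  rewrite (integral_independent_families WX); first last.
  + by move=> w; exact: f0.
  + by move=> w; exact: powR_ge0.
  + exact: (measurableT_comp mf (mXs' j)).
  + exact: (measurableT_comp (measurable_powR s) (mc' j)).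
  + exact: (measurableT_comp mf).
  + exact: (measurableT_comp (measurable_powR s) (mc j)).
  by rewrite (integral_same_distribution (XE j)).
- move=> i j f g ij mf mg f0 g0.
  rewrite (integral_independent_families WX); first last.
  + by move=> w; rewrite mulr_ge0.
  + by move=> w; rewrite mulr_ge0 ?capped_ge0.
  + apply: measurable_funM; first exact: (measurableT_comp mf (mXs' i)).
    exact: (measurableT_comp mg (mXs' j)).
  + exact: measurable_funM (mc' i) (mc' j).
  + by apply: measurable_funM; exact: measurableT_comp.
  + exact: measurable_funM.
  rewrite (integral_mutually_independent iX ij mf mg f0 g0).
  by rewrite (integral_same_distribution (XE i))// (integral_same_distribution (XE j)).
Qed.

(** * Abscissae and absolute moments *)

Section moments.
Context d (T : measurableType d) (R : realType) (P : probability T R).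
Local Open Scope ereal_scope.

Lemma lt_abscissa (Y : T -> R) (s : R) : measurable_fun setT Y -> (forall w, 0 <= Y w)%R ->
  (0 < s)%R -> s%:E < abscissa P Y -> \int[P]_w (Y w `^ s)%:E < +oo.
Proof.
move=> mY Y0 s0; rewrite /abscissa lt_max => /orP[]; first by rewrite lte_fin ltNge (ltW s0).
move=> /ereal_sup_gt[_ [q [q0 Yq] <-]]; rewrite lte_fin => sq.
move: Yq; rewrite unlock => Yq.
apply: (le_lt_trans (moment_le1D P mY Y0 s0 (ltW sq))).
by rewrite lte_add_pinfty// ltry.
Qed.

Lemma abscissa_ge (Y : T -> R) (s : R) : (0 < s)%R -> \int[P]_w (Y w `^ s)%:E < +oo -> s%:E <= abscissa P Y.
Proof.
move=> s0 Ys; rewrite /abscissa le_max; apply/orP; right.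
by apply: ereal_sup_ubound; exists s => //; split => //; rewrite unlock.
Qed.

Variable X : T -> R.
Hypothesis mX : measurable_fun setT X.

Let mXp : measurable_fun setT (X^\+)%R. Proof. exact: measurable_funrpos. Qed.
Let mXn : measurable_fun setT (X^\-)%R. Proof. exact: measurable_funrneg. Qed.

Lemma lt_moment_abscissa (s : R) : (0 < s)%R -> s%:E < moment_abscissa P X ->
  exists k : R, \int[P]_w (`|X w| `^ s)%:E = k%:E.
Proof.
move=> s0; rewrite /moment_abscissa lt_min => /andP[hp hn].
have i1 := lt_abscissa mXp (funrpos_ge0 X) s0 hp.
have i2 := lt_abscissa mXn (funrneg_ge0 X) s0 hn.
have mp (Y : T -> R) : measurable_fun setT Y -> measurable_fun setT (fun w => (Y w `^ s)%:E).
  by move=> mY; apply/measurable_EFinP; exact: (measurableT_comp (measurable_powR s)).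
have [mp1 mp2] := (mp _ mXp, mp _ mXn).
have p1 w : [set: T] w -> 0 <= ((X^\+ w)%R `^ s)%:E by rewrite lee_fin powR_ge0.
have p2 w : [set: T] w -> 0 <= ((X^\- w)%R `^ s)%:E by rewrite lee_fin powR_ge0.
have fin : \int[P]_w (`|X w| `^ s)%:E < +oo.
  apply: (@le_lt_trans _ _ (\int[P]_w (((X^\+ w)%R `^ s)%:E + ((X^\- w)%R `^ s)%:E))); last first.
    rewrite (ge0_integralD P measurableT p1 mp1 p2 mp2).
    by apply: lte_add_pinfty; [exact: i1|exact: i2].
  apply: ge0_le_integral => //.
  - by apply: mp; exact: (measurableT_comp (@normr_measurable R setT)).
  - by exact: emeasurable_funD.
  - move=> w _; rewrite -EFinD lee_fin /funrpos /funrneg.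
    have [h|h] := leP 0%R (X w).
      by rewrite ger0_norm// lerDl powR_ge0.
    by rewrite ltr0_norm// (max_l (_ : 0 <= - X w)%R) ?oppr_ge0 ?(ltW h)// lerDr powR_ge0.
exists (fine (\int[P]_w (`|X w| `^ s)%:E)).
by rewrite fineK// ge0_fin_numE// integral_ge0// => w _; rewrite lee_fin powR_ge0.
Qed.

Lemma gt_moment_abscissa (s : R) : (0 < s)%R -> moment_abscissa P X < s%:E ->
  \int[P]_w (`|X w| `^ s)%:E = +oo.
Proof.
move=> s0 Xs; apply: contraPP Xs => /eqP; rewrite -ltey => fin; apply/negP; rewrite -leNgt.
have mp (Y : T -> R) : measurable_fun setT Y -> measurable_fun setT (fun w => (Y w `^ s)%:E).
  by move=> mY; apply/measurable_EFinP; exact: (measurableT_comp (measurable_powR s)).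
have le (Y : T -> R) : measurable_fun setT Y -> (forall w, 0 <= Y w <= `|X w|)%R -> \int[P]_w (Y w `^ s)%:E < +oo.
  move=> mY YX; apply: le_lt_trans fin; apply: ge0_le_integral => //.
  - by move=> w _; rewrite lee_fin powR_ge0.
  - exact: mp.
  - by apply: mp; exact: (measurableT_comp (@normr_measurable R setT)).
  - move=> w _; rewrite lee_fin; have /andP[h1 h2] := YX w.
    by rewrite ge0_ler_powR ?nnegrE// ltW.
rewrite /moment_abscissa le_min; apply/andP; split; apply: (abscissa_ge s0).
  apply: (le _ mXp) => w.
  by rewrite funrpos_ge0 /funrpos ge_max ler_norm normr_ge0.
apply: (le _ mXn) => w.
by rewrite funrneg_ge0 /funrneg ge_max -normrN ler_norm normr_ge0.
Qed.
End moments.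

(** Truncate at a level [n] and subtract the mean [b]. Since [X] is centered, [|b|] is at most the
    expectation of [|X|] on [|X| > n], so recentering costs no more than truncating, and both costs
    vanish as [n] grows. *)
Lemma centered_truncation d (T : measurableType d) (R : realType) (P : probability T R) (X : T -> R) (k1 e : R) :
  measurable_fun setT X -> (\int[P]_w `|X w|%:E = k1%:E)%E -> \int[P]_w X w = 0 -> 0 < e ->
  exists (y : R -> R) (v zeta : R), [/\ measurable_fun setT y,
    P.-integrable setT (EFin \o (fun w => y (X w))), \int[P]_w y (X w) = 0,
    (\int[P]_w (y (X w) ^+ 2)%:E = v%:E)%E &
    (\int[P]_w `|X w - y (X w)|%:E = zeta%:E)%E /\ zeta < e].
Proof.
move=> mX k1E EX e0.
have mabs : measurable_fun setT (fun u : R => `|u|) by exact: normr_measurable.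
have mle n : measurable_fun setT (fun u : R => `|u| <= n%:R) by exact: measurable_fun_ler.
pose g n (u : R) : R := if `|u| <= n%:R then u else 0.
pose h n (u : R) : R := if `|u| <= n%:R then 0 else `|u|.
have mg n : measurable_fun setT (g n) by exact: measurable_fun_ifT.
have mh n : measurable_fun setT (h n) by exact: measurable_fun_ifT.
have gh n u : `|u - g n u| = h n u by rewrite /g /h; case: ifP; rewrite ?subrr ?normr0 ?subr0.
have h0 n u : 0 <= h n u by rewrite -gh.
have hle n u : h n u <= `|u| by rewrite /h; case: ifP.
have Xi : P.-integrable setT (EFin \o (fun w => `|X w|)).
  apply/integrableP; split; first by apply/measurable_EFinP; exact: (measurableT_comp mabs).
  by under eq_integral do rewrite /= normr_id; rewrite k1E ltry.
have Xi' : P.-integrable setT (EFin \o X).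
  apply/integrableP; split; first exact/measurable_EFinP.
  by rewrite /= k1E ltry.
have [] := @dominated_convergence _ _ _ P setT measurableT (fun n w => (h n (X w))%:E) (cst 0%E) (fun w => `|X w|%:E).
- by move=> n; apply/measurable_EFinP; exact: (measurableT_comp (mh n)).
- exact: measurable_cst.
- apply: aeW => w _; apply: cvg_near_cst.
  exists (Num.truncn `|X w|).+1 => // n /= nX; rewrite /h ifT//.
  by apply: ltW; apply: lt_le_trans (truncnS_gt _) _; rewrite ler_nat.
- exact: Xi.
- by apply: aeW => w n _; rewrite /= lee_fin ger0_norm.
move=> _ _; rewrite integral0 => hc.
have fin n : (\int[P]_w (h n (X w))%:E = (\int[P]_w h n (X w))%:E)%E.
  rewrite /Rintegral fineK// ge0_fin_numE; last by apply: integral_ge0 => w _; rewrite lee_fin.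
  apply: (@le_lt_trans _ _ k1%:E); last exact: ltry.
  rewrite -k1E; apply: ge0_le_integral => //.
  - by move=> w _; rewrite lee_fin.
  - by apply/measurable_EFinP; exact: (measurableT_comp (mh n)).
  - by apply/measurable_EFinP; exact: (measurableT_comp mabs).
  - by move=> w _; rewrite lee_fin.
have {hc} hc : (fun n => \int[P]_w h n (X w)) @ \oo --> 0.
  by move/fine_cvgP: hc => [_ hc]; exact: hc.
have e2 : 0 < e / 2 by rewrite divr_gt0.
move/cvgrPdist_lt/(_ _ e2) : hc => [n _ /(_ n (leqnn n))]; rewrite /= sub0r normrN => hn.
pose b := \int[P]_w g n (X w).
have mgX : measurable_fun setT (fun w => g n (X w)) by exact: (measurableT_comp (mg n)).
have mhX : measurable_fun setT (fun w => h n (X w)) by exact: (measurableT_comp (mh n)).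
have mX' : measurable_fun setT (fun w => `|X w|) by exact: (measurableT_comp mabs).
have gle u : `|g n u| <= n%:R by rewrite /g; case: ifP => //; rewrite normr0.
have gi : P.-integrable setT (EFin \o (fun w => g n (X w))).
  by apply: (integrable_dom mgX mX' _ k1E) => w; rewrite /g; case: ifP => //; rewrite normr0.
have bE : `|b| <= \int[P]_w h n (X w).
  have -> : b = \int[P]_w (g n (X w) + -1 * X w) by rewrite RintegralDZ// EX mulr0 addr0.
  apply: (Rintegral_dom _ mhX _ (fin n)).
    by apply: measurable_funD => //; exact: measurable_funM.
  by move=> w; rewrite mulN1r distrC gh.
have my : measurable_fun setT (fun u => g n u - b) by exact: measurable_funB.
have myX : measurable_fun setT (fun w => g n (X w) - b) by exact: (measurableT_comp my).
have yle u : `|g n u - b| <= n%:R + `|b| by apply: le_trans (ler_normB _ _) _; rewrite lerD2r.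
have [yi yE] := fin_int_bounded P myX (fun w => yle (X w)).
have my2 : measurable_fun setT (fun w => (g n (X w) - b) ^+ 2) by exact: measurable_funX.
have [|_ y2E] := @fin_int_bounded _ _ _ P (fun w => (g n (X w) - b) ^+ 2) ((n%:R + `|b|) ^+ 2) my2.
  by move=> w; rewrite normrX lerXn2r ?nnegrE ?addr_ge0.
have mz : measurable_fun setT (fun w => `|X w - (g n (X w) - b)|).
  by apply: (measurableT_comp mabs); exact: measurable_funB.
have zle : (\int[P]_w `|X w - (g n (X w) - b)|%:E <= (\int[P]_w h n (X w) + `|b|)%:E)%E.
  rewrite EFinD -fin -[X in (_ + X)%E](integral_prob_cst P) -ge0_integralD//; last 2 first.
  - by move=> w _; rewrite lee_fin.
  - exact/measurable_EFinP.
  apply: ge0_le_integral => //.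
  - exact/measurable_EFinP.
  - by apply: emeasurable_funD => //; exact/measurable_EFinP.
  - by move=> w _; rewrite -EFinD lee_fin opprB addrA -gh addrAC ler_normD.
exists (fun u => g n u - b), (\int[P]_w (g n (X w) - b) ^+ 2), (fine (\int[P]_w `|X w - (g n (X w) - b)|%:E)).
split => //.
- transitivity (\int[P]_w (g n (X w) + (- b) * 1)).
    by apply: eq_Rintegral => w _; rewrite mulr1.
  have [|i1 _] := @fin_int_bounded _ _ _ P (fun=> 1) 1 (@measurable_cst _ _ _ _ _ _).
    by move=> w; rewrite normr1.
  rewrite (RintegralDZ (- b) gi i1).
  by rewrite /Rintegral integral_prob_cst/= mulr1 subrr.
have zfin : (\int[P]_w `|X w - (g n (X w) - b)|%:E \is a fin_num)%E.
  rewrite ge0_fin_numE; last by apply: integral_ge0 => w _; rewrite lee_fin.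
  by apply: le_lt_trans zle _; exact: ltry.
split; first by rewrite fineK.
rewrite -lte_fin fineK//; apply: le_lt_trans zle _; rewrite lte_fin [ltRHS]splitr.
have hn' := le_lt_trans (ler_norm _) hn.
by apply: ltrD => //; exact: le_lt_trans hn'.
Qed.

(** * Vanishing weights force a degenerate limit *)

Section degenerate_limits.
Context d (T : measurableType d) (R : realType) (P : probability T R).
Context d' (T' : measurableType d') (P' : probability T' R).
Variables (I : Type) (F : set_system I).
Hypothesis FF : ProperFilter F.
Variables (p : I -> nat -> T -> R) (x : nat -> T -> R) (X : T -> R) (Z : I -> T -> R) (Y : T' -> R).
Hypothesis HW : forall t, iid_weighted P (p t) x X.
Hypothesis ZE : forall t, {ae P, forall w, Z t w = weighted_sum (p t) x w}.
Hypothesis mY : measurable_fun setT Y.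
Hypothesis Zlim : forall f : R -> R, continuous f -> bounded_fun f ->
  (fun t => \int[P]_w f (Z t w)) @ F --> \int[P']_w f (Y w).
Variables (k1 : R).
Hypotheses (mX : measurable_fun setT X) (k1E : (\int[P]_w `|X w|%:E = k1%:E)%E) (EX : \int[P]_w X w = 0).

(** A bounded continuous function that vanishes at 0 only, hence a test for the limit being 0. *)
Let f (y : R) : R := Num.min `|y| 1.
Let cf : continuous f.
Proof. by move=> y; apply: continuous_min; [exact: norm_continuous|exact: cvg_cst]. Qed.
Let f0 y : 0 <= f y. Proof. by rewrite le_min normr_ge0 ler01. Qed.
Let f1 y : `|f y| <= 1. Proof. by rewrite ger0_norm// ge_min lexx orbT. Qed.

Lemma ae_eq0_of_small : (forall e, 0 < e -> \forall t \near F, \int[P]_w f (Z t w) <= e) ->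
  {ae P', forall w, Y w = 0}.
Proof.
move=> H.
have bf : bounded_fun f.
  by exists 1; split; [exact: num_real|move=> B B1 y _; apply: le_trans (f1 y) (ltW B1)].
have mf : measurable_fun setT (fun w => f (Y w)).
  by apply: measurableT_comp => //; exact: continuous_measurable_fun.
have [_ fE] := fin_int_bounded P' mf (fun w => f1 (Y w)).
have fY : \int[P']_w f (Y w) = 0.
  apply/eqP; rewrite eq_le Rintegral_ge0// andbT; apply/ler_addgt0Pr => e e0; rewrite add0r.
  have c := Zlim cf bf; rewrite -(cvg_lim _ c)//.
  by apply: limr_le; [exact: cvgP c|exact: H].
have : (\int[P']_w `|(f (Y w))%:E| = 0)%E.
  by under eq_integral do rewrite gee0_abs ?lee_fin//; rewrite fE fY.
have mf' : measurable_fun setT (fun w => (f (Y w))%:E) by exact/measurable_EFinP.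
move/(ae_eq_integral_abs _ measurableT mf').
apply: filterS => w /(_ Logic.I); rewrite /= => -[] h; apply/eqP; rewrite -normr_eq0.
have [h1|h1] := leP `|Y w| 1; move: h; rewrite /f.
  by rewrite min_l// => ->.
by rewrite min_r ?(ltW h1)// => /eqP; rewrite oner_eq0.
Qed.

Let L t := weight_functional P (p t).

Lemma expectation_min_le t (y : R -> R) (v zeta theta : R) :
  measurable_fun setT y -> P.-integrable setT (EFin \o (fun w => y (X w))) ->
  \int[P]_w y (X w) = 0 -> (\int[P]_w (y (X w) ^+ 2)%:E = v%:E)%E ->
  (\int[P]_w `|X w - y (X w)|%:E = zeta%:E)%E -> 0 < theta ->
  \int[P]_w f (Z t w) <= zeta + theta + v / theta * L t (fun u => u `^ 2).
Proof.
move=> my yi y0 yv yz th0.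
have [c1 _] := cvg_expectation_partial_sum (HW t) k1E cf f1 (ZE t).
have c2 := cvg_weight_functional (HW t) (weight_dom_powR (ler1n _ 2)).
have c3 : (fun n => zeta + theta + v / theta * \sum_(j < n) \int[P]_w (p t j w `^ 2)) @ \oo -->
    zeta + theta + v / theta * L t (fun u => u `^ 2).
  by apply: cvgD; [exact: cvg_cst|apply: cvgMr].
rewrite -(cvg_lim _ c1)// -(cvg_lim _ c3)//; apply: ler_lim.
- exact: cvgP c1.
- exact: cvgP c3.
- by apply: nearW => n; exact: (small_partial_sum (HW t) n my yi y0 yv yz th0).
Qed.

(** For [y <= theta] the square is at most [theta * y], and the weights have mean mass at most 1;
    for larger [y] in the unit interval, [y ^ 2 <= 1 <= (y / theta) ^ q]. *)
Lemma weight_functional_sqr_le t (q theta : R) : 1 <= q -> 0 < theta ->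
  L t (fun u => u `^ 2) <= theta + theta `^ (- q) * L t (fun u => u `^ q).
Proof.
move=> q1 th0.
have d1 := weight_dom_powR (lexx (1 : R)); have dq := weight_dom_powR q1.
have d2 : weight_dom (fun u : R => u `^ 2) 1 by apply: weight_dom_powR; rewrite ler1n.
have LD := weight_functionalD (HW t).
have l1 := weight_functional_bound (HW t) d1.
apply: (@le_trans _ _ (theta * L t (fun u => u `^ 1) + theta `^ (- q) * L t (fun u => u `^ q))); last first.
  by rewrite lerD2r ler_piMr ?(ltW th0)//; apply: le_trans (ler_norm _) l1.
(* Linearity is stated for [f + k * g] only, so the combination is built up from the zero
   function. *)
have z0 : weight_dom (fun _ : R => 0 : R) 0.
  by split => // y _; rewrite normr0 mul0r.
have e1 := LD _ _ _ _ theta z0 d1.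
have L0 : L t (fun=> 0) = 0.
  by apply/eqP; rewrite -normr_le0; have := weight_functional_bound (HW t) z0.
have e2 := LD _ _ _ _ (theta `^ (- q)) (weight_domD theta z0 d1) dq.
have e3 := LD _ _ _ _ (-1) (weight_domD (theta `^ (- q)) (weight_domD theta z0 d1) dq) d2.
have := weight_functional_ge0 (HW t) (weight_domD (-1) (weight_domD (theta `^ (- q)) (weight_domD theta z0 d1) dq) d2).
rewrite e3 e2 e1 -/(L t) L0 add0r mulN1r subr_ge0; apply.
move=> y /andP[y0 y1]; rewrite add0r mulN1r subr_ge0 powRr1//.
have [yt|ty] := leP y theta.
  rewrite (_ : y `^ 2 = y * y); last by rewrite -[2]/(2%:R) powR_mulrn// expr2.
  apply: (@le_trans _ _ (theta * y)); first by rewrite ler_wpM2r.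
  by rewrite lerDl mulr_ge0 ?powR_ge0.
apply: (@le_trans _ _ 1).
  by apply: (le_trans _ y1); apply: powR_le_id; rewrite ?ler1n ?y0 ?y1.
apply: (@le_trans _ _ (theta `^ (- q) * y `^ q)); last by rewrite lerDr mulr_ge0// ltW.
rewrite -[leLHS](_ : theta `^ (- q) * theta `^ q = 1).
  rewrite ler_wpM2l ?powR_ge0// ge0_ler_powR ?nnegrE ?(ltW th0) ?(ltW ty)//.
  exact: le_trans ler01 q1.
by rewrite powRN mulVf// gt_eqF// powR_gt0.
Qed.

Lemma degenerate_weights (q : R) : 1 <= q -> (fun t => L t (fun u => u `^ q)) @ F --> (0 : R) ->
  {ae P', forall w, Y w = 0}.
Proof.
move=> q1 L0; apply: ae_eq0_of_small => e e0.
(* One quarter each goes to the truncation error, to the parameter of [expectation_min_le], to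
   [c * th], and to the multiple of the moment of order [q]. *)
have e3 : 0 < e / 4 by rewrite divr_gt0.
have [y [v [zeta [my yi y0 yv [yz ze]]]]] := centered_truncation mX k1E EX e3.
have v0 : 0 <= v.
  by rewrite -lee_fin -yv; apply: integral_ge0 => w _; rewrite lee_fin sqr_ge0.
pose c := v / (e / 4); have c0 : 0 <= c by rewrite divr_ge0// ltW.
pose th := e / 4 / (c + 1); have th0 : 0 < th by rewrite divr_gt0// ltr_wpDl.
have cth : c * th <= e / 4.
  by rewrite /th mulrCA ler_piMr ?(ltW e3)// ler_pdivrMr ?ltr_wpDl// mul1r lerDl.
pose K := c * th `^ (- q).
have : (fun t => K * L t (fun u => u `^ q)) @ F --> (0 : R).
  by rewrite -[X in _ --> X](mulr0 K); exact: cvgMr.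
move/cvgrPdist_lt/(_ _ e3); apply: filterS => t; rewrite sub0r normrN => /ltW Ht.
have K1 := le_trans (ler_norm _) Ht.
apply: le_trans (expectation_min_le t my yi y0 yv yz e3) _.
have s1 : c * L t (fun u => u `^ 2) <= e / 4 + e / 4.
  apply: (@le_trans _ _ (c * th + K * L t (fun u => u `^ q))); last exact: lerD.
  by rewrite /K -mulrA -mulrDr ler_wpM2l// weight_functional_sqr_le.
rewrite [leRHS](_ : e = (e / 4 + e / 4) + (e / 4 + e / 4)); last by field.
by apply: lerD => //; rewrite lerD2r ltW.
Qed.

Lemma degenerate_variance : (\int[P]_w (X w ^+ 2)%:E = 0%:E)%E -> {ae P', forall w, Y w = 0}.
Proof.
move=> X2; apply: ae_eq0_of_small => e e0; apply: nearW => t.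
have Xi : P.-integrable setT (EFin \o (fun w => X w)).
  by apply/integrableP; split; [exact/measurable_EFinP|rewrite /= k1E ltry].
have z0 : (\int[P]_w `|X w - X w|%:E = 0%:E)%E.
  by under eq_integral do rewrite subrr normr0; rewrite integral0.
apply: le_trans (expectation_min_le t (y := id) _ Xi EX X2 z0 e0) _ => //.
by rewrite !mul0r add0r addr0.
Qed.
End degenerate_limits.

Lemma complex_extension_real (R : realType) (Lam : (R -> R) -> R) (B s : R) :
  (forall f C, weight_dom f C -> `|Lam f| <= B * C) ->
  (forall f g C C' k, weight_dom f C -> weight_dom g C' -> Lam (fun y => f y + k * g y) = Lam f + k * Lam g) ->
  1 < s -> complex_extension Lam (cpow0 s%:C) = (Lam (fun y => y `^ s))%:C.
Proof.
move=> Lb LD s1.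
have [C wC] := weight_dom_powlog 0 s1.
have s0 : s != 0 by rewrite gt_eqF// (lt_trans ltr01).
have c0 := @weight_dom_cpow0 R s%:C (ltW s1).
rewrite (complex_extension_ext Lb LD c0 (cweight_dom_real wC)); last first.
  by move=> y /andP[y0 _]; rewrite cpow0_real// /powlog expr0 mulr1.
rewrite (complex_extension_powlog Lb)//; congr (_%:C); congr Lam.
by apply/funext => y; rewrite /powlog expr0 mulr1.
Qed.

(** * Limits of the power moments *)

Section moment_limits.
Context d (T : measurableType d) (R : realType) (P : probability T R).
Context d' (T' : measurableType d') (P' : probability T' R).
Variables (I : Type) (F : set_system I).
Hypothesis FF : ProperFilter F.
Variables (p : I -> nat -> T -> R) (x : nat -> T -> R) (X : T -> R) (Z : I -> T -> R) (Y : T' -> R).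
Hypothesis HW : forall t, iid_weighted P (p t) x X.
Hypothesis ZE : forall t, {ae P, forall w, Z t w = weighted_sum (p t) x w}.
Hypothesis mY : measurable_fun setT Y.
Hypothesis Zlim : forall f : R -> R, continuous f -> bounded_fun f ->
  (fun t => \int[P]_w f (Z t w)) @ F --> \int[P']_w f (Y w).
Hypothesis Ynd : ~ {ae P', forall w, Y w = 0}.
Variables (k1 : R).
Hypotheses (mX : measurable_fun setT X) (k1E : (\int[P]_w `|X w|%:E = k1%:E)%E) (EX : \int[P]_w X w = 0).
Variable m : I -> R[i] -> R[i]^o.
Let L t := weight_functional P (p t).
Hypothesis mE : \forall t \near F, forall s : R[i], 1 < complex.Re s -> m t s = complex_extension (L t) (cpow0 s).

Let Zcvg f : continuous f -> bounded_fun f -> cvg ((fun t => \int[P]_w f (Z t w)) @ F).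
Proof. by move=> cf bf; exact: cvgP (Zlim cf bf). Qed.

Let L_bound t f C : weight_dom f C -> `|L t f| <= 1 * C.
Proof. by move=> h; rewrite mul1r; exact: (weight_functional_bound (HW t)). Qed.

Let L_D t f g C C' k : weight_dom f C -> weight_dom g C' ->
  L t (fun y => f y + k * g y) = L t f + k * L t g.
Proof. exact: (weight_functionalD (HW t)). Qed.

Lemma moment_limit_gt0 (s c : R) : 1 < s -> (fun t => L t (fun y => y `^ s)) @ F --> c -> 0 < c <= 1.
Proof.
move=> s1 Lc; have ws := weight_dom_powR (ltW s1).
have c0 : 0 <= c.
  rewrite -(cvg_lim _ Lc)//; apply: limr_ge; first exact: cvgP Lc.
  by apply: nearW => t; apply: (weight_functional_ge0 (HW t) ws) => y _; exact: powR_ge0.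
have c1 : c <= 1.
  rewrite -(cvg_lim _ Lc)//; apply: limr_le; first exact: cvgP Lc.
  by apply: nearW => t; apply: le_trans (ler_norm _) (weight_functional_bound (HW t) ws).
rewrite c1 andbT lt_neqAle c0 andbT eq_sym; apply/eqP => c00; apply: Ynd.
move: Lc; rewrite c00 => Lc.
exact: (degenerate_weights FF HW ZE mY Zlim mX k1E EX (ltW s1) Lc).
Qed.

Lemma power_moment_limit (s c : R) : 1 < s -> (fun t => L t (fun y => y `^ s)) @ F --> c ->
  exists2 c : R, 0 < c <= 1 & (fun t => m t s%:C) @ F --> (c%:C : R[i]^o).
Proof.
move=> s1 Lc; exists c; first exact: moment_limit_gt0 Lc.
apply/cvg_complexP => e e0; near=> t.
have -> : m t s%:C = complex_extension (L t) (cpow0 s%:C).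
  have : forall s : R[i], 1 < complex.Re s -> m t s = complex_extension (L t) (cpow0 s) by near: t.
  exact.
rewrite (complex_extension_real (@L_bound t) (@L_D t) s1) -raddfB cnorm_real distrC.
by near: t; move/cvgrPdist_lt : Lc; exact.
Unshelve. all: by end_near. Qed.

(** The moment of order [s > 2] supplies the uniform integrability at order 2. The variance is
    nonzero because otherwise the limit would be 0, so one may divide by it. *)
Lemma second_moment_limit (s k : R) : 2 < s -> (\int[P]_w (`|X w| `^ s)%:E = k%:E)%E ->
  exists c : R, (fun t => L t (fun y => y `^ 2)) @ F --> c.
Proof.
move=> s2 kE.
have s0 : 0 < s by exact: lt_trans s2.
have mX2 : measurable_fun setT (fun w => X w ^+ 2) by exact: measurable_funX.
have X2fin : (\int[P]_w (X w ^+ 2)%:E <= (1 + k)%:E)%E.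
  rewrite EFinD -kE; under eq_integral do rewrite -(real_normK (num_real (X _))) -powR_mulrn//.
  apply: moment_le1D => //; last exact: ltW.
  exact: (measurableT_comp (@normr_measurable R setT)).
have [v vE] : exists v : R, (\int[P]_w (X w ^+ 2)%:E = v%:E)%E.
  exists (fine (\int[P]_w (X w ^+ 2)%:E)); rewrite fineK// ge0_fin_numE.
    by apply: le_lt_trans X2fin _; exact: ltry.
  by apply: integral_ge0 => w _; rewrite lee_fin sqr_ge0.
have v0 : v != 0.
  apply/eqP => v00; apply: Ynd.
  by apply: (degenerate_variance FF HW ZE mY Zlim mX k1E EX); rewrite vE v00.
have Xi : P.-integrable setT (EFin \o (fun w => X w)).
  by apply/integrableP; split; [exact/measurable_EFinP|rewrite /= k1E ltry].
have Hl t : (fun n => \int[P]_w `|weighted_partial_sum (p t) x n w| `^ 2) @ \oo --> v * L t (fun y => y `^ 2).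
  have c := cvg_weight_functional (HW t) (weight_dom_powR (ler1n _ 2)).
  have -> : (fun n => \int[P]_w `|weighted_partial_sum (p t) x n w| `^ 2) =
      (fun n => v * \sum_(j < n) \int[P]_w (p t j w `^ 2)).
    apply/funext => n; have [_ <-] := second_moment (HW t) (@measurable_id _ R setT) Xi EX vE n.
    apply: eq_Rintegral => w _; rewrite -[2]/(2%:R) powR_mulrn// real_normK ?num_real//.
  exact: cvgMr.
have /cvg_ex[/= l lE] := cvg_limit_moment FF HW ZE Zcvg k1E (ltr1n R 2) s2 kE Hl.
exists (v^-1 * l); have : (fun t => v^-1 * (v * L t (fun y => y `^ 2))) @ F --> v^-1 * l by exact: cvgMr.
by under eq_fun do rewrite mulKf//.
Qed.

Section finite_abscissa.
Variable a : R.
Hypotheses (a1 : 1 < a)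
  (fin_moment : forall s, 1 < s < a -> exists k, (\int[P]_w (`|X w| `^ s)%:E = k%:E)%E)
  (inf_moment : forall e : R, 0 < e -> (\int[P]_w (`|X w| `^ (a + e))%:E = +oo)%E).

Lemma abscissa_moment_limit : exists c : R, (fun t => L t (fun y => y `^ a)) @ F --> c.
Proof.
have [U [UU FU]] := ultraFilterLemma FF.
have wa := weight_dom_powR (ltW a1).
exists (ultra_functional L U (fun y => y `^ a)).
apply: (cvg_of_ultra FF (fun t => L_bound t wa)) => V VV FV.
(* At index 0 the left alternative on [K] holds, so [B] is a placeholder. *)
have := powlog_rigidity FF HW ZE Zcvg mX a1 k1E fin_moment inf_moment VV UU FV FU (k := 0) (B := 0).
have -> : powlog a 0 = (fun y => y `^ a) by apply/funext => y; rewrite /powlog expr0 mulr1.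
by move=> H; apply/eqP; rewrite -subr_eq0; apply/eqP; apply: H => //; left.
Qed.

Lemma holomorphic_moment_limit (ka : R) : (\int[P]_w (`|X w| `^ a)%:E = ka%:E)%E ->
  exists mlim : R[i]^o -> R[i]^o,
  [/\ forall z : R[i]^o, 1 < complex.Re z -> derivable mlim z 1,
      forall z : R[i]^o, [set s : R[i]^o | 1 < complex.Re s] z ->
        exists2 U : set R[i]^o, nbhs z U &
        {uniform U `&` [set s : R[i]^o | 1 < complex.Re s], (m t : R[i]^o -> R[i]^o) @[t --> F] --> mlim} &
      forall q : R, 1 < q -> 0 < (mlim q%:C : R[i])].
Proof.
move=> kaE.
have [U [UU FU]] := ultraFilterLemma FF.
(* On [|X| > 1] powers increase with the exponent, so the moment of order [a] bounds [K] up to [a].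
   This admits every index in [powlog_rigidity], and strong induction removes the coefficients one
   after the other. *)
have bigK s : 1 < s < a -> `|big_moment P X s| <= ka.
  move=> /andP[s1 sa]; apply: (Rintegral_dom _ _ _ kaE).
  - apply: measurable_fun_ifT => //.
      by apply: measurable_fun_ltr => //; exact: (measurableT_comp (@normr_measurable R setT)).
    exact: (measurableT_comp (measurable_absX s)).
  - exact: (measurableT_comp (measurable_absX a)).
  move=> w; case: ifPn => [X1|_]; last by rewrite normr0 powR_ge0.
  by rewrite ger0_norm ?powR_ge0//; apply: ler_powR; exact: ltW.
have van V : UltraFilter V -> F `<=` V -> vanishes_at (ultra_difference L U V) a.
  move=> VV FV n; elim/ltn_ind: n => n IH.
  apply: (powlog_rigidity FF HW ZE Zcvg mX a1 k1E fin_moment inf_moment UU VV FU FV (B := ka)) => //.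
  by right.
have M_bound f C : weight_dom f C -> `|ultra_functional L U f| <= 1 * C by exact: ultra_functional_bound.
have M_D f g C C' k : weight_dom f C -> weight_dom g C' ->
    ultra_functional L U (fun y => f y + k * g y) = ultra_functional L U f + k * ultra_functional L U g.
  exact: (ultra_functionalD L_bound L_D UU).
exists (fun s => complex_extension (ultra_functional L U) (cpow0 s)); split.
- by move=> z z1; exact: (derivable_complex_extension ler01 M_bound M_D z1).
- exact: (cvg_locally_uniformly_extension FF L_bound L_D UU a1 van mE).
move=> q q1; rewrite (complex_extension_real M_bound M_D q1) ltcR.
have c : (fun t => L t (powlog q 0)) @ F --> ultra_functional L U (powlog q 0).
  exact: (cvg_powlog FF L_bound L_D UU a1 van).
have pE : powlog q 0 = (fun y => y `^ q) by apply/funext => y; rewrite /powlog expr0 mulr1.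
by rewrite pE in c; have /andP[] := moment_limit_gt0 q1 c.
Qed.
End finite_abscissa.
End moment_limits.

Theorem theorem2p2 (R : realType)
  (d : measure_display) (T : measurableType d) (P : probability T R)
  (W : R -> nat -> {RV P >-> R}) (X : {RV P >-> R}) (Xs : nat -> {RV P >-> R})
  (star : set_system R) (hstar : star = 0^'+ \/ star = +oo%R)
  (hW : forall t : R, 0 < t ->
    {ae P, forall w, is_subprobability (fun j => W t j w)})
  (hXid : forall j, distribution P (Xs j) = distribution P X)
  (hXind : mutually_independent P Xs)
  (hWX : forall t : R, 0 < t -> independent_families P (W t) Xs)
  (hmean : ('E_P[X] = 0)%E)
  (haX : (1 < moment_abscissa P X)%E)
  (d' : measure_display) (T' : measurableType d') (P' : probability T' R)
  (Rlim : {RV P' >-> R})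
  (hcvg : cvg_in_distribution P P' star (fun t => weighted_sum (W t) Xs) Rlim)
  (hnondeg : nondegenerate_rv P' Rlim) :
  let a := moment_abscissa P X in
  let m := fun (t : R) (s : R[i]) => power_moment P (W t) s in
  [/\ (a < 2%:E)%E ->
        exists2 c : R, 0 < c <= 1 &
          m t (fine a)%:C @[t --> star] --> (c%:C : R[i]^o),
      (2%:E <= a)%E ->
        exists2 c : R, 0 < c <= 1 &
          m t (2 : R)%:C @[t --> star] --> (c%:C : R[i]^o) &
      (a < 4%:E)%E -> ('E_P[fun w => powR `|X w| (fine a)] < +oo)%E ->
        exists mlim : R[i]^o -> R[i]^o,
        [/\ holomorphic_on [set s : R[i]^o | (1 < complex.Re s)%R] mlim,
            cvg_locally_uniformly star
              [set s : R[i]^o | (1 < complex.Re s)%R] m mlim &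
            forall q : R, 1 < q -> 0 < (mlim q%:C : R[i])]].
Proof.
move=> a m.
have Fstar : ProperFilter star.
  by case: hstar => ->; [exact: at_right_proper_filter|exact: proper_pinfty_nbhs].
have pos : \forall t \near star, 0 < t.
  by case: hstar => ->; [exact: nbhs_right_gt|exact: nbhs_pinfty_gt].
(* The hypotheses on the weights concern [t > 0]. Replacing every other index by 1 makes them hold
   for all [t], and the filter does not see the change. *)
pose pt (t : R) := if 0 < t then t else 1.
have pt0 t : 0 < pt t by rewrite /pt; case: ifP.
pose p t := capped (W (pt t)).
have HW t : iid_weighted P (p t) Xs X by exact: (iid_weighted_capped hXid hXind (hWX _ (pt0 t))).
have pW t : {ae P, forall w, forall n, p t n w = W (pt t) n w}.
  by apply: filterS (hW _ (pt0 t)) => w hw n; exact: capped_eq.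
pose Z t := weighted_sum (W (pt t)) Xs.
have ZE t : {ae P, forall w, Z t w = weighted_sum (p t) Xs w}.
  apply: filterS (pW t) => w hw; rewrite /Z /weighted_sum; congr (limn _).
  by apply/funext => n; apply: eq_bigr => j _; rewrite hw.
have mX : measurable_fun setT X by [].
have [k1 k1E'] := lt_moment_abscissa mX ltr01 haX.
have k1E : (\int[P]_w `|X w|%:E = k1%:E)%E.
  by rewrite -k1E'; apply: eq_integral => w _; rewrite powRr1.
have EX : \int[P]_w X w = 0.
  by have := hmean; rewrite unlock /Rintegral => ->.
have Zlim (f : R -> R) : continuous f -> bounded_fun f ->
    (fun t => \int[P]_w f (Z t w)) @ star --> \int[P']_w f (Rlim w).
  move=> cf bf; have [C fC] : exists C : R, forall y, `|f y| <= C.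
    by case: bf => M [_ hM]; exists (M + 1) => y; apply: (hM (M + 1)); rewrite ?ltrDl.
  have [_ fR] : P'.-integrable setT (EFin \o (fun w => f (Rlim w))) /\
      (\int[P']_w (f (Rlim w))%:E = (\int[P']_w f (Rlim w))%:E)%E.
    apply: (fin_int_bounded P' _ (fun w => fC (Rlim w))).
    by apply: measurableT_comp => //; exact: continuous_measurable_fun.
  have := hcvg f cf bf; rewrite unlock fR => hc.
  suff /fine_cvgP[_] : (fun t => (\int[P]_w f (Z t w))%:E) @ star --> (\int[P']_w f (Rlim w))%:E by [].
  apply: cvg_trans hc; apply: near_eq_cvg; apply: filterS pos => t t0.
  have [_ <-] := cvg_expectation_partial_sum (HW t) k1E cf fC (ZE t).
  by rewrite /Z /pt t0.
have Ynd : ~ {ae P', forall w, Rlim w = 0} by move=> H; apply: hnondeg; exists 0.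
have mE : \forall t \near star, forall s : R[i], 1 < complex.Re s ->
    m t s = complex_extension (weight_functional P (p t)) (cpow0 s).
  apply: filterS pos => t t0 s s1; rewrite /m.
  have -> : W t = W (pt t) by rewrite /pt t0.
  exact: (power_momentE (HW t) (pW t) (ltW s1)).
have fin_moment s : 1 < s -> (s%:E < a)%E -> exists k, (\int[P]_w (`|X w| `^ s)%:E = k%:E)%E.
  by move=> s1; apply: lt_moment_abscissa => //; exact: lt_trans s1.
have finite (b : R) : (a < b%:E)%E -> [/\ a = (fine a)%:E, 1 < fine a,
    forall s, 1 < s < fine a -> exists k, (\int[P]_w (`|X w| `^ s)%:E = k%:E)%E &
    forall e : R, 0 < e -> (\int[P]_w (`|X w| `^ (fine a + e))%:E = +oo)%E].
  move=> ab; have aE : a = (fine a)%:E.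
    rewrite fineK// fin_numE; apply/andP; split.
      by rewrite gt_eqF// (lt_trans _ haX)// ltNyr.
    by rewrite lt_eqF// (lt_trans ab)// ltry.
  have a1 : 1 < fine a by rewrite -lte_fin -aE.
  split => //.
  - by move=> s /andP[s1 sa]; apply: fin_moment => //; rewrite aE lte_fin.
  - move=> e e0; apply: gt_moment_abscissa => //; first by rewrite ltr_wpDl// ltW// (lt_trans ltr01).
    by rewrite -/a aE lte_fin ltrDl.
have mR : measurable_fun setT Rlim by [].
split.
- move=> /finite[aE a1 fm im].
  have [c Lc] := abscissa_moment_limit Fstar HW ZE Zlim mX k1E a1 fm im.
  exact: (power_moment_limit Fstar HW ZE mR Zlim Ynd mX k1E EX mE a1 Lc).
- rewrite le_eqVlt => /orP[/eqP a2|a2].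
    (* At [a = 2] no moment of order above 2 is finite and the variance may be infinite, so this
       value is treated by the argument at the abscissa; 3 is any real above [a]. *)
    have [|aE a1 fm im] := finite 3; first by rewrite -a2 lte_fin ltr_nat.
    have fa : fine a = 2 by rewrite -a2.
    have [c Lc] := abscissa_moment_limit Fstar HW ZE Zlim mX k1E a1 fm im.
    rewrite fa in a1 Lc.
    exact: (power_moment_limit Fstar HW ZE mR Zlim Ynd mX k1E EX mE a1 Lc).
  have [s s2 sa] : exists2 s : R, 2 < s & (s%:E < a)%E.
    case: (a) a2 => [r||//]; last by exists 3; rewrite ?ltry// ltr_nat.
    rewrite lte_fin => r2; exists ((2 + r) / 2); rewrite ?lte_fin; lra.
  have [k kE] := fin_moment s (lt_trans (ltr1n R 2) s2) sa.
  have [c Lc] := second_moment_limit Fstar HW ZE mR Zlim Ynd mX k1E EX s2 kE.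
  exact: (power_moment_limit Fstar HW ZE mR Zlim Ynd mX k1E EX mE (ltr1n R 2) Lc).
move=> /finite[aE a1 fm im]; rewrite unlock => Xa.
have [ka kaE] : exists ka, (\int[P]_w (`|X w| `^ fine a)%:E = ka%:E)%E.
  exists (fine (\int[P]_w (`|X w| `^ fine a)%:E)%E); rewrite fineK// ge0_fin_numE//.
  by apply: integral_ge0 => w _; rewrite lee_fin powR_ge0.
have [mlim [h1 h2 h3]] := holomorphic_moment_limit Fstar HW ZE mR Zlim Ynd mX k1E EX mE a1 fm im kaE.
by exists mlim; split.
Qed.
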